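(* Let $\mathcal{T}$ be a compact 3-manifold triangulation formed from $n$ tetrahedra. An integer vector $\mathbf{w}\in\mathbb{R}^{3n}$ is the joint vector representation of an embedded normal or octagonal almost normal surface in $\mathcal{T}$ if and only if all of the following hold: (1) at most one coordinate of $\mathbf{w}$ is negative; (2) $\mathbf{w}$ satisfies the quadrilateral matching equations for $\mathcal{T}$; (3) $\mathbf{w}$ satisfies the quadrilateral constraints for $\mathcal{T}$; (4) if there is a negative coordinate in $\mathbf{w}$, then this coordinate is equal to $-1$. Moreover, such a vector represents an embedded normal surface in $\mathcal{T}$ if and only if all of its coordinates are non-negative.
   Context: Triangulations. A compact 3-manifold triangulation $\mathcal{T}$ is formed from $n$ tetrahedra $\Delta_1,\ldots,\Delta_n$ by identifying some of their faces in pairs, so that the result is a compact 3-manifold (possibly with boundary) and every vertex of $\mathcal{T}$ has a small neighbourhood whose frontier is a sphere or a disc (ideal triangulations are excluded). Different faces (or edges, or vertices) of the same tetrahedron may be identified with each other. An edge of $\mathcal{T}$ is a boundary edge if it lies entirely within the boundary of the 3-manifold, and a non-boundary edge otherwise. Normal discs and octagons. In a tetrahedron, a normal arc is an arc in a face joining the interiors of two distinct edges of that face. Normal discs are properly embedded discs of two kinds. Triangles have boundary consisting of three normal arcs crossing distinct faces; there are four types, each separating one vertex from the other three. Quadrilaterals have boundary consisting of four normal arcs crossing distinct faces; there are three types, each separating one pair of opposite edges, which it does not meet, and meeting each of the other four edges exactly once. A normal octagon is a properly embedded disc whose boundary consists of eight normal arcs; there are three types, each corresponding to a pair of opposite edges,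 which it meets twice each, while it meets each of the other four edges exactly once. Numbering. In each tetrahedron the quadrilateral types and octagon types are numbered $1,2,3$ so that for each $i\in\{1,2,3\}$ the two edges that quadrilaterals of type $i$ never meet are the same two edges that octagons of type $i$ meet twice. Surfaces. An embedded normal surface in $\mathcal{T}$ is a properly embedded surface (possibly disconnected or empty) that meets each tetrahedron in a collection of disjoint normal discs (triangles and quadrilaterals). An octagonal almost normal surface in $\mathcal{T}$ is a properly embedded surface (possibly disconnected) whose intersection with the tetrahedra of $\mathcal{T}$ consists of zero or more normal discs together with, in precisely one tetrahedron, a single normal octagon (all pieces being pairwise disjoint within each tetrahedron). Joint vector representation. For an embedded normal or octagonal almost normal surface $S$, let $q_{i,1},q_{i,2},q_{i,3}$ and $k_{i,1},k_{i,2},k_{i,3}$ be the numbers of quadrilateral discs and octagonal discs of $S$, respectively, of types $1,2,3$ in $\Delta_i$. The joint vector representation of $S$ is $$\mathbf{j}(S)=\left(q_{1,1}-k_{1,1},\,q_{1,2}-k_{1,2},\,q_{1,3}-k_{1,3};\ \ldots;\ q_{n,1}-k_{n,1},\,q_{n,2}-k_{n,2},\,q_{n,3}-k_{n,3}\right)\in\mathbb{R}^{3n}.$$ Write an arbitrary vector as $\mathbf{w}=(j_{1,1},j_{1,2},j_{1,3};\ldots;j_{n,1},j_{n,2},j_{n,3})\in\mathbb{R}^{3n}$, where $j_{i,m}$ is the coordinate associated with type $m$ in $\Delta_i$. Quadrilateral matching equations. There is one equation for each non-boundary edge $e$ of $\mathcal{T}$. Arbitrarily label the two ends of $e$ as upper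 and lower. The tetrahedra containing $e$ are arranged in a cycle around $e$; choose a direction around this cycle and let $\Delta_{i_1},\ldots,\Delta_{i_t}$ be the tetrahedra encountered in order (a tetrahedron is listed once for each of its edges that is identified with $e$). In $\Delta_{i_k}$, write $U$ and $L$ for the upper and lower endpoints of the relevant edge, and $X,Y$ for the other two vertices, so that we enter $\Delta_{i_k}$ through face $LUX$ and leave through face $LUY$. The upward quadrilateral type, whose number is denoted $u_k$, is the one separating $\{U,X\}$ from $\{L,Y\}$; the downward quadrilateral type, whose number is denoted $d_k$, is the one separating $\{U,Y\}$ from $\{L,X\}$. The matching equation for $e$ is $$j_{i_1,u_1}+j_{i_2,u_2}+\cdots+j_{i_t,u_t}=j_{i_1,d_1}+j_{i_2,d_2}+\cdots+j_{i_t,d_t}.$$ Quadrilateral constraints. $\mathbf{w}\in\mathbb{R}^{3n}$ satisfies these if for every $i\in\{1,\ldots,n\}$ at most one of $j_{i,1},j_{i,2},j_{i,3}$ is non-zero. Both the matching equations and the constraints are applied literally to the (possibly negative) coordinates of $\mathbf{w}$. *)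

(* Defs.v *)
From mathcomp Require Import all_boot all_order all_algebra fingroup perm.
From mathcomp Require Import all_classical all_reals all_analysis.
From Stdlib Require Import Relation_Operators.
Import Order.TTheory GRing.Theory Num.Theory.
Import numFieldNormedType.Exports.

Set Implicit Arguments.
Unset Strict Implicit.
Unset Printing Implicit Defensive.

Local Open Scope classical_set_scope.
Local Open Scope ring_scope.

(** * Face gluings *)

(* Face [a] of a tetrahedron is the face opposite to vertex [a].
   [glue i a = Some (j, s)] means that face [a] of tetrahedron [i] is identified
   with face [s a] of tetrahedron [j], each vertex [v != a] of that face going to
   vertex [s v]; a bijection between the vertices of two faces extends uniquely
   to such an [s].  [glue i a = None] means that the face is left unglued.
   A face is never glued to itself. *)
Record face_gluing (n : nat) := FaceGluing {
  glue : 'I_n -> 'I_4 -> option ('I_n * {perm 'I_4}) ;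
  glue_sym : forall i a j s,
    glue i a = Some (j, s) -> glue j (s a) = Some (i, (s^-1)%g) ;
  glue_irr : forall i a j s, glue i a = Some (j, s) -> (j, s a) <> (i, a) }.

(** * The glued space *)

Section Simplex.
Variable R : realType.

(* Points of a tetrahedron, in barycentric coordinates. *)
Definition tetra : set 'rV[R]_4 :=
  [set x : 'rV[R]_4 | (forall a, 0 <= x 0 a) /\ \sum_a x 0 a = 1].

Definition face (a : 'I_4) : set 'rV[R]_4 := [set x | tetra x /\ x 0 a = 0].

Definition face_interior (a : 'I_4) : set 'rV[R]_4 :=
  [set x | face a x /\ forall b, b != a -> 0 < x 0 b].

Definition edge (a b : 'I_4) : set 'rV[R]_4 :=
  [set x | tetra x /\ forall c, c != a -> c != b -> x 0 c = 0].

Definition edge_interior (a b : 'I_4) : set 'rV[R]_4 :=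
  [set x | edge a b x /\ 0 < x 0 a /\ 0 < x 0 b].

Definition tetra_boundary : set 'rV[R]_4 := \bigcup_a face a.

Definition tetra_vertex (a : 'I_4) : 'rV[R]_4 := delta_mx 0 a.

Variables (n : nat) (T : face_gluing n).

Definition face_step (p q : 'I_n * 'rV[R]_4) : Prop :=
  exists a s, [/\ glue T p.1 a = Some (q.1, s), face a p.2 &
                  forall v, q.2 0 (s v) = p.2 0 v].

Definition identified : 'I_n * 'rV[R]_4 -> 'I_n * 'rV[R]_4 -> Prop :=
  clos_refl_sym_trans _ face_step.

(* A subset of the glued space |T| is given by its preimage in the disjoint union
   of the tetrahedra: a family [A] of subsets of [tetra] that is saturated. *)
Definition saturated (A : 'I_n -> set 'rV[R]_4) : Prop :=
  (forall i, A i `<=` tetra) /\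
  (forall p q, face_step p q -> A p.1 p.2 -> A q.1 q.2).

Definition closed_subset (A : 'I_n -> set 'rV[R]_4) : Prop :=
  saturated A /\ forall i, closed (A i).

Definition open_subset (A : 'I_n -> set 'rV[R]_4) : Prop :=
  saturated A /\ forall i, exists2 O, open O & A i = O `&` tetra.

(* [A] is a closed subset of |T|, hence compact, so a continuous bijection from
   it (for the quotient topology) onto [Y] is a homeomorphism. *)
Definition homeomorphic_to (A : 'I_n -> set 'rV[R]_4)
    (d : nat) (Y : set 'rV[R]_d) : Prop :=
  closed_subset A /\
  exists phi : 'I_n -> 'rV[R]_4 -> 'rV[R]_d,
  [/\ forall i, {within A i, continuous (phi i)},
      forall i x j y, A i x -> A j y ->
        (phi i x = phi j y <-> identified (i, x) (j, y)) &
      \bigcup_i (phi i @` A i) = Y].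

(* The norm on row vectors is the sup norm, so these are a solid cube and its
   surface: a closed ball and a sphere up to homeomorphism. *)
Definition ball_set (d : nat) : set 'rV[R]_d := [set x | `|x| <= 1].
Definition sphere_set (d : nat) : set 'rV[R]_d := [set x | `|x| = 1].

(* A topological 3-manifold, possibly with boundary: every point has a
   neighbourhood homeomorphic to a closed 3-ball, in which the point may lie
   anywhere.  Compactness and the Hausdorff property hold for every finite
   gluing. *)
Definition manifold3 : Prop :=
  forall i x, tetra x ->
  exists U N : 'I_n -> set 'rV[R]_4,
  [/\ open_subset U, U i x, forall j, U j `<=` N j &
      homeomorphic_to N (@ball_set 3)].

(* The frontier of the neighbourhood of the vertex [v] of tetrahedron [i] formed
   by the points whose barycentric coordinate at some tetrahedron vertex
   identified with it exceeds 2/3. *)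
Definition vertex_link (i : 'I_n) (v : 'I_4) (j : 'I_n) : set 'rV[R]_4 :=
  [set x | tetra x /\
    exists2 u, identified (i, tetra_vertex v) (j, tetra_vertex u) &
               x 0 u = 2 / 3].

Definition compact_3manifold_triangulation : Prop :=
  manifold3 /\
  forall i v, homeomorphic_to (vertex_link i v) (@sphere_set 3) \/
              homeomorphic_to (vertex_link i v) (@ball_set 2).

Definition manifold_boundary (p : 'I_n * 'rV[R]_4) : Prop :=
  exists j y c, [/\ identified p (j, y), glue T j c = None & face c y].

Definition boundary_edge (i : 'I_n) (a b : 'I_4) : Prop :=
  forall x, edge a b x -> manifold_boundary (i, x).

End Simplex.

(** * Normal discs and octagons *)

(* Types [0,1,2] correspond to the vertex partitions 01|23, 02|13, 03|12, for
   both quadrilaterals and octagons.  [same_side m a b] holds iff [a] and [b] lie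
   in the same block, that is, iff ab is one of the two opposite edges attached
   to type [m]. *)
Definition same_side (m : 'I_3) (a b : 'I_4) : bool :=
  let side (c : 'I_4) := (c == 0%N :> nat) || (c == m.+1 :> nat) in
  side a == side b.

Inductive disc_type := Tri of 'I_4 | Quad of 'I_3 | Oct of 'I_3.

Definition is_quad (m : 'I_3) (t : disc_type) : bool :=
  if t is Quad m' then m' == m else false.
Definition is_oct (m : 'I_3) (t : disc_type) : bool :=
  if t is Oct m' then m' == m else false.

(* The number of times a piece of type [t] meets the edge ab. *)
Definition edge_weight (t : disc_type) (a b : 'I_4) : nat :=
  match t with
  | Tri v => (a == v) || (b == v)
  | Quad m => if same_side m a b then 0 else 1
  | Oct m => if same_side m a b then 2 else 1
  end%N.

(* The number of boundary arcs of a piece of type [t] in face [a]: triangles have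
   three arcs and quadrilaterals four, all in distinct faces.  For octagons each
   face has edges met twice, once and once, which forces two of the eight arcs in
   each face. *)
Definition face_arcs (t : disc_type) (a : 'I_4) : nat :=
  match t with
  | Tri v => (a != v)
  | Quad _ => 1
  | Oct _ => 2
  end%N.

Section Surfaces.
Variable R : realType.

(* Two distinct edges of a face share one vertex [b]. *)
Definition normal_arc (a : 'I_4) (A : set 'rV[R]_4) : Prop :=
  exists b c d, uniq [:: a; b; c; d] /\
  exists g : R -> 'rV[R]_4,
  [/\ {within `[0, 1], continuous g}, {in `[0, 1] &, injective g},
      edge_interior b c (g 0) /\ edge_interior b d (g 1),
      forall t, 0 < t < 1 -> face_interior a (g t) &
      A = g @` `[0, 1]].

Definition properly_embedded_disc (D : set 'rV[R]_4) : Prop :=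
  exists h : 'rV[R]_2 -> 'rV[R]_4,
  [/\ {within @ball_set R 2, continuous h}, set_inj (@ball_set R 2) h,
      D = h @` @ball_set R 2, D `<=` @tetra R &
      D `&` @tetra_boundary R = h @` @sphere_set R 2].

Definition normal_piece (t : disc_type) (D : set 'rV[R]_4) : Prop :=
  [/\ properly_embedded_disc D,
      forall a, exists A : 'I_(face_arcs t a) -> set 'rV[R]_4,
        [/\ forall l, normal_arc a (A l), trivIset setT A &
            D `&` face a = \bigcup_l A l] &
      forall a b, a != b -> (D `&` edge a b #= `I_(edge_weight t a b))%card].

(* A finite family of typed pieces in each tetrahedron. *)
Record pieces (n : nat) := Pieces {
  npieces : 'I_n -> nat ;
  piece_type : forall i, 'I_(npieces i) -> disc_type ;
  piece_set : forall i, 'I_(npieces i) -> set 'rV[R]_4 }.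
Arguments piece_type {n} p {i} l.
Arguments piece_set {n} p {i} l.

Definition carrier n (S : pieces n) (i : 'I_n) : set 'rV[R]_4 :=
  \bigcup_(l : 'I_(npieces S i)) piece_set S l.

(* The subset [carrier S] of |T| meets each tetrahedron exactly in the pieces of
   [S].  Such a subset is automatically a properly embedded surface: pieces on
   the two sides of a glued face share their arcs there, and the pieces around a
   point on an edge close up into a disc (or a half-disc, at the boundary). *)
Definition made_of_pieces n (T : face_gluing n) (S : pieces n) : Prop :=
  [/\ forall i (l : 'I_(npieces S i)), normal_piece (piece_type S l) (piece_set S l),
      forall i, trivIset setT (@piece_set n S i) &
      saturated T (carrier S)].

Definition quad_count n (S : pieces n) (i : 'I_n) (m : 'I_3) : nat :=
  #|[pred l : 'I_(npieces S i) | is_quad m (piece_type S l)]|.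
Definition oct_count n (S : pieces n) (i : 'I_n) (m : 'I_3) : nat :=
  #|[pred l : 'I_(npieces S i) | is_oct m (piece_type S l)]|.
Definition total_octs n (S : pieces n) : nat :=
  (\sum_i \sum_m oct_count S i m)%N.

Definition embedded_normal n (T : face_gluing n) (S : pieces n) : Prop :=
  made_of_pieces T S /\ total_octs S = 0%N.
Definition octagonal_almost_normal n (T : face_gluing n) (S : pieces n) : Prop :=
  made_of_pieces T S /\ total_octs S = 1%N.

Definition joint_vector n (S : pieces n) : 'M[int]_(n, 3) :=
  \matrix_(i, m) ((quad_count S i m)%:Z - (oct_count S i m)%:Z).

End Surfaces.

(** * Matching equations and constraints *)

(* A tetrahedron visited while going around an edge, with its vertices labelled
   U, L, X, Y: it is entered through face LUX and left through face LUY. *)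
Notation visit n := ('I_n * {perm 'I_4})%type.

Definition idxU : 'I_4 := @Ordinal 4 0 isT.
Definition idxL : 'I_4 := @Ordinal 4 1 isT.
Definition idxX : 'I_4 := @Ordinal 4 2 isT.
Definition idxY : 'I_4 := @Ordinal 4 3 isT.

(* Face LUY is opposite X.  In the next tetrahedron the image of Y plays the role
   of X; the product of permutations applies its left factor first.  The [None]
   case does not arise around a non-boundary edge. *)
Definition next_visit n (T : face_gluing n) (f : visit n) : visit n :=
  if glue T f.1 (f.2 idxX) is Some (j, s)
  then (j, (tperm idxX idxY * f.2 * s)%g) else f.

(* The quadrilateral type separating {a, b} from the other two vertices. *)
Definition quad_separating (a b : 'I_4) : 'I_3 :=
  odflt ord0 [pick m | same_side m a b].

Definition upward n (f : visit n) : 'I_3 :=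
  quad_separating (f.2 idxU) (f.2 idxX).
Definition downward n (f : visit n) : 'I_3 :=
  quad_separating (f.2 idxU) (f.2 idxY).

(* One equation for each non-boundary edge together with all the choices made:
   starting tetrahedron, upper end and direction. *)
Definition matching_equations (R : realType) n (T : face_gluing n)
    (w : 'M[int]_(n, 3)) : Prop :=
  forall f : visit n, ~ boundary_edge R T f.1 (f.2 idxU) (f.2 idxL) ->
    \sum_(g <- orbit (next_visit T) f) w g.1 (upward g) =
    \sum_(g <- orbit (next_visit T) f) w g.1 (downward g).

Definition quad_constraints n (w : 'M[int]_(n, 3)) : Prop :=
  forall i m m', w i m != 0 -> w i m' != 0 -> m = m'.

(* Main.v *)
(* A surface made of normal pieces determines the number of its arcs around each
   corner of each face, and this number is unchanged by a face gluing.  Going once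
   around an interior edge, the corner numbers add up to the matching equation.
   Two quadrilaterals of different types, or a quadrilateral and an octagon of
   different types, in one tetrahedron would have arcs that cross in a face: a
   planar intermediate value theorem, proved by showing that an integer cocycle on
   a square is a coboundary, so no theory of the degree is needed.

   Conversely, the matching equations say that the prescribed jumps [w] of the
   number of triangles from one tetrahedron vertex to the next have zero sum around
   every edge.  They are therefore the jumps of a real potential on the ends of the
   edges, extended linearly over the link of the vertex.  This gives a continuous
   map of the link to [R / Z].  The link is a sphere or a disc, both images of a
   square, so the map lifts to [R] and the difference of the two real functions is
   an integer-valued function with the prescribed jumps; a constant makes it
   positive.  This fixes the numbers of triangles, and in each tetrahedron one
   realises triangles and quadrilaterals by planes and the octagon by a cone over
   its boundary, all spaced so that the pieces meet every edge in equally spaced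
   points and hence match along the faces. *)

From mathcomp Require Import all_boot all_order all_algebra fingroup perm.
From mathcomp Require Import all_classical all_reals all_analysis.
From mathcomp Require Import ring lra zify finmap.
From Stdlib Require Import Relation_Operators.
Require Import Defs.
Import Order.TTheory GRing.Theory Num.Theory.
Import numFieldNormedType.Exports.

Set Implicit Arguments.
Unset Strict Implicit.
Unset Printing Implicit Defensive.

Local Open Scope classical_set_scope.
Local Open Scope ring_scope.

(** * Integer cocycles on star-shaped sets *)

(** The signs come from the octagon itself. About a corner [b] of the face opposite [a] it has one
    arc, minus one if [ab] belongs to its type. The first term depends on [b] alone and merges with
    the number of triangles at [b]; what is left behaves like a quadrilateral counted with
    coefficient [-1]. The converse therefore solves for triangles plus octagon and subtracts the
    octagon at the end, which is why strictly positive numbers are wanted. Two obstacles shape the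
    rest. Pieces are arbitrary topological discs, so a crossing has to be derived from the ends of
    their arcs alone. And the link of a vertex is a sphere or a disc only up to homeomorphism, so
    closed paths of link triangles cannot be contracted combinatorially; hence the passage through
    continuous functions. A boundary edge carries no equation: the walk around it turns back at the
    unglued faces, and every jump is cancelled by its reverse. *)

Section UniformScale.
Variable R : realType.

(** A Lebesgue number argument. Since [good] passes to subsets, half of a radius that works at [p]
    also works for all nearby centres, and compactness in near-covering form yields a common
    radius. *)
Lemma compact_uniform_scale (V : pseudoMetricType R) (K : set V)
    (good : set V -> Prop) :
  compact K ->
  (forall A B, A `<=` B -> good B -> good A) ->
  (forall p, K p -> exists2 e : R, 0 < e & good (K `&` ball p e)) ->
  exists2 e : R, 0 < e & forall p, K p -> good (K `&` ball p e).
Proof.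
move=> /compact_near_coveringP cK gsub loc.
have : \forall e \near 0^'+, K `<=` (fun p => good (K `&` ball p (e : R))).
  apply: (cK R (0^'+) (fun e p => good (K `&` ball p e))) => p Kp.
  have [e e0 ge] := loc p Kp.
  have e20 : 0 < e / 2 by rewrite divr_gt0.
  exists (ball p (e / 2), [set d : R | 0 < d /\ d < e / 2]) => /=.
    split; first exact: nbhsx_ballx.
    near=> d; split; near: d; [exact: nbhs_right_gt | exact: nbhs_right_lt].
  move=> [q d] /= [pq [d0 de]].
  apply: gsub ge => z [Kz qz]; split=> //.
  apply: (@le_ball _ _ _ (e / 2 + d)); first by lra.
  exact: ball_triangle pq qz.
case=> e /= e0 he; exists (e / 2); first by rewrite divr_gt0.
apply: he => /=; last by rewrite divr_gt0.
by rewrite sub0r normrN gtr0_norm ?divr_gt0// ltr_pdivrMr// ltr_pMr// ltr1n.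
Unshelve. all: by end_near. Qed.

Lemma exists_fine (e C : R) : 0 < e -> 0 <= C -> exists N : nat, C / N.+1%:R < e.
Proof.
move=> e0 C0; exists (Num.truncn (C / e)).
rewrite ltr_pdivrMr ?ltr0n// mulrC -ltr_pdivrMr//.
exact: truncnS_gt.
Qed.

Lemma uniformly_const (E : Type) (f : R -> E) (e : R) : 0 < e ->
  (forall s t, 0 <= s <= 1 -> 0 <= t <= 1 -> `|s - t| < e -> f s = f t) ->
  f 0 = f 1.
Proof.
move=> e0 fe; have [N Ne] := exists_fine e0 ler01.
have stp k : (k <= N.+1)%N -> f 0 = f (k%:R / N.+1%:R).
  elim: k => [|k IH] kN; first by rewrite mul0r.
  rewrite IH; last exact: ltnW.
  have N0 : (0 : R) < N.+1%:R by rewrite ltr0n.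
  apply: fe; rewrite ?divr_ge0 ?ler0n ?ler_pdivrMr ?mul1r ?ler_nat //=.
    exact: ltnW.
  by rewrite -mulrBl -natr1 opprD addrA subrr sub0r mulN1r normrN gtr0_norm
     ?invr_gt0// -[_^-1]mul1r.
by rewrite (stp N.+1)// divff// pnatr_eq0.
Qed.

(* The integer cocycle [c] bounds because the set contracts radially to [0]:
   [s] adds up [c] along the segment from [0], and comparing two nearby segments
   rung by rung telescopes. *)
Lemma star_cocycle (V : normedModType R) (X : set V) (c : V -> V -> int) (e : R) :
  0 < e ->
  (forall p, X p -> `|p| <= 1) ->
  (forall p (t : R), X p -> 0 <= t <= 1 -> X (t *: p)) ->
  (forall p q r, X p -> X q -> X r -> `|p - q| < e -> `|q - r| < e ->
     `|p - r| < e -> c p q + c q r = c p r) ->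
  exists s : V -> int, forall p q, X p -> X q -> `|p - q| < e / 2 ->
    s q - s p = c p q.
Proof.
move=> e0 X1 Xstar cc.
have [N Ne] := exists_fine (divr_gt0 e0 (ltr0Sn R 1)) ler01.
have N0 : (0 : R) < N.+1%:R by rewrite ltr0n.
pose pt k (p : V) := (k%:R / N.+1%:R : R) *: p.
have ptX k p : X p -> (k <= N.+1)%N -> X (pt k p).
  move=> Xp kN; apply: Xstar => //.
  by rewrite divr_ge0 ?ler0n //= ler_pdivrMr// mul1r ler_nat.
have ptS k p : X p -> `|pt k p - pt k.+1 p| < e / 2.
  move=> Xp; rewrite /pt -scalerBl -mulrBl -[in X in _ - X]natr1 opprD addrA.
  rewrite subrr sub0r mulN1r normrZ normrN gtr0_norm ?invr_gt0//.
  apply: le_lt_trans Ne; rewrite -[leRHS]mulr1 mul1r.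
  by rewrite ler_pM2l ?invr_gt0// X1.
have ptd k p q : (k <= N.+1)%N -> `|p - q| < e / 2 -> `|pt k p - pt k q| < e / 2.
  move=> kN; apply: le_lt_trans; rewrite /pt -scalerBr normrZ.
  rewrite ger0_norm ?divr_ge0 ?ler0n//.
  by rewrite ler_piMl// ler_pdivrMr// mul1r ler_nat.
have e2 : e / 2 + e / 2 = e by rewrite -splitr.
have le2 : e / 2 < e by rewrite -[ltRHS]e2 ltrDl divr_gt0.
exists (fun p => \sum_(0 <= k < N.+1) c (pt k p) (pt k.+1 p)) => p q Xp Xq pq.
have czz z : X z -> c z z = 0.
  move=> Xz; apply: (@addrI _ (c z z)).
  by rewrite addr0 cc// subrr normr0.
(* A ladder between the two segments. Each square is cut by a diagonal into two triangles; its sides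
   are shorter than [e / 2] and the diagonal shorter than [e], so the cocycle identity applies to
   both. *)
have tele m : (m <= N.+1)%N ->
    \sum_(0 <= k < m) c (pt k q) (pt k.+1 q) -
    \sum_(0 <= k < m) c (pt k p) (pt k.+1 p) = c (pt m p) (pt m q).
  elim: m => [|m IH] mN.
    by rewrite !big_geq// subrr /pt mul0r !scale0r czz// -(scale0r p) -[0](mul0r N.+1%:R^-1); exact: (@ptX 0%N).
  rewrite !big_nat_recr//= opprD addrACA IH; last exact: ltnW.
  have Xpm := ptX _ _ Xp (ltnW mN); have Xqm := ptX _ _ Xq (ltnW mN).
  have XpS := ptX _ _ Xp mN; have XqS := ptX _ _ Xq mN.
  have E1 : c (pt m p) (pt m q) + c (pt m q) (pt m.+1 q) = c (pt m p) (pt m.+1 q).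
    apply: cc => //.
    - exact: lt_trans (ptd _ _ _ (ltnW mN) pq) le2.
    - exact: lt_trans (ptS _ _ Xq) le2.
    - rewrite -[ltRHS]e2 -[ltLHS](_ : `|(pt m p - pt m q) + (pt m q - pt m.+1 q)| = _); last by rewrite addrA subrK.
      by apply: le_lt_trans (ler_normD _ _) _; rewrite ltrD ?ptS// ptd// ltnW.
  have E2 : c (pt m p) (pt m.+1 p) + c (pt m.+1 p) (pt m.+1 q) = c (pt m p) (pt m.+1 q).
    apply: cc => //.
    - exact: lt_trans (ptS _ _ Xp) le2.
    - exact: lt_trans (ptd _ _ _ mN pq) le2.
    - rewrite -[ltRHS]e2 -[ltLHS](_ : `|(pt m p - pt m.+1 p) + (pt m.+1 p - pt m.+1 q)| = _); last by rewrite addrA subrK.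
      by apply: le_lt_trans (ler_normD _ _) _; rewrite ltrD ?ptS// ptd.
  by rewrite addrA E1 -E2 addrAC subrr add0r.
by rewrite tele// /pt divff ?pnatr_eq0// !scale1r.
Qed.

End UniformScale.

(** * A planar intermediate value theorem *)

Section Crossing.
Variable R : realType.

Lemma within_continuous_ball (V : pseudoMetricType R) (W : normedModType R)
    (K : set V) (f : V -> W) (p : V) (e : R) :
  {within K, continuous f} -> K p -> 0 < e ->
  exists2 d : R, 0 < d & forall q, K q -> ball p d q -> `|f q - f p| < e.
Proof.
move=> cf Kp e0.
have /cvgrPdist_lt/(_ e e0) := (subspace_continuousP K f).1 cf p Kp.
rewrite near_withinE => /nbhs_ballP[d /= d0 hd]; exists d => // q Kq pq.
by rewrite distrC; apply: hd.
Qed.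

Lemma bounded_square_star (X := [set p : R * R | 0 <= p.1 <= 1 /\ 0 <= p.2 <= 1]) :
  [/\ forall p, X p -> `|p| <= 1,
      forall p (t : R), X p -> 0 <= t <= 1 -> X (t *: p) & compact X].
Proof.
rewrite /X {X}; split.
- move=> [a b] /= [/andP[a0 a1] /andP[b0 b1]].
  by rewrite prod_normE ge_max !ger0_norm// a1 b1.
- move=> [a b] t /= [/andP[a0 a1] /andP[b0 b1]] /andP[t0 t1].
  by split; rewrite /= mulr_ge0 //= mulr_ile1.
- have -> : [set p : R * R | 0 <= p.1 <= 1 /\ 0 <= p.2 <= 1] = `[0, 1]%classic `*` `[0, 1]%classic.
    by apply/seteqP; split => -[a b]; rewrite /= !in_itv.
  exact: compact_setX (@segment_compact _ _ _) (@segment_compact _ _ _).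
Qed.

(* The vector [(G, D)] would turn once around the origin along the boundary of
   the square; the cocycle below counts crossings of the negative [G]-axis. *)
Lemma square_zero (G D : R * R -> R)
    (X := [set p : R * R | 0 <= p.1 <= 1 /\ 0 <= p.2 <= 1]) :
  {within X, continuous G} -> {within X, continuous D} ->
  (forall t, 0 <= t <= 1 -> D (0, t) <= 0) ->
  (forall s, 0 <= s <= 1 -> 0 <= D (s, 0)) ->
  0 < G (0, 0) ->
  (forall s, 0 <= s <= 1 -> 0 < G (s, 1) -> D (s, 1) < 0) ->
  (forall t, 0 <= t <= 1 -> G (1, t) <= 0) \/
    (forall t, 0 <= t <= 1 -> 0 <= G (1, t)) /\ 0 < D (1, 1) ->
  exists p, [/\ X p, G p = 0 & D p = 0].
Proof.
move=> cG cD s0 t0 c00 t1 s1; apply: contrapT => noz.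
have [X1 Xstar Xcpt] := bounded_square_star; rewrite -/X in X1 Xstar Xcpt.
(* Without a common zero, one of the two functions keeps its sign near every point. At a scale where
   this holds uniformly, the cocycle identity is a check of four cases. *)
pose good A := [\/ forall p, A p -> 0 < G p, forall p, A p -> G p < 0,
  forall p, A p -> 0 < D p | forall p, A p -> D p < 0].
have [||e e0 he] := compact_uniform_scale (good := good) Xcpt.
- by move=> A B AB [] h; [constructor 1|constructor 2|constructor 3|constructor 4];
    move=> p /AB; exact: h.
- move=> p Xp.
  have near0 (f : R * R -> R) : {within X, continuous f} -> f p != 0 ->
     exists2 d : R, 0 < d &
      (forall q, (X `&` ball p d) q -> 0 < f q) \/
      (forall q, (X `&` ball p d) q -> f q < 0).
    move=> cf fp; have fp0 : 0 < `|f p| by rewrite normr_gt0.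
    have [d d0 hd] := within_continuous_ball cf Xp fp0.
    exists d => //; case: (ltrgtP (f p) 0) fp => // sg _; [right|left];
      move=> q [Xq bq]; have := hd q Xq bq.
    + by rewrite [in ltRHS]ltr0_norm// ltr_norml => /andP[]; lra.
    + by rewrite [in ltRHS]gtr0_norm// ltr_norml => /andP[]; lra.
  have [Gp|Gp] := eqVneq (G p) 0; last first.
    have [d d0 [] h] := near0 G cG Gp; exists d => //.
      by constructor 1.
    by constructor 2.
  have [Dp|Dp] := eqVneq (D p) 0; first by case: noz; exists p.
  have [d d0 [] h] := near0 D cD Dp; exists d => //.
    by constructor 3.
  by constructor 4.
pose up p : int := if 0 < D p then 1 else 0.
pose c p q : int := if G p < 0 then up q - up p else 0.
have ballE (p q : R * R) : `|p - q| < e -> ball p e q by rewrite -ball_normE.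
have ballp (p : R * R) : ball p e p by apply: ballxx.
have cc p q r : X p -> X q -> X r -> `|p - q| < e -> `|q - r| < e ->
    `|p - r| < e -> c p q + c q r = c p r.
  move=> Xp Xq Xr pq qr pr; have := he p Xp.
  have Ap : (X `&` ball p e) p by [].
  have Aq : (X `&` ball p e) q by split=> //; exact: ballE.
  have Ar : (X `&` ball p e) r by split=> //; exact: ballE.
  rewrite /c /up; case=> h; have hp := h _ Ap; have hq := h _ Aq; have hr := h _ Ar.
  - by rewrite (lt_gtF hp) (lt_gtF hq).
  - by rewrite hp hq addrC addrA subrK.
  - by rewrite hp hq hr; do ?case: ifP.
  - by rewrite (lt_gtF hp) (lt_gtF hq) (lt_gtF hr); do ?case: ifP.
have [s hs] := star_cocycle e0 X1 Xstar cc.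
have e20 : 0 < e / 2 by rewrite divr_gt0.
have near_good p q : X p -> X q -> `|p - q| < e / 2 ->
    s q = s p + c p q /\ [\/ 0 < G p /\ 0 < G q, G p < 0 /\ G q < 0,
       0 < D p /\ 0 < D q | D p < 0 /\ D q < 0].
  move=> Xp Xq pq; rewrite -hs//; split; first by rewrite addrC subrK.
  have Ap : (X `&` ball p e) p by [].
  have Aq : (X `&` ball p e) q.
    by split=> //; apply: ballE; apply: lt_trans pq _; rewrite ltr_pdivrMr// ltr_pMr// ltr1n.
  by case: (he p Xp) => h; [constructor 1|constructor 2|constructor 3|constructor 4];
    split; exact: h.
have I01 : 0 <= (0 : R) <= 1 by rewrite lexx ler01.
have I11 : 0 <= (1 : R) <= 1 by rewrite lexx ler01.
have up0 t : 0 <= t <= 1 -> up (0, t) = 0 by move=> ht; rewrite /up ltNge s0.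
(* Going once round the square: along each side a combination of [s], [up] and the sign of [G] is
   constant, and the four resulting equations are incompatible. *)
have side0 : s (0, 0) = s (0, 1).
  apply: (uniformly_const (f := fun t => s (0, t)) e20) => t t' ht ht' tt.
  have [|||-> _] // := near_good (0, t) (0, t').
    by rewrite prod_normE /= subrr normr0 gt_max e20.
  by rewrite /c !up0// subrr if_same addr0.
have side1 : s (0, 1) - up (0, 1) = s (1, 1) - up (1, 1).
  apply: (uniformly_const (f := fun t => s (t, 1) - up (t, 1)) e20) => t t' ht ht' tt.
  have [|||-> sg] // := near_good (t, 1) (t', 1).
    by rewrite prod_normE /= subrr normr0 gt_max e20 andbT.
  rewrite /c; case: sg => -[gp gq].
  - by rewrite (lt_gtF gp) addr0 /up (lt_gtF (t1 _ ht gp)) (lt_gtF (t1 _ ht' gq)).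
  - by rewrite gp; ring.
  - by rewrite /up gp gq subrr if_same; ring.
  - by rewrite /up (lt_gtF gp) (lt_gtF gq) subrr if_same; ring.
have side2 : s (0, 0) = s (1, 0) + (if G (1, 0) < 0 then 1 - up (1, 0) else 0).
  pose k p : int := if G p < 0 then 1 - up p else 0.
  have k0 : k (0, 0) = 0 by rewrite /k lt_gtF.
  transitivity (s (0, 0) + k (0, 0)); first by rewrite k0 addr0.
  apply: (uniformly_const (f := fun t => s (t, 0) + k (t, 0)) e20) => t t' ht ht' tt.
  have [|||-> sg] // := near_good (t, 0) (t', 0).
    by rewrite prod_normE /= subrr normr0 gt_max e20 andbT.
  rewrite /c /k; case: sg => -[gp gq].
  - by rewrite (lt_gtF gp) (lt_gtF gq) /=; ring.
  - by rewrite gp gq; ring.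
  - by rewrite /up gp gq subrr !if_same; ring.
  - by have := t0 _ ht; rewrite leNgt gp.
have up01 : up (0, 1) = 0 by rewrite /up ltNge s0.
case: s1 => [s1|[s1 c11]].
- have side3 : s (1, 0) - up (1, 0) = s (1, 1) - up (1, 1).
    apply: (uniformly_const (f := fun t => s (1, t) - up (1, t)) e20) => t t' ht ht' tt.
    have [|||-> sg] // := near_good (1, t) (1, t').
      by rewrite prod_normE /= subrr normr0 gt_max e20.
    rewrite /c; case: sg => -[gp gq].
    + by have := s1 _ ht; rewrite leNgt gp.
    + by rewrite gp; ring.
    + by rewrite /up gp gq subrr if_same; ring.
    + by rewrite /up (lt_gtF gp) (lt_gtF gq) subrr if_same; ring.
  have := s1 0 I01; rewrite le_eqVlt => /orP[/eqP g10|g10].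
    have d10 : up (1, 0) = 1.
      rewrite /up lt_neqAle t0// andbT ifT//; apply/eqP => d10; apply: noz.
      by exists (1, 0); rewrite /X /= I01 I11.
    by move: side2; rewrite g10 ltxx; clear -side0 side1 side3 up01 d10; lia.
  by move: side2; rewrite g10; clear -side0 side1 side3 up01; lia.
- have side3 : s (1, 0) = s (1, 1).
    apply: (uniformly_const (f := fun t => s (1, t)) e20) => t t' ht ht' tt.
    have [|||-> sg] // := near_good (1, t) (1, t').
      by rewrite prod_normE /= subrr normr0 gt_max e20.
    by rewrite /c ltNge s1//= addr0.
  have up11 : up (1, 1) = 1 by rewrite /up c11.
  have g10 : (G (1, 0) < 0) = false by rewrite ltNge s1.
  by move: side2 side1; rewrite g10 up01 up11 -side0 side3; clear; lia.
Qed.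

End Crossing.

(** * Crossing arcs in a face *)

Section Sides.

Lemma all_ord (k : nat) (P : nat -> bool) : all P (iota 0 k) -> forall a : 'I_k, P a.
Proof. by move=> /allP h a; apply: h; rewrite mem_iota /=. Qed.

(** A copy of [same_side] on natural numbers, on which finite checks run by [vm_compute]; [all_ord]
    and [has_ord] carry the results back to ordinals. *)
Definition sides (m a b : nat) : bool :=
  ((a == 0) || (a == m.+1)) == ((b == 0) || (b == m.+1)).

Lemma same_sideE (m : 'I_3) (a b : 'I_4) : same_side m a b = sides m a b.
Proof. by []. Qed.

Lemma same_sideC m a b : same_side m a b = same_side m b a.
Proof. by rewrite /same_side eq_sym. Qed.

Lemma same_side_uniq (m : 'I_3) (a b c d : 'I_4) :
  uniq [:: a; b; c; d] -> same_side m a b ->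
  [/\ same_side m c d, same_side m a c = false, same_side m a d = false,
      same_side m b c = false & same_side m b d = false].
Proof.
pose P m a b c d := uniq [:: a; b; c; d] && sides m a b ==>
  [&& sides m c d, ~~ sides m a c, ~~ sides m a d, ~~ sides m b c & ~~ sides m b d].
have H : all (fun m => all (fun a => all (fun b => all (fun c =>
    all (P m a b c) (iota 0 4)) (iota 0 4)) (iota 0 4)) (iota 0 4)) (iota 0 3).
  by vm_compute.
have := all_ord (all_ord (all_ord (all_ord (all_ord H m) a) b) c) d.
move=> + u s; rewrite /P !same_sideE.
have -> /= : uniq [:: val a; val b; val c; val d].
  by rewrite -[X in uniq X]/(map val [:: a; b; c; d]) map_inj_uniq//; exact: val_inj.
move=> /implyP/(_ s).
by case/and5P=> -> /negPf-> /negPf-> /negPf-> /negPf->.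
Qed.

Lemma has_ord (k : nat) (P : nat -> bool) : has P (iota 0 k) -> exists a : 'I_k, P a.
Proof.
case/hasP => a; rewrite mem_iota /= add0n => ak Pa; by exists (Ordinal ak).
Qed.

Lemma uniq_val (s : seq 'I_4) : uniq (map val s) = uniq s.
Proof. by rewrite map_inj_uniq//; exact: val_inj. Qed.

(** The position in which two different types are compared: in the face opposite [a], a
    quadrilateral of type [m] cuts off the corner [b] and one of type [m'] the corner [c]. *)
Lemma two_sides (m m' : 'I_3) : m != m' -> exists a b c d : 'I_4,
  [/\ uniq [:: a; b; c; d], same_side m a b & same_side m' a c].
Proof.
have H : all (fun m => all (fun m' => has (fun a => has (fun b => has (fun c =>
    has (fun d => (m != m') ==> [&& uniq [:: a; b; c; d], sides m a b & sides m' a c])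
    (iota 0 4)) (iota 0 4)) (iota 0 4)) (iota 0 4)) (iota 0 3)) (iota 0 3).
  by vm_compute.
have /has_ord[a /has_ord[b /has_ord[c /has_ord[d]]]] := all_ord (all_ord H m) m'.
move=> /implyP h /h /and3P[u s s']; exists a, b, c, d; split=> //.
Qed.

Lemma side_partner (m : 'I_3) (a : 'I_4) : exists b c d : 'I_4,
  uniq [:: a; b; c; d] /\ same_side m a b.
Proof.
have H : all (fun m => all (fun a => has (fun b => has (fun c =>
    has (fun d => uniq [:: a; b; c; d] && sides m a b)
    (iota 0 4)) (iota 0 4)) (iota 0 4)) (iota 0 4)) (iota 0 3).
  by vm_compute.
have /has_ord[b /has_ord[c /has_ord[d]]] := all_ord (all_ord H m) a.
by move=> /andP[u s]; exists b, c, d; split=> //; rewrite -uniq_val.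
Qed.

Lemma two_more (a b : 'I_4) : a != b -> exists c d : 'I_4, uniq [:: a; b; c; d].
Proof.
have H : all (fun a => all (fun b => has (fun c => has (fun d =>
    (a != b) ==> uniq [:: a; b; c; d])
    (iota 0 4)) (iota 0 4)) (iota 0 4)) (iota 0 4).
  by vm_compute.
have /has_ord[c /has_ord[d]] := all_ord (all_ord H a) b.
by move=> /implyP h /h u; exists c, d; rewrite -uniq_val.
Qed.

Lemma one_more (a b c : 'I_4) : uniq [:: a; b; c] -> exists d, uniq [:: a; b; c; d].
Proof.
have H : all (fun a => all (fun b => all (fun c => has (fun d =>
    uniq [:: a; b; c] ==> uniq [:: a; b; c; d])
    (iota 0 4)) (iota 0 4)) (iota 0 4)) (iota 0 4).
  by vm_compute.
have /has_ord[d] := all_ord (all_ord (all_ord H a) b) c.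
rewrite -!(uniq_val [:: a; b; c]) => /implyP h /h u; exists d; by rewrite -uniq_val.
Qed.

Lemma same_side_cases (m : 'I_3) (a b c d : 'I_4) : uniq [:: a; b; c; d] ->
  [\/ same_side m a b, same_side m a c | same_side m a d].
Proof.
have H : all (fun m => all (fun a => all (fun b => all (fun c => all (fun d =>
    uniq [:: a; b; c; d] ==> [|| sides m a b, sides m a c | sides m a d])
    (iota 0 4)) (iota 0 4)) (iota 0 4)) (iota 0 4)) (iota 0 3).
  by vm_compute.
have := all_ord (all_ord (all_ord (all_ord (all_ord H m) a) b) c) d.
rewrite -(uniq_val [:: a; b; c; d]) => /implyP h /h /or3P.
by case; [constructor 1|constructor 2|constructor 3].
Qed.

Lemma same_side_inj (m m' : 'I_3) (a b : 'I_4) :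
  a != b -> same_side m a b -> same_side m' a b -> m = m'.
Proof.
have H : all (fun m => all (fun m' => all (fun a => all (fun b =>
    [&& a != b, sides m a b & sides m' a b] ==> (m == m'))
    (iota 0 4)) (iota 0 4)) (iota 0 3)) (iota 0 3).
  by vm_compute.
move=> ab s s'; apply/val_inj/eqP.
have /implyP := all_ord (all_ord (all_ord (all_ord H m) m') a) b.
by apply; apply/and3P.
Qed.

Lemma quad_separatingP (a b : 'I_4) : a != b -> same_side (quad_separating a b) a b.
Proof.
move=> ab; rewrite /quad_separating; case: pickP => //= no.
have H : all (fun a => all (fun b => has (fun m => (a != b) ==> sides m a b)
    (iota 0 3)) (iota 0 4)) (iota 0 4).
  by vm_compute.
have /has_ord[m /implyP/(_ ab)] := all_ord (all_ord H a) b.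
by have := no m; rewrite same_sideE => ->.
Qed.

Lemma quad_separating_eq m (a b : 'I_4) : a != b -> same_side m a b ->
  quad_separating a b = m.
Proof. by move=> ab; apply: same_side_inj (ab) (quad_separatingP ab). Qed.

Lemma same_side_sepE m (a b : 'I_4) : a != b -> same_side m a b = (m == quad_separating a b).
Proof.
move=> ab; apply/idP/eqP => [/(quad_separating_eq ab)//|->].
exact: quad_separatingP.
Qed.

Lemma uniq4_perm (a b c d : 'I_4) : uniq [:: a; b; c; d] ->
  perm_eq (index_enum 'I_4) [:: a; b; c; d].
Proof.
move=> u; apply: uniq_perm => //; first exact: index_enum_uniq.
move=> x; rewrite mem_index_enum; apply/esym.
have sub : {subset [:: a; b; c; d] <= enum 'I_4} by move=> y _; rewrite mem_enum.
have [|_ ->] := uniq_min_size u sub; first by rewrite -cardE card_ord.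
by rewrite mem_enum.
Qed.

Lemma big_uniq4 (V : nmodType) (F : 'I_4 -> V) (a b c d : 'I_4) :
  uniq [:: a; b; c; d] -> \sum_i F i = F a + F b + F c + F d.
Proof.
move=> /uniq4_perm p; rewrite (perm_big _ p) /= !big_cons big_nil addr0.
by rewrite !addrA.
Qed.

Lemma uniq4_cases (a b c d x : 'I_4) : uniq [:: a; b; c; d] ->
  [\/ x = a, x = b, x = c | x = d].
Proof.
move=> /uniq4_perm/perm_mem/(_ x); rewrite mem_index_enum !inE => /esym.
by case/or4P => /eqP; [constructor 1|constructor 2|constructor 3|constructor 4].
Qed.

Lemma uniq4_ne (U : eqType) (a b c d : U) : uniq [:: a; b; c; d] ->
  [/\ a != b, a != c & a != d] /\ [/\ b != c, b != d & c != d].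
Proof.
by rewrite /= !inE !negb_or => /and4P[/and3P[-> -> ->] /andP[-> ->] ->].
Qed.

Lemma uniq4E (U : eqType) (a b c d : U) : uniq [:: a; b; c; d] =
  [&& a != b, a != c, a != d, b != c, b != d & c != d].
Proof. by rewrite /= !inE !negb_or -!andbA andbT. Qed.

Lemma uniq4_swap12 (U : eqType) (a b c d : U) :
  uniq [:: a; b; c; d] = uniq [:: b; a; c; d].
Proof. by rewrite !uniq4E eq_sym; do !case: (_ == _). Qed.

Lemma uniq4_swap23 (U : eqType) (a b c d : U) :
  uniq [:: a; b; c; d] = uniq [:: a; c; b; d].
Proof. by rewrite !uniq4E (eq_sym b c); do !case: (_ == _). Qed.

Lemma uniq4_swap34 (U : eqType) (a b c d : U) :
  uniq [:: a; b; c; d] = uniq [:: a; b; d; c].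
Proof. by rewrite !uniq4E (eq_sym c d); do !case: (_ == _). Qed.

End Sides.

Lemma card_eq_seq (U : choiceType) (A : set U) n : (A #= `I_n)%card ->
  exists s : seq U, [/\ uniq s, size s = n & forall x, A x <-> x \in s].
Proof.
move=> An; have fA : finite_set A by exists n.
exists (enum_fset (fset_set A)); split; first exact: fset_uniq.
  exact: card_fset_set An.
move=> x; have -> : (x \in enum_fset (fset_set A)) = (x \in fset_set A) by [].
by rewrite in_fset_set//; split=> [/mem_set|/set_mem].
Qed.

Lemma card_I1_eq (U : choiceType) (A : set U) x y : (A #= `I_1)%card -> A x -> A y -> x = y.
Proof.
case/card_eq_seq => -[|z [|? ?]] [_ //= _ sA] /sA + /sA.
by rewrite !inE => /eqP-> /eqP->.
Qed.

Lemma card_I2_or (U : choiceType) (A : set U) x y z : (A #= `I_2)%card ->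
  A x -> A y -> x <> y -> A z -> z = x \/ z = y.
Proof.
case/card_eq_seq => -[|u [|v [|? ?]]] [_ //= _ sA] /sA + /sA + + /sA.
rewrite !inE => /orP[]/eqP-> /orP[]/eqP-> // _ /orP[]/eqP->; by [left|right].
Qed.

(** * Order of the ends of disjoint arcs in a face *)

Section Arcs.
Variable R : realType.

Lemma within_comp (U V W : topologicalType) (A : set U) (B : set V)
    (h : U -> V) (f : V -> W) :
  {within B, continuous f} -> {within A, continuous h} ->
  (forall x, A x -> B (h x)) -> {within A, continuous (f \o h)}.
Proof.
move=> /subspace_continuousP cf /subspace_continuousP ch AB.
apply/subspace_continuousP => x Ax P nP.
have H : nbhs x (fun y => A y -> B (h y) -> P (f (h y))).
  exact: ch x Ax _ (cf (h x) (AB x Ax) P nP).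
suff H' : nbhs x (fun y => A y -> P (f (h y))) by exact: H'.
by apply: filterS H => y Hy Ay; apply: Hy => //; exact: AB.
Qed.

(** A normal arc with its corner [b] named and an orientation chosen, so that two arcs can be
    compared by their ends on a common edge. *)
Definition arc_from (a b c d : 'I_4) (A : set 'rV[R]_4) (p r : 'rV[R]_4) : Prop :=
  uniq [:: a; b; c; d] /\ exists g : R -> 'rV[R]_4,
  [/\ {within `[0, 1], continuous g},
      g 0 = p /\ g 1 = r, edge_interior b c p /\ edge_interior b d r,
      forall t, 0 < t < 1 -> face_interior a (g t) & A = g @` `[0, 1]].

Lemma arc_from_rev a b c d A p r : arc_from a b c d A p r -> arc_from a b d c A r p.
Proof.
move=> [u [g [cg [g0 g1] [ep er] gi ->]]]; split.
  by move: u; rewrite /= !inE !negb_or => /and4P[/and3P[-> -> ->] /andP[-> ->]];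
     rewrite eq_sym => ->.
have in1 t : (`[0, 1]%classic : set R) t -> (`[0, 1]%classic : set R) (1 - t).
  by rewrite /= !in_itv /= => /andP[t0 t1]; rewrite subr_ge0 t1 gerBl.
exists (fun t => g (1 - t)); split.
- refine (@within_comp R R _ _ _ (fun t : R => 1 - t) g cg _ _).
  apply: continuous_subspaceT => x; apply: cvgB; [exact: cvg_cst | exact: cvg_id].
- exact: in1.
- by rewrite subr0 subrr.
- by [].
- by move=> t /andP[t0 t1]; apply: gi; rewrite subr_gt0 t1 gtrBl.
- apply/seteqP; split=> _ [t /in1 t01 <-]; exists (1 - t) => //.
  by rewrite subKr.
Qed.

Lemma arc_from_face a b c d A p r x : arc_from a b c d A p r -> A x -> face a x.
Proof.
move=> [/uniq4_ne[[ab ac ad] _] [g [_ [g0 g1] [ep er] gi ->]]] [t].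
rewrite /= in_itv /= => /andP[]; rewrite !le_eqVlt => /orP[/eqP<-|t0].
  by move=> _ <-; rewrite g0; case: ep => -[tp pz] _; split=> //; exact: pz.
case/orP => [/eqP->|t1] <-; last by have [] := gi t; rewrite ?t0.
by rewrite g1; case: er => -[tp pz] _; split=> //; exact: pz.
Qed.

Lemma arc_from_ends a b c d A p r : arc_from a b c d A p r ->
  [/\ A p, A r, edge b c p & edge b d r].
Proof.
move=> [_ [g [_ [<- <-] [[ep _] [er _]] gi ->]]]; split=> //.
  by exists 0 => //=; rewrite in_itv /= lexx ler01.
by exists 1 => //=; rewrite in_itv /= lexx ler01.
Qed.

Lemma tetra_sum4 (x : 'rV[R]_4) a b c d : uniq [:: a; b; c; d] -> tetra x ->
  x 0 a + x 0 b + x 0 c + x 0 d = 1.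
Proof. by move=> u [_ <-]; rewrite (big_uniq4 _ u). Qed.

(* Subtracting the two parametrizations turns an intersection of two arcs of a
   face into a zero of a planar map on the square. *)
Lemma arcs_square (a b c d : 'I_4) (f g : R -> 'rV[R]_4) (k : R) :
  k != 0 -> uniq [:: a; b; c; d] ->
  {within `[0, 1], continuous f} -> {within `[0, 1], continuous g} ->
  (forall t, 0 <= t <= 1 -> face a (f t)) ->
  (forall t, 0 <= t <= 1 -> face a (g t)) ->
  (forall t, 0 <= t <= 1 -> f 0 0 d - g t 0 d <= 0) ->
  (forall s, 0 <= s <= 1 -> 0 <= f s 0 d - g 0 0 d) ->
  0 < k * (f 0 0 c - g 0 0 c) ->
  (forall s, 0 <= s <= 1 -> 0 < k * (f s 0 c - g 1 0 c) -> f s 0 d - g 1 0 d < 0) ->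
  (forall t, 0 <= t <= 1 -> k * (f 1 0 c - g t 0 c) <= 0) \/
    (forall t, 0 <= t <= 1 -> 0 <= k * (f 1 0 c - g t 0 c)) /\
    0 < f 1 0 d - g 1 0 d ->
  exists s t, [/\ 0 <= s <= 1, 0 <= t <= 1 & f s = g t].
Proof.
move=> k0 u cf cg ff fg h1 h2 h3 h4 h5.
pose X := [set p : R * R | 0 <= p.1 <= 1 /\ 0 <= p.2 <= 1].
have c1 (i : 'I_4) : {within X, continuous (fun p => f p.1 0 i)}.
  refine (@within_comp (R * R)%type R R X `[0, 1]%classic fst (fun t => f t 0 i) _ _ _).
  - refine (@within_comp R 'rV[R]_4 R _ setT f (fun M => M 0 i) _ cf _) => //.
    by apply: continuous_subspaceT; exact: coord_continuous.
  - by apply: continuous_subspaceT => p; exact: cvg_fst.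
  - by move=> [p q] /= []; rewrite in_itv.
have c2 (i : 'I_4) : {within X, continuous (fun p => g p.2 0 i)}.
  refine (@within_comp (R * R)%type R R X `[0, 1]%classic snd (fun t => g t 0 i) _ _ _).
  - refine (@within_comp R 'rV[R]_4 R _ setT g (fun M => M 0 i) _ cg _) => //.
    by apply: continuous_subspaceT; exact: coord_continuous.
  - by apply: continuous_subspaceT => p; exact: cvg_snd.
  - by move=> [p q] /= []; rewrite in_itv.
have c3 (i : 'I_4) : {within X, continuous (fun p => f p.1 0 i - g p.2 0 i)}.
  by move=> p; apply: cvgB; [exact: c1 | exact: c2].
have cG : {within X, continuous (fun p => k * (f p.1 0 c - g p.2 0 c))}.
  by move=> p; apply: cvgM; [exact: cvg_cst | exact: c3].
have [[s t] [[/= s1 t1] gz dz]] := square_zero cG (c3 d) h1 h2 h3 h4 h5.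
exists s, t; split=> //.
have ec : f s 0 c = g t 0 c.
  by move/eqP: gz; rewrite mulf_eq0 (negPf k0) /= subr_eq0 => /eqP.
have ed : f s 0 d = g t 0 d by move/eqP: dz; rewrite subr_eq0 => /eqP.
have [tf fa] := ff s s1; have [tg ga] := fg t t1.
have eb : f s 0 b = g t 0 b.
  have := tetra_sum4 u tf; have := tetra_sum4 u tg; rewrite fa ga ec ed => <-.
  by move/addIr/addIr/addrI.
apply/rowP => i; case: (uniq4_cases i u) => ->//; by rewrite fa ga.
Qed.

Lemma edge_sum (b c : 'I_4) (x : 'rV[R]_4) : b != c -> edge b c x -> x 0 b + x 0 c = 1.
Proof.
move=> bc [tx x0]; have [d [e u]] := two_more bc.
have [[_ bd be] [cd ce _]] := uniq4_ne u.
by have := tetra_sum4 u tx; rewrite (x0 d) 1?eq_sym// (x0 e) 1?eq_sym// !addr0.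
Qed.

Lemma edge_eq (b c : 'I_4) (x y : 'rV[R]_4) : b != c -> edge b c x -> edge b c y ->
  x 0 b = y 0 b -> x = y.
Proof.
move=> bc ex ey xy; have := edge_sum bc ex; rewrite xy -(edge_sum bc ey).
move=> /addrI xyc; apply/rowP => i.
have [->//|ib] := eqVneq i b; have [->//|ic] := eqVneq i c.
by rewrite ex.2// ey.2.
Qed.

Lemma arc_param a b c d A p r : arc_from a b c d A p r ->
  exists g : R -> 'rV[R]_4, [/\ {within `[0, 1], continuous g},
    g 0 = p, g 1 = r, forall t, 0 <= t <= 1 -> face a (g t) &
    forall t, 0 <= t <= 1 -> A (g t)].
Proof.
move=> h; have [_ [g [cg [g0 g1] _ _ Ae]]] := h.
have gA t : 0 <= t <= 1 -> A (g t).
  by move=> t01; rewrite Ae; exists t => //=; rewrite in_itv.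
exists g; split=> // t t01; exact: arc_from_face h (gA t t01).
Qed.

(** The arcs cut off the two ends of [bc]. If their ends on [bc] came in the wrong order they would
    have to cross: the differences of the coordinates [c] and [d] along the two arcs satisfy the
    sign conditions on the square. *)
Lemma arc_cross_facing a b c d A p r A' p' r' :
  arc_from a b c d A p r -> arc_from a c b d A' p' r' ->
  (forall x, A x -> A' x -> False) -> p' 0 b < p 0 b.
Proof.
move=> hA hA' dis; have u := hA.1; have [[ab ac ad] [bc bd cd]] := uniq4_ne u.
have [cb db dc] : [/\ c != b, d != b & d != c] by rewrite !(eq_sym _ b) (eq_sym d).
rewrite ltNge; apply/negP; rewrite le_eqVlt => pp.
have [Ap Ar ep er] := arc_from_ends hA; have [Ap' Ar' ep' er'] := arc_from_ends hA'.
have ep'' : edge b c p' by split; [exact: ep'.1|move=> i ib ic; exact: ep'.2].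
case/orP: pp => [/eqP pp|pp].
  by apply: (dis p) => //; rewrite (edge_eq bc ep ep'' pp).
have [f [cf f0 f1 ff fA]] := arc_param hA.
have [g [cg g0 g1 fg gA]] := arc_param hA'.
have [|||||s [t [s1 t1 st]]] := @arcs_square a b c d f g 1 (oner_neq0 R) u cf cg ff fg.
- move=> t t01; rewrite f0 (ep.2 d)// sub0r oppr_le0.
  by have [[]] := fg t t01.
- move=> t t01; rewrite g0 (ep'.2 d)// subr0.
  by have [[]] := ff t t01.
- rewrite f0 g0 mul1r.
  by have := edge_sum bc ep; have := edge_sum bc ep''; lra.
- rewrite /= => s s01; rewrite g1 mul1r => G0.
  have [tf fa] := ff s s01; have := tetra_sum4 u tf.
  have := tetra_sum4 u er'.1; rewrite fa (er'.2 a)// (er'.2 b)//.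
  have := tf.1 b; lra.
- left => t t01; rewrite f1 (er.2 c)// mul1r sub0r oppr_le0.
  by have [[]] := fg t t01.
- by apply: (dis (f s)); [exact: fA | rewrite st; exact: gA].
Qed.

(** Arcs about the same corner are nested: the one nearer to [b] at one end is nearer at the other.
    The arc that is inner on [bc] comes first here, so the difference of the [c]-coordinates enters
    the square with factor [-1]. *)
Lemma arc_cross_nested a b c d A p r A' p' r' :
  arc_from a b c d A p r -> arc_from a b c d A' p' r' ->
  (forall x, A x -> A' x -> False) -> p 0 c < p' 0 c -> r 0 d < r' 0 d.
Proof.
move=> hA hA' dis pp; have u := hA.1; have [[ab ac ad] [bc bd cd]] := uniq4_ne u.
have [cb db dc] : [/\ c != b, d != b & d != c] by rewrite !(eq_sym _ b) (eq_sym d).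
rewrite ltNge; apply/negP; rewrite le_eqVlt => rr.
have [Ap Ar ep er] := arc_from_ends hA; have [Ap' Ar' ep' er'] := arc_from_ends hA'.
case/orP: rr => [/eqP rr|rr].
  apply: (dis r) => //; rewrite (edge_eq bd er er')//.
  by have := edge_sum bd er; have := edge_sum bd er'; lra.
have [f [cf f0 f1 ff fA]] := arc_param hA.
have [g [cg g0 g1 fg gA]] := arc_param hA'.
have k0 : -1 != 0 :> R by rewrite oppr_eq0 oner_eq0.
have [|||||s [t [s1 t1 st]]] := @arcs_square a b c d f g (-1) k0 u cf cg ff fg.
- move=> t t01; rewrite f0 (ep.2 d)// sub0r oppr_le0.
  by have [[]] := fg t t01.
- move=> t t01; rewrite g0 (ep'.2 d)// subr0.
  by have [[]] := ff t t01.
- by rewrite f0 g0 mulN1r; lra.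
- rewrite /= => s s01; rewrite g1 mulN1r (er'.2 c)// subr0.
  have [[/(_ c)]] := ff s s01; lra.
- right; split=> [t t01|]; last by rewrite f1 g1 subr_gt0.
  rewrite f1 (er.2 c)// mulN1r sub0r opprK.
  by have [[]] := fg t t01.
- by apply: (dis (f s)); [exact: fA | rewrite st; exact: gA].
Qed.

End Arcs.

(** * Arcs of quadrilaterals and octagons *)

Section PieceArcs.
Variable R : realType.

Lemma normal_arc_from (a b c d : 'I_4) (A : set 'rV[R]_4) :
  uniq [:: a; b; c; d] -> normal_arc a A ->
  [\/ exists p r, arc_from a b c d A p r, exists p r, arc_from a c b d A p r |
      exists p r, arc_from a d b c A p r].
Proof.
move=> u [b' [c' [d' [u' [g [cg _ [e0 e1] gi ->]]]]]].
have h0 : arc_from a b' c' d' (g @` `[0, 1]) (g 0) (g 1).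
  by split=> //; exists g; split.
have h1 := arc_from_rev h0.
have corner x y z : uniq [:: a; x; y; z] -> b' = x ->
    exists p r, arc_from a x y z (g @` `[0, 1]) p r.
  move=> ux E; move: h0 h1; rewrite E => h0 h1.
  have [[_ ac' ad'] [bc' bd' cd']] := uniq4_ne u'; rewrite E in bc' bd'.
  case: (uniq4_cases c' ux) => Ec; rewrite Ec ?eqxx// in h0 h1 ac' bc' cd';
  case: (uniq4_cases d' ux) => Ed; rewrite Ed ?eqxx// in h0 h1 ad' bd' cd'.
    by exists (g 0), (g 1).
  by exists (g 1), (g 0).
have [[ab _ _] _] := uniq4_ne u'.
have ub : uniq [:: a; c; b; d] by rewrite uniq4_swap23.
have ud : uniq [:: a; d; b; c] by rewrite uniq4_swap23 uniq4_swap34.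
case: (uniq4_cases b' u) => E; first by rewrite E eqxx in ab.
- by constructor 1; exact: corner.
- by constructor 2; exact: corner.
- by constructor 3; exact: corner.
Qed.

Lemma edge_sym (a b : 'I_4) : @edge R a b = edge b a.
Proof.
by apply/seteqP; split=> x [tx x0]; split=> // c ca cb; exact: x0.
Qed.

(** The quadrilateral misses the edge [cd] opposite [ab], so its single arc in the face opposite [a]
    has no end there and must run about [b]. *)
Lemma quad_face_arc (m : 'I_3) (D : set 'rV[R]_4) (a b c d : 'I_4) :
  normal_piece (Quad m) D -> uniq [:: a; b; c; d] -> same_side m a b ->
  exists p r, arc_from a b c d (D `&` face a) p r.
Proof.
move=> [_ /(_ a)[A [nA tA eA]] eD] u s.
have [s1 s2 s3 s4 s5] := same_side_uniq u s.
have [[ab ac ad] [bc bd cd]] := uniq4_ne u.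
have eA' : D `&` face a = A ord0.
  rewrite eA; apply/seteqP; split=> [x [i _]|x Ax]; last by exists ord0.
  by rewrite (ord1 i).
have no x : D x -> edge c d x -> False.
  move=> Dx ex; have := eD c d cd; rewrite /= s1 => /card_eq_seq[l [_ sl h]].
  by have := (h x).1 (conj Dx ex); rewrite (size0nil sl).
rewrite eA'; case: (normal_arc_from u (nA ord0)) => -[p [r h]].
- by exists p, r.
- have [_ Ar _ er] := arc_from_ends h; case: (no r) => //.
  by have [] : (D `&` face a) r by rewrite eA'. 
- have [_ Ar _ er] := arc_from_ends h; case: (no r); last by rewrite edge_sym.
  by have [] : (D `&` face a) r by rewrite eA'. 
Qed.

(** The octagon meets [bc] and [bd] once each. An arc about [b] would use up both points, although
    the other arc also has an end on one of these edges; two arcs about [c], or two about [d], would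
    share a point. So one arc runs about each of [c] and [d]. *)
Lemma oct_face_arcs (m : 'I_3) (D : set 'rV[R]_4) (a b c d : 'I_4) :
  normal_piece (Oct m) D -> uniq [:: a; b; c; d] -> same_side m a b ->
  exists A A' p r p' r', [/\ arc_from a c b d A p r, arc_from a d b c A' p' r',
    A `<=` D, A' `<=` D & forall x, A x -> A' x -> False].
Proof.
move=> [_ /(_ a)[A [nA tA eA]] eD] u s.
have [s1 s2 s3 s4 s5] := same_side_uniq u s.
have [[ab ac ad] [bc bd cd]] := uniq4_ne u.
have AD i : A i `<=` D by move=> x Ax; have [] : (D `&` face a) x by rewrite eA; exists i.
have dis i j x : i != j -> A i x -> A j x -> False.
  move=> ij Ai Aj; move/negP: ij; apply; apply/eqP.
  by apply: (tA i j I I); exists x.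
have one v x y : ~~ same_side m b v -> b != v -> D x -> edge b v x -> D y -> edge b v y -> x = y.
  move=> nv bv Dx ex Dy ey; apply: (card_I1_eq (A := D `&` edge b v)) => //.
  by have := eD b v bv; rewrite /= (negPf nv).
have arcs i := normal_arc_from u (nA i).
have nob i : ~ exists p r, arc_from a b c d (A i) p r.
  move=> [p [r h]]; have [Ap Ar ep er] := arc_from_ends h.
  have [j ij] : exists j, i != j.
    by case: (eqVneq i ord0) => [->|]; [exists (lift ord0 ord0)|exists ord0].
  have uc x : A j x -> edge b c x -> False.
    move=> Ax ex; apply: (dis i j p ij Ap).
    by rewrite (one c p x _ bc (AD _ _ Ap) ep (AD _ _ Ax) ex)// s4.
  have ud x : A j x -> edge b d x -> False.
    move=> Ax ex; apply: (dis i j r ij Ar).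
    by rewrite (one d r x _ bd (AD _ _ Ar) er (AD _ _ Ax) ex)// s5.
  case: (arcs j) => -[p' [r' /arc_from_ends[Ap' Ar' ep' er']]].
  - exact: (uc p').
  - by apply: (uc p'); rewrite // edge_sym.
  - by apply: (ud p'); rewrite // edge_sym.
have diff i j v w : i != j -> ~~ same_side m b v -> b != v ->
   (exists p r, arc_from a v b w (A i) p r) -> (exists p r, arc_from a v b w (A j) p r) -> False.
  move=> ij nv bv [p [r /arc_from_ends[Ap _ ep _]]] [p' [r' /arc_from_ends[Ap' _ ep' _]]].
  rewrite edge_sym in ep; rewrite edge_sym in ep'; apply: (dis i j p ij Ap).
  by rewrite (one v p p' nv bv (AD _ _ Ap) ep (AD _ _ Ap') ep').
have [i [j [ij hi hj]]] : exists i j, [/\ i != j,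
    exists p r, arc_from a c b d (A i) p r & exists p r, arc_from a d b c (A j) p r].
  have ne : (ord0 : 'I_2) != lift ord0 ord0 by [].
  case: (arcs ord0) => [/nob//|h0|h0]; case: (arcs (lift ord0 ord0)) => [/nob//|h1|h1].
  - by case: (diff _ _ c d ne _ bc h0 h1); rewrite s4.
  - by exists ord0, (lift ord0 ord0).
  - by exists (lift ord0 ord0), ord0.
  - by case: (diff _ _ d c ne _ bd h0 h1); rewrite s5.
have [p [r h]] := hi; have [p' [r' h']] := hj.
exists (A i), (A j), p, r, p', r'; split=> //.
by move=> x; apply: dis.
Qed.

(** Both quadrilaterals meet [bc] once. In the face opposite [a] the first cuts off [b] and the
    second [c], so the point of the first is nearer to [b]; in the face opposite [d] the roles are
    exchanged and the order is reversed. *)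
Lemma quads_meet (m m' : 'I_3) (D D' : set 'rV[R]_4) : m != m' ->
  normal_piece (Quad m) D -> normal_piece (Quad m') D' ->
  (forall x, D x -> D' x -> False) -> False.
Proof.
move=> mm nD nD' dis; have [a [b [c [d [u s s']]]]] := two_sides mm.
have [[ab ac ad] [bc bd cd]] := uniq4_ne u.
have [sd sac sad sbc sbd] := same_side_uniq u s.
have u' : uniq [:: a; c; b; d] by rewrite uniq4_swap23.
have [sd' _ _ scb' _] := same_side_uniq u' s'.
have ud : uniq [:: d; c; b; a] by rewrite -rev_uniq.
have ud' : uniq [:: d; b; c; a] by rewrite uniq4_swap23.
have [p [r h]] := quad_face_arc nD u s.
have [p' [r' h']] := quad_face_arc nD' u' s'.
have [|p2 [r2 h2]] := quad_face_arc nD ud; first by rewrite same_sideC.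
have [|p2' [r2' h2']] := quad_face_arc nD' ud'; first by rewrite same_sideC.
have disI f g x : (D `&` f) x -> (D' `&` g) x -> False.
  by move=> [Dx _] [D'x _]; exact: dis Dx D'x.
have lt1 := arc_cross_facing h h' (disI _ _).
have lt2 := arc_cross_facing h2' h2 (fun x y z => disI _ _ x z y).
have [[Dp _] _ ep _] := arc_from_ends h; have [[Dp' _] _ ep' _] := arc_from_ends h'.
have [[Dp2 _] _ ep2 _] := arc_from_ends h2; have [[Dp2' _] _ ep2' _] := arc_from_ends h2'.
rewrite edge_sym in ep'; rewrite edge_sym in ep2.
have e1 : p = p2.
  apply: (card_I1_eq (A := D `&` edge b c)) => //.
  by have [_ _ /(_ b c bc)] := nD; rewrite /= sbc.
have e2 : p' = p2'.
  apply: (card_I1_eq (A := D' `&` edge b c)) => //.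
  by have [_ _ /(_ b c bc)] := nD'; rewrite /= same_sideC scb'.
by rewrite e1 e2 in lt1; have := lt_trans lt1 lt2; rewrite ltxx.
Qed.

(** In each of the faces opposite [a] and [c] the octagon has an arc about [b] and one about [d],
    both ending on [bd]. In the face opposite [c] the quadrilateral cuts off [d], so on [bd] it lies
    farther from [b] than the octagon's arc about [b]. In the face opposite [a] it also cuts off
    [b], and nesting carries this order from [bd] over to [bc]. *)
Lemma quad_oct_order (m m' : 'I_3) (D O : set 'rV[R]_4) (a b c d : 'I_4) :
  uniq [:: a; b; c; d] -> same_side m a b -> same_side m' a c ->
  normal_piece (Quad m) D -> normal_piece (Oct m') O ->
  (forall x, D x -> O x -> False) ->
  exists p q, [/\ D p, O q, edge b c p, edge b c q & q 0 c < p 0 c].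
Proof.
move=> u s s' nD nO dis.
have [[ab ac ad] [bc bd cd]] := uniq4_ne u.
have [scd _ _ _ sbd] := same_side_uniq u s.
have ua' : uniq [:: a; c; b; d] by rewrite uniq4_swap23.
have [sbd' _ _ _ _] := same_side_uniq ua' s'.
have uc : uniq [:: c; d; a; b] by rewrite -(rot_uniq 2).
have uc' : uniq [:: c; a; b; d].
  by rewrite uniq4_swap12.
have [pa [ra ha]] := quad_face_arc nD u s.
have [A1 [A2 [u1 [v [u2 [w [hA1 hA2 sA1 sA2 disA]]]]]]] := oct_face_arcs nO ua' s'.
have [pc [rc hc]] := quad_face_arc nD uc scd.
have [|B1 [B2 [u3 [v3 [u4 [w4 [hB1 hB2 sB1 sB2 disB]]]]]]] := oct_face_arcs nO uc'.
  by rewrite same_sideC.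
have disI A f x : A `<=` O -> (D `&` f) x -> A x -> False.
  by move=> AO [Dx _] /AO; exact: dis.
have [[Dpa _] [Dra _] epa era] := arc_from_ends ha.
have [_ [Drc _] _ erc] := arc_from_ends hc.
have [Au1 Av eu1 ev] := arc_from_ends hA1; have [_ Aw _ ew] := arc_from_ends hA2.
have [_ Av3 _ ev3] := arc_from_ends hB1; have [_ Aw4 _ ew4] := arc_from_ends hB2.
rewrite edge_sym in ew; rewrite edge_sym in ew4; rewrite edge_sym in erc.
have lt1 := arc_cross_facing (arc_from_rev hA1) (arc_from_rev hA2) disA.
have lt2 := arc_cross_facing (arc_from_rev hB1) (arc_from_rev hB2) disB.
have lt3 := arc_cross_facing (arc_from_rev hB1) (arc_from_rev hc)
  (fun x y z => disI _ _ x sB1 z y).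
have rr : ra = rc.
  apply: (card_I1_eq (A := D `&` edge b d)) => //.
  by have [_ _ /(_ b d bd)] := nD; rewrite /= sbd.
have two : (O `&` edge b d #= `I_2)%card.
  by have [_ _ /(_ b d bd)] := nO; rewrite /= sbd'.
have vw : v <> w by move=> E; rewrite E ltxx in lt1.
have or z : O z -> edge b d z -> z = v \/ z = w.
  move=> Oz ez; apply: (card_I2_or two) => //; split=> //; [exact: sA1|exact: sA2].
(* In both faces the arc about [b] ends at that one of the two points on [bd] which is nearer to
   [b]. *)
have vv : v3 = v.
  case: (or v3 (sB1 _ Av3) ev3) => // E3.
  case: (or w4 (sB2 _ Aw4) ew4) => E4; rewrite E3 E4 ?ltxx// in lt2.
  by have := lt_trans lt1 lt2; rewrite ltxx.
exists pa, u1; split=> //; first exact: sA1.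
apply: (arc_cross_nested (arc_from_rev hA1) (arc_from_rev ha)).
  by move=> x A1x Dx; exact: disI sA1 Dx A1x.
have := edge_sum bd era; have := edge_sum bd ev; rewrite rr -vv.
by move: lt3; lra.
Qed.

(** Read from the face opposite [a] and from the face opposite [d], [quad_oct_order] puts the same
    two points of [bc] in opposite orders. *)
Lemma quad_oct_meet (m m' : 'I_3) (D O : set 'rV[R]_4) : m != m' ->
  normal_piece (Quad m) D -> normal_piece (Oct m') O ->
  (forall x, D x -> O x -> False) -> False.
Proof.
move=> mm nD nO dis; have [a [b [c [d [u s s']]]]] := two_sides mm.
have [[ab ac ad] [bc bd cd]] := uniq4_ne u.
have [sd _ _ sbc _] := same_side_uniq u s.
have u' : uniq [:: a; c; b; d] by rewrite uniq4_swap23.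
have [sd' _ _ scb' _] := same_side_uniq u' s'.
have ud : uniq [:: d; c; b; a] by rewrite -rev_uniq.
have [p [q [Dp Oq ep eq qp]]] := quad_oct_order u s s' nD nO dis.
have [||p' [q' [Dp' Oq' ep' eq' qp']]] := quad_oct_order ud _ _ nD nO dis.
- by rewrite same_sideC.
- by rewrite same_sideC.
rewrite edge_sym in ep'; rewrite edge_sym in eq'.
have e1 : p = p'.
  apply: (card_I1_eq (A := D `&` edge b c)) => //.
  by have [_ _ /(_ b c bc)] := nD; rewrite /= sbc.
have e2 : q = q'.
  apply: (card_I1_eq (A := O `&` edge b c)) => //.
  by have [_ _ /(_ b c bc)] := nO; rewrite /= same_sideC scb'.
have := edge_sum bc ep; have := edge_sum bc eq; move: qp qp'; rewrite -e1 -e2; lra.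
Qed.

End PieceArcs.

(** * The matching equations of a surface *)

Section Visits.
Variables (R : realType) (n : nat) (T : face_gluing n).
Implicit Types f g : visit n.

(** The same visit with the direction around the edge reversed: entrance and exit faces are
    exchanged. *)
Definition vswap f : visit n := (f.1, (tperm idxX idxY * f.2)%g).

Definition exit_glued f : bool := glue T f.1 (f.2 idxX).

(* Extending [next_visit] by turning back at an unglued face makes it injective,
   so that its orbits are cycles. *)
Definition turn_visit f : visit n := if exit_glued f then next_visit T f else vswap f.

Lemma vswapK : involutive vswap.
Proof. by case=> i s; rewrite /vswap /= mulgA tperm2 mul1g. Qed.

Lemma exit_gluedP f : exit_glued f -> exists j s,
  glue T f.1 (f.2 idxX) = Some (j, s) /\
  turn_visit f = (j, (tperm idxX idxY * f.2 * s)%g).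
Proof.
move=> gf; rewrite /turn_visit gf /next_visit; move: gf; rewrite /exit_glued.
by case: (glue T _ _) => [[j s]|] // _; exists j, s.
Qed.

Lemma glued_swap_turn f : exit_glued f -> exit_glued (vswap (turn_visit f)).
Proof.
move=> /exit_gluedP[j [s [e ->]]].
rewrite /exit_glued /vswap /= !mulgA tperm2 mul1g permM.
by rewrite (glue_sym e).
Qed.

(** Reversal conjugates [turn_visit] to its inverse; injectivity follows. *)
Lemma turn_swap_turn f : turn_visit (vswap (turn_visit f)) = vswap f.
Proof.
case gf: (exit_glued f); last by rewrite /turn_visit gf vswapK gf.
have := glued_swap_turn gf => g2; rewrite {1}/turn_visit g2 /next_visit.
have [j [s [e ->]]] := exit_gluedP gf.
rewrite /vswap /= !mulgA tperm2 mul1g permM (glue_sym e).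
by rewrite /= mul1g mulgK.
Qed.

Lemma turn_inj : injective turn_visit.
Proof.
move=> f g e; apply: (can_inj vswapK).
by rewrite -turn_swap_turn e turn_swap_turn.
Qed.

Lemma turn_iter_glued f : (forall k, exit_glued (iter k turn_visit f)) ->
  forall k, iter k (next_visit T) f = iter k turn_visit f.
Proof.
move=> gf; elim=> // k IH; rewrite !iterS IH {2}/turn_visit; by rewrite gf.
Qed.

Lemma orbit_sum (V : nmodType) (F : visit n -> V) f :
  (forall k, exit_glued (iter k turn_visit f)) ->
  \sum_(g <- orbit (next_visit T) f) F g = \sum_(g | fconnect turn_visit f g) F g.
Proof.
move=> gf; rewrite -[RHS]big_filter; apply: perm_big.
apply: uniq_perm; [exact: orbit_uniq|exact/filter_uniq/index_enum_uniq|] => g.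
rewrite -fconnect_orbit mem_filter mem_index_enum andbT.
apply/idP/idP => /iter_findex <-.
  by rewrite turn_iter_glued//; exact: fconnect_iter.
by rewrite -turn_iter_glued//; exact: fconnect_iter.
Qed.

Lemma turn_orbit_shift (V : nmodType) (F : visit n -> V) f :
  \sum_(g | fconnect turn_visit f g) F (turn_visit g) =
  \sum_(g | fconnect turn_visit f g) F g.
Proof.
rewrite [RHS](reindex_inj turn_inj) /=; apply: eq_bigl => g.
by rewrite (same_fconnect1_r turn_inj).
Qed.

Definition edge_of f : set 'rV[R]_4 := edge (f.2 idxU) (f.2 idxL).

Lemma visit_uniq f : uniq [:: f.2 idxU; f.2 idxL; f.2 idxX; f.2 idxY].
Proof.
by rewrite -[X in uniq X]/(map f.2 [:: idxU; idxL; idxX; idxY]) map_inj_uniq//; exact: perm_inj.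
Qed.

Lemma edge_step f x : exit_glued f -> edge_of f x ->
  exists2 y, edge_of (turn_visit f) y & face_step T (f.1, x) ((turn_visit f).1, y).
Proof.
move=> /exit_gluedP[j [s [e ->]]] [tx x0].
have u := visit_uniq f; have [[UL UX UY] [LX LY XY]] := uniq4_ne u.
have fx : face (f.2 idxX) x by split=> //; apply: x0; rewrite eq_sym.
exists (\row_v x 0 ((s^-1)%g v)) => /=; last first.
  by exists (f.2 idxX), s; split=> // v; rewrite mxE permK.
split; last first.
  move=> c; rewrite mxE !permM !tpermD// => cU cL; apply: x0.
    by apply: contraNneq cU => <-; rewrite permKV.
  by apply: contraNneq cL => <-; rewrite permKV.
split=> [a|]; first by rewrite mxE; exact: tx.1.
rewrite -[RHS]tx.2 (reindex_inj (@perm_inj _ s)); apply: eq_bigr => a _.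
by rewrite mxE permK.
Qed.

Lemma identified_trans (p q r : 'I_n * 'rV[R]_4) :
  identified T p q -> identified T q r -> identified T p r.
Proof. exact: rst_trans. Qed.

(** If the walk reached an unglued face, every point of the edge could be carried along the visits
    to a point of that face, and the whole edge would be boundary. *)
Lemma nonboundary_glued f : ~ boundary_edge R T f.1 (f.2 idxU) (f.2 idxL) ->
  forall k, exit_glued (iter k turn_visit f).
Proof.
move=> nb k; elim/ltn_ind: k => k IH; apply/negP => /negP ng; apply: nb => x ex.
have [y ey iy] : exists2 y, edge_of (iter k turn_visit f) y &
    identified T (f.1, x) ((iter k turn_visit f).1, y).
  elim: k IH {ng} => [|k IHk] IH; first by exists x => //; exact: rst_refl.
  have [|y ey iy] := IHk; first by move=> l lk; apply: IH; exact: ltnW.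
  have [z ez sz] := edge_step (IH k (ltnSn k)) ey.
  exists z; first exact: ez.
  apply: identified_trans iy _; exact: rst_step.
set g := iter k turn_visit f in ng ey iy *.
exists g.1, y, (g.2 idxX); split=> //.
  by move: ng; rewrite /exit_glued; case: (glue T _ _).
have [[_ UX _] [LX _ _]] := uniq4_ne (visit_uniq g).
by case: ey => ty y0; split=> //; apply: y0; rewrite eq_sym.
Qed.

End Visits.

(** * Corner counts of a surface *)

Section SurfaceVector.
Variables (R : realType) (n : nat) (T : face_gluing n) (S : pieces R n).
Hypothesis hS : made_of_pieces T S.

Let typ i (l : 'I_(npieces S i)) := piece_type l.
Let pset i (l : 'I_(npieces S i)) := piece_set l.

Lemma pset_disjoint i (l l' : 'I_(npieces S i)) x :
  l != l' -> pset l x -> pset l' x -> False.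
Proof.
move=> ll h h'; move/negP: ll; apply; apply/eqP.
by case: hS => _ tS _; apply: (tS i l l' I I); exists x.
Qed.

Lemma quad_count_gt0 i m : (0 < quad_count S i m)%N -> exists l, @typ i l = Quad m.
Proof.
case/card_gt0P => l; rewrite inE => h; exists l; move: h; rewrite /typ.
by case: (piece_type l) => //= m' /eqP->.
Qed.

Lemma oct_count_gt0 i m : (0 < oct_count S i m)%N -> exists l, @typ i l = Oct m.
Proof.
case/card_gt0P => l; rewrite inE => h; exists l; move: h; rewrite /typ.
by case: (piece_type l) => //= m' /eqP->.
Qed.

Lemma oct_count_le i m : (oct_count S i m <= total_octs S)%N.
Proof.
rewrite /total_octs (bigD1 i)//= (bigD1 m)//= -addnA; exact: leq_addr.
Qed.

Lemma oct_count_unique i m i' m' : (total_octs S <= 1)%N ->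
  (0 < oct_count S i m)%N -> (0 < oct_count S i' m')%N -> (i, m) = (i', m').
Proof.
move=> tot h h'; apply/eqP; apply: contraLR tot => ne; rewrite -ltnNge.
rewrite /total_octs pair_big /= (bigD1 (i, m))//= (bigD1 (i', m'))/=; last by rewrite eq_sym.
by rewrite addnA ltn_addr// -[2%N]/(1 + 1)%N leq_add.
Qed.

Lemma joint_vectorE i m : joint_vector S i m = (quad_count S i m)%:Z - (oct_count S i m)%:Z.
Proof. by rewrite mxE. Qed.

Lemma joint_neg i m : joint_vector S i m < 0 -> (0 < oct_count S i m)%N.
Proof. by rewrite joint_vectorE subr_lt0 ltz_nat; exact: leq_ltn_trans. Qed.

Lemma joint_quad_constraints : (total_octs S <= 1)%N -> quad_constraints (joint_vector S).
Proof.
move=> tot i m m'.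
have nz k : joint_vector S i k != 0 ->
    exists l, @typ i l = Quad k \/ @typ i l = Oct k.
  rewrite joint_vectorE; case: (posnP (oct_count S i k)) => [->|/oct_count_gt0[l hl] _].
    rewrite subr0 => q0; have : (0 < quad_count S i k)%N by rewrite lt0n.
    by move=> /quad_count_gt0[l hl]; exists l; left.
  by exists l; right.
move=> /nz[l hl] /nz[l' hl']; apply/eqP/negPn/negP => mm.
have ll : l != l'.
  by apply: contraNneq mm => E; case: hl hl'; rewrite E => -> [] // [->].
have dis x : pset l x -> pset l' x -> False by exact: pset_disjoint.
have [nl _ _] := hS; have := nl i l; have := nl i l'.
rewrite -/(typ l) -/(typ l') -/(pset l) -/(pset l').
case: hl => hl; case: hl' => hl'; rewrite hl hl' => nl' nl0.
- exact: quads_meet mm nl0 nl' dis.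
- exact: quad_oct_meet mm nl0 nl' dis.
- by rewrite eq_sym in mm; apply: quad_oct_meet mm nl' nl0 (fun x y z => dis x z y).
- have pos k (l0 : 'I_(npieces S i)) : typ l0 = Oct k -> (0 < oct_count S i k)%N.
    by move=> h; apply/card_gt0P; exists l0; rewrite inE -/(typ l0) h /= eqxx.
  have := oct_count_unique tot (pos _ _ hl) (pos _ _ hl').
  by case=> E; rewrite E eqxx in mm.
Qed.

Definition edge_count i a b : nat := \sum_(l < npieces S i) edge_weight (piece_type l) a b.

Lemma carrier_edge_seq i a b : a != b -> exists s : seq 'rV[R]_4,
  [/\ uniq s, size s = edge_count i a b &
      forall x, (carrier S i `&` edge a b) x <-> x \in s].
Proof.
move=> ab; have [nl _ _] := hS.
have /boolp.choice[s hs] : forall l : 'I_(npieces S i), exists s : seq 'rV[R]_4,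
    [/\ uniq s, size s = edge_weight (piece_type l) a b &
     forall x, (pset l `&` edge a b) x <-> x \in s].
  by move=> l; have [_ _ /(_ a b ab)/card_eq_seq] := nl i l.
exists (flatten [seq s l | l <- index_enum 'I_(npieces S i)]); split.
- have : uniq (index_enum 'I_(npieces S i)) by exact: index_enum_uniq.
  elim: (index_enum _) => //= l L IH /andP[lL uL].
  rewrite cat_uniq IH// andbT; have [-> _ sl] := hs l => /=.
  apply/hasPn => x /flattenP[_ /mapP[l' l'L ->] xs]; apply/negP => xs'.
  have [_ _ sl'] := hs l'.
  have [h1 _] := (sl' x).2 xs; have [h2 _] := (sl x).2 xs'.
  by apply: (pset_disjoint _ h2 h1); apply: contraNneq lL => ->.
- rewrite size_flatten /shape -map_comp sumnE big_map /edge_count.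
  by apply: eq_bigr => l _ /=; have [] := hs l.
- move=> x; split=> [[[l _ xl] ex]|/flattenP[_ /mapP[l _ ->] xs]].
    apply/flattenP; exists (s l); first by apply/mapP; exists l; rewrite ?mem_index_enum.
    by have [_ _ /(_ x)[h _]] := hs l; apply: h.
  by have [_ _ /(_ x)[_ /(_ xs)[h1 h2]]] := hs l; split=> //; exists l.
Qed.

(** By saturation the gluing maps the crossings on one edge injectively into those on the other. The
    inverse gluing gives the opposite inequality. *)
Lemma edge_count_le i a j s b c : glue T i a = Some (j, s) ->
  uniq [:: a; b; c] -> (edge_count i b c <= edge_count j (s b) (s c))%N.
Proof.
move=> e /=; rewrite !inE negb_or andbT => /andP[/andP[ab ac] bc].
have [s1 [u1 <- h1]] := carrier_edge_seq i bc.
have sbc : s b != s c by rewrite (inj_eq perm_inj).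
have [s2 [u2 <- h2]] := carrier_edge_seq j sbc.
pose mv (x : 'rV[R]_4) : 'rV[R]_4 := \row_v x 0 ((s^-1)%g v).
have mvi : injective mv.
  move=> x y /rowP xy; apply/rowP => v; have := xy (s v).
  by rewrite !mxE permK.
rewrite -(size_map mv s1); apply: uniq_leq_size; first by rewrite map_inj_uniq.
move=> _ /mapP[x /h1[cx ex] ->]; apply/h2.
have st : face_step T (i, x) (j, mv x).
  exists a, s; split=> //=; last by move=> v; rewrite mxE permK.
  by split; [exact: ex.1 | apply: ex.2].
have [_ _ [ct cs]] := hS; have cy := cs _ _ st cx; split=> //.
split; first exact: ct cy.
move=> d db dc; rewrite mxE; apply: ex.2.
  by apply: contraNneq db => <-; rewrite permKV.
by apply: contraNneq dc => <-; rewrite permKV.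
Qed.

Lemma edge_count_glue i a j s b c : glue T i a = Some (j, s) ->
  uniq [:: a; b; c] -> edge_count i b c = edge_count j (s b) (s c).
Proof.
move=> e u; apply/eqP; rewrite eqn_leq (edge_count_le e u) /=.
have := edge_count_le (glue_sym e) (b := s b) (c := s c).
rewrite !permK; apply.
by rewrite -[X in uniq X]/(map s [:: a; b; c]) map_inj_uniq//; exact: perm_inj.
Qed.

(* The number of arcs around the corner [b] in the face opposite [a]. *)
Definition corner_arcs (t : disc_type) (a b : 'I_4) : int :=
  match t with
  | Tri v => (b == v)%:Z
  | Quad m => (m == quad_separating a b)%:Z
  | Oct m => 1 - (m == quad_separating a b)%:Z
  end.

(** Every arc about [b] ends on [bc] and on [bd]; every other arc of the face has one end on [cd]
    and one on [bc] or [bd]. Edge counts therefore determine corner counts. *)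
Lemma corner_arcsE t a b c d : uniq [:: a; b; c; d] ->
  (edge_weight t b c)%:Z + (edge_weight t b d)%:Z =
  (edge_weight t c d)%:Z + 2 * corner_arcs t a b.
Proof.
move=> u; have [[ab ac ad] [bc bd cd]] := uniq4_ne u.
have key m : (m == quad_separating a b) = same_side m a b.
  by rewrite same_side_sepE.
have ss m : [\/ [/\ same_side m a b, same_side m c d, same_side m b c = false & same_side m b d = false],
    [/\ same_side m a b = false, same_side m c d = false, same_side m b c = false & same_side m b d] |
    [/\ same_side m a b = false, same_side m c d = false, same_side m b c & same_side m b d = false]].
  have uc : uniq [:: a; c; b; d] by rewrite uniq4_swap23.
  have ud : uniq [:: a; d; b; c] by rewrite uniq4_swap23 uniq4_swap34.
  case: (same_side_cases m u) => E.
  - by constructor 1; have [] := same_side_uniq u E.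
  - by constructor 2; have [h1 h2 _ h3 h4] := same_side_uniq uc E; split=> //; rewrite same_sideC.
  - by constructor 3; have [h1 h2 _ h3 h4] := same_side_uniq ud E; split=> //; rewrite same_sideC.
case: t => [v|m|m] /=; rewrite ?key.
- case: (eqVneq b v) => [<-|_]; rewrite ?(eq_sym c b) ?(eq_sym d b) ?(negPf bc) ?(negPf bd) /=.
    by [].
  case: (eqVneq c v) => [<-|_]; rewrite ?(eq_sym d c) ?(negPf cd)//=.
  by case: (d == v).
- by case: (ss m) => -[-> -> -> ->].
- by case: (ss m) => -[-> -> -> ->].
Qed.

Definition face_corner i a b : int := \sum_(l < npieces S i) corner_arcs (piece_type l) a b.

Lemma face_cornerE i a b c d : uniq [:: a; b; c; d] ->
  (edge_count i b c)%:Z + (edge_count i b d)%:Z =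
  (edge_count i c d)%:Z + 2 * face_corner i a b.
Proof.
move=> u; rewrite /edge_count /face_corner !(big_morph Posz PoszD (erefl _)).
rewrite mulr_sumr -!big_split /=; apply: eq_bigr => l _; exact: corner_arcsE.
Qed.

Lemma face_corner_glue i a j s b : glue T i a = Some (j, s) -> a != b ->
  face_corner i a b = face_corner j (s a) (s b).
Proof.
move=> e ab; have [c [d u]] := two_more ab.
have us : uniq [:: s a; s b; s c; s d].
  by rewrite -[X in uniq X]/(map s [:: a; b; c; d]) map_inj_uniq//; exact: perm_inj.
have [[_ ac ad] [bc bd cd]] := uniq4_ne u.
have := face_cornerE i u; have := face_cornerE j us.
rewrite -!(edge_count_glue e) /= ?inE ?negb_or ?ab ?ac ?ad ?bc ?bd ?cd//.
by move=> -> /addrI/mulfI ->.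
Qed.

(** The part of a corner count that is the same in all faces at [b]. The [1] of an octagon is placed
    here, so that exactly its coordinate in the joint vector, with its minus sign, remains. *)
Definition corner_base i b : int :=
  \sum_(l < npieces S i) match piece_type l with
    Tri v => (b == v)%:Z | Quad _ => 0 | Oct _ => 1 end.

Lemma face_corner_joint i a b :
  face_corner i a b = corner_base i b + joint_vector S i (quad_separating a b).
Proof.
rewrite joint_vectorE /quad_count /oct_count -!sum1_card.
rewrite !(big_morph Posz PoszD (erefl _)) !(big_mkcond (fun l => l \in _)) /=.
rewrite -sumrB -big_split /=; apply: eq_bigr => l _; rewrite !inE.
by case: (piece_type l) => [v|m|m] /=; case: eqP.
Qed.

(** In each visit the base term at [U] occurs on both sides and cancels. The face left by one visit
    is the face through which the next one enters, so the corner counts on the two sides agree after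
    a shift by one visit. *)
Lemma joint_matching : matching_equations R T (joint_vector S).
Proof.
move=> f /nonboundary_glued gf; rewrite !orbit_sum//.
pose Q (g : visit n) := fconnect (turn_visit T) f g.
pose NX (g : visit n) := face_corner g.1 (g.2 idxX) (g.2 idxU).
pose NY (g : visit n) := face_corner g.1 (g.2 idxY) (g.2 idxU).
pose B (g : visit n) := corner_base g.1 (g.2 idxU).
have sepC a b : quad_separating a b = quad_separating b a.
  by rewrite /quad_separating; under eq_pick do rewrite same_sideC.
have eX g : joint_vector S g.1 (upward g) = NX g - B g.
  by rewrite /NX face_corner_joint /upward sepC /B addrAC subrr add0r.
have eY g : joint_vector S g.1 (downward g) = NY g - B g.
  by rewrite /NY face_corner_joint /downward sepC /B addrAC subrr add0r.
rewrite (eq_bigr _ (fun g _ => eX g)) (eq_bigr _ (fun g _ => eY g)) !sumrB.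
congr (_ - _); rewrite -(turn_orbit_shift T NY); apply: eq_bigr => g Qg.
have gg : exit_glued T g by rewrite -(iter_findex Qg); exact: gf.
have [j [s [e ->]]] := exit_gluedP gg.
rewrite /NX /NY /= !permM (tpermR idxX idxY) tpermD//.
apply: face_corner_glue => //.
by have [[_ UX _] _] := uniq4_ne (visit_uniq g); rewrite eq_sym.
Qed.

End SurfaceVector.

Lemma joint_conditions (R : realType) n (T : face_gluing n) (S : pieces R n) :
  embedded_normal T S \/ octagonal_almost_normal T S ->
  let w := joint_vector S in
  [/\ forall i m i' m', w i m < 0 -> w i' m' < 0 -> (i, m) = (i', m'),
      matching_equations R T w, quad_constraints w &
      forall i m, w i m < 0 -> w i m = -1].
Proof.
move=> hS; have [mS tot] : made_of_pieces T S /\ (total_octs S <= 1)%N.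
  by case: hS => -[h ->].
split.
- by move=> i m i' m' /joint_neg h /joint_neg h'; exact: oct_count_unique tot h h'.
- exact: joint_matching.
- exact: joint_quad_constraints mS tot.
- move=> i m wn; have := oct_count_le S i m; have := joint_neg wn; move: wn.
  rewrite joint_vectorE; lia.
Qed.

(** * Potentials on edge ends *)

Section EdgePotential.
Variables (R : realType) (n : nat) (T : face_gluing n).
Implicit Types f g : visit n.

Notation turn := (turn_visit T).

Definition interior_visit f := forall k, exit_glued T (iter k turn f).

Lemma interior_exit f : interior_visit f -> exit_glued T f.
Proof. exact: (fun h => h 0%N). Qed.

Lemma interior_turn f : interior_visit f -> interior_visit (turn f).
Proof. by move=> hf k; rewrite -iterSr; exact: hf. Qed.

Lemma interior_pred f : interior_visit f -> exists2 g, interior_visit g & turn g = f.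
Proof.
move=> hf; exists (finv turn f); last exact: (f_finv (@turn_inj n T)).
by move=> k; rewrite /finv -iterD; exact: hf.
Qed.

Lemma interior_vswap f : interior_visit f -> interior_visit (vswap f).
Proof.
move=> hf k.
have [x hx ->] : exists2 x, interior_visit x & iter k turn (vswap f) = vswap x.
  elim: k => [|k [x hx IH]]; first by exists f.
  have [y hy yx] := interior_pred hx.
  by exists y => //; rewrite iterS IH -yx turn_swap_turn.
have [y hy <-] := interior_pred hx; apply: glued_swap_turn; exact: interior_exit.
Qed.

Lemma face_step_sym (p q : 'I_n * 'rV[R]_4) : face_step T p q -> face_step T q p.
Proof.
move=> [a [s [e [tp pa] qp]]]; exists (s a), (s^-1)%g; split.
- exact: glue_sym e.
- split; last by rewrite qp.
  split=> [v|]; first by rewrite -(permKV s v) qp; exact: tp.1.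
  rewrite -tp.2 (reindex_inj (@perm_inj _ s)); apply: eq_bigr => v _.
  exact: qp.
- by move=> v; rewrite -qp permKV.
Qed.

Definition edge_mid (a b : 'I_4) : 'rV[R]_4 :=
  \row_v (if (v == a) || (v == b) then 1 / 2 else 0).

Lemma edge_midP (a b : 'I_4) : a != b -> edge a b (edge_mid a b).
Proof.
move=> ab; split; last by move=> c /negPf ca /negPf cb; rewrite mxE ca cb.
split=> [v|]; first by rewrite mxE; case: ifP => // _; rewrite divr_ge0.
have [c [d u]] := two_more ab; have [[_ ac ad] [bc bd cd]] := uniq4_ne u.
rewrite (big_uniq4 _ u) !mxE !eqxx /= orbT (eq_sym c) (eq_sym c) (eq_sym d) (eq_sym d).
rewrite (negPf ac) (negPf bc) (negPf ad) (negPf bd) /=; lra.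
Qed.

(** The converse of [nonboundary_glued]. In each tetrahedron the midpoint of an edge lies in two
    faces only, the entrance and exit faces of its visit. Its identification class is therefore
    swept out by interior visits, whose faces are all glued. *)
Lemma interior_nonboundary f : interior_visit f ->
  ~ boundary_edge R T f.1 (f.2 idxU) (f.2 idxL).
Proof.
move=> hf bd; have [[UL _ _] _] := uniq4_ne (visit_uniq f).
have [j [y [c [+ gc [ty yc]]]]] := bd _ (edge_midP UL).
pose Inv (p : 'I_n * 'rV[R]_4) := exists2 g, interior_visit g &
  p = (g.1, edge_mid (g.2 idxU) (g.2 idxL)).
have avoid g a : (edge_mid (g.2 idxU) (g.2 idxL)) 0 a = 0 -> a = g.2 idxX \/ a = g.2 idxY.
  rewrite mxE; case: ifP => [_ /eqP|/negbT]; first by rewrite mul1r invr_eq0 pnatr_eq0.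
  rewrite negb_or => /andP[/eqP aU /eqP aL] _.
  by case: (uniq4_cases a (visit_uniq g)) => //; [left|right].
have stp p q : face_step T p q -> Inv p -> Inv q.
  move=> [a [s [e [tp pa] qp]]] [g hg pe].
  have key g' : interior_visit g' -> p = (g'.1, edge_mid (g'.2 idxU) (g'.2 idxL)) ->
      a = g'.2 idxX -> Inv q.
    move=> hg' pe' aX; exists (turn g'); first exact: interior_turn.
    have [j' [s' [e' ->]]] := exit_gluedP (interior_exit hg').
    move: e; rewrite pe' /= aX e' => -[jE sE]; rewrite [LHS]surjective_pairing -jE.
    congr (_, _); apply/rowP => v; rewrite -(permKV s' v).
    by rewrite {1}sE qp pe' !mxE !permM !tpermD// !(inj_eq perm_inj).
  have [aX|aY] : a = g.2 idxX \/ a = g.2 idxY by apply: avoid; rewrite -pa pe.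
    exact: key pe aX.
  apply: (key (vswap g)); first exact: interior_vswap.
    by rewrite pe /= !permM !tpermD.
  by rewrite aY permM tpermL.
have inv p q : identified T p q -> Inv p <-> Inv q.
  elim=> [p' q' h|p'|p' q' _ IH|p' q' r' _ IH1 _ IH2]; [|by []|by rewrite IH|by rewrite IH1].
  by split; apply: stp => //; exact: face_step_sym.
move=> /inv[+ _]; case; first by exists f.
move=> g hg [jg yg]; move: yc; rewrite yg => /avoid[] cE; move: gc; rewrite cE jg.
  by have := interior_exit hg; rewrite /exit_glued => + E; rewrite E.
have := interior_exit (interior_vswap hg).
by rewrite /exit_glued /= permM tpermL => + E; rewrite E.
Qed.

Variable w : 'M[int]_(n, 3).
Hypothesis hw : matching_equations R T w.

(** The increase of the face-independent count at [U] that makes the corner counts agree in the face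
    between two consecutive visits. An unglued face imposes nothing, hence the value 0. *)
Definition jump f : int :=
  if exit_glued T f then w f.1 (upward f) - w (turn f).1 (downward (turn f)) else 0.

Lemma upward_vswap f : upward (vswap f) = downward f.
Proof. by rewrite /upward /downward /= !permM tpermL tpermD. Qed.

Lemma downward_vswap f : downward (vswap f) = upward f.
Proof. by rewrite /upward /downward /= !permM tpermR tpermD. Qed.

Lemma jump_back f : jump (vswap (turn f)) = - jump f.
Proof.
rewrite /jump turn_swap_turn downward_vswap upward_vswap /=.
case: ifPn => gf; last first.
  case: ifPn => gf' //; have := glued_swap_turn gf'.
  by rewrite (negPf gf).
case: ifPn => gf'; first by rewrite opprB.
move: gf; rewrite /turn_visit (negPf gf') vswapK => gf.
by rewrite gf in gf'.
Qed.

(** Around an interior edge this is the matching equation. Otherwise the walk turns back at an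
    unglued face, so its orbit is closed under reversal; the involution [rho] negates the jumps and
    the sum equals its own negative. *)
Lemma jump_orbit_sum f : \sum_(g | fconnect turn f g) jump g = 0.
Proof.
have [gf|] := pselect (interior_visit f).
  have ne : forall g, fconnect turn f g -> jump g =
      w g.1 (upward g) - w (turn g).1 (downward (turn g)).
    by move=> g /iter_findex <-; rewrite /jump gf.
  rewrite (eq_bigr _ ne) sumrB (turn_orbit_shift T (fun g => w g.1 (downward g))).
  rewrite -(orbit_sum (fun g => w g.1 (upward g)) gf).
  rewrite -(orbit_sum (fun g => w g.1 (downward g)) gf).
  by rewrite hw ?subrr//; exact: interior_nonboundary.
move=> /existsNP[k /negP nk]; set e := iter k turn f in nk.
have sym := fconnect_sym (@turn_inj n T).
have fe : fconnect turn f e by exact: fconnect_iter.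
have te : turn e = vswap e by rewrite /turn_visit (negPf nk).
have cl g : fconnect turn f g -> fconnect turn f (vswap g).
  move=> fg; have eg : fconnect turn e g by apply: connect_trans fg; rewrite sym.
  rewrite -(iter_findex eg); elim: (findex _ _ _) => [|m IH] /=.
    by rewrite -te; apply: connect_trans fe _; exact: fconnect1.
  apply: connect_trans IH _; rewrite sym -(turn_swap_turn T (iter m turn e)).
  exact: fconnect1.
pose rho g := vswap (turn g).
have rhoK : involutive rho by move=> g; rewrite /rho turn_swap_turn vswapK.
have rhoQ g : fconnect turn f (rho g) = fconnect turn f g.
  have one x : fconnect turn f x -> fconnect turn f (rho x).
    by move=> fx; apply: cl; apply: connect_trans fx _; exact: fconnect1.
  by apply/idP/idP => /one //; rewrite rhoK.
have : \sum_(g | fconnect turn f g) jump g = - \sum_(g | fconnect turn f g) jump g.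
  rewrite {1}(reindex_inj (inv_inj rhoK)) -sumrN /=; apply: eq_big => [g|g _].
    exact: rhoQ.
  exact: jump_back.
lia.
Qed.

Definition visit_sum m f : R := \sum_(j < m) (jump (iter j turn f))%:~R.

Lemma visit_sumS m f : visit_sum m.+1 f = (jump f)%:~R + visit_sum m (turn f).
Proof.
rewrite /visit_sum big_ord_recl /=; congr (_ + _).
by apply: eq_bigr => j _; rewrite -iterSr.
Qed.

Lemma visit_sum_order f : visit_sum (fingraph.order turn f) f = 0.
Proof.
rewrite /visit_sum -(big_mkord xpredT (fun j => (jump (iter j turn f))%:~R)).
have -> : \sum_(0 <= j < fingraph.order turn f) (jump (iter j turn f))%:~R =
  \sum_(g <- orbit turn f) (jump g)%:~R :> R.
  rewrite (big_nth f) size_orbit [RHS]big_nat [LHS]big_nat.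
  by apply: eq_bigr => j /andP[_ jo]; rewrite nth_traject.
rewrite -(big_morph (intr : int -> R) (@rmorphD _ _ _) (rmorph0 _)).
have -> : \sum_(g <- orbit turn f) jump g = \sum_(g | fconnect turn f g) jump g.
  rewrite -[RHS]big_filter; apply: perm_big; apply: uniq_perm.
  - exact: orbit_uniq.
  - exact/filter_uniq/index_enum_uniq.
  - by move=> g; rewrite -fconnect_orbit mem_filter mem_index_enum andbT.
by rewrite jump_orbit_sum.
Qed.

(** The potential of [jump] normalised to mean zero over the orbit. It is determined by the visit
    alone, with no base point to choose on the cycle. *)
Definition visit_mean f : R :=
  - ((fingraph.order turn f)%:R^-1 * \sum_(m < fingraph.order turn f) visit_sum m f).

Lemma visit_mean_turn f : visit_mean (turn f) = visit_mean f + (jump f)%:~R.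
Proof.
have oE : fingraph.order turn (turn f) = fingraph.order turn f.
  by apply: eq_card => g; rewrite !inE -(same_fconnect1 (@turn_inj n T)).
rewrite /visit_mean oE; set M := fingraph.order turn f.
have M0 : M%:R != 0 :> R by rewrite pnatr_eq0 -lt0n fingraph.order_gt0.
have -> : \sum_(m < M) visit_sum m (turn f) =
   \sum_(m < M) visit_sum m f - M%:R * (jump f)%:~R.
  rewrite (eq_bigr (fun m : 'I_M => visit_sum m.+1 f - (jump f)%:~R)); last first.
    by move=> m _; rewrite visit_sumS addrAC subrr add0r.
  rewrite sumrB sumr_const card_ord -[_ *+ M]mulr_natl; congr (_ - _).
  (* Moving the window by one step changes the total by the sum of the jumps over the whole orbit,
     which vanishes. *)
  apply/eqP; rewrite -subr_eq0 -sumrB.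
  rewrite -(big_mkord xpredT (fun m => visit_sum m.+1 f - visit_sum m f)).
  by rewrite telescope_sumr// visit_sum_order /visit_sum big_ord0 subrr.
by rewrite mulrBr mulKf// opprB addrC.
Qed.

(** Symmetrised over the two directions, so that within a tetrahedron the value depends on the edge
    and its upper end only. *)
Definition visit_potential f : R := (visit_mean f + visit_mean (vswap f)) / 2.

Lemma visit_potential_vswap f : visit_potential (vswap f) = visit_potential f.
Proof. by rewrite /visit_potential vswapK addrC. Qed.

Lemma visit_potential_turn f :
  visit_potential (turn f) = visit_potential f + (jump f)%:~R.
Proof.
have := visit_mean_turn (vswap (turn f)).
rewrite turn_swap_turn jump_back rmorphN /= => e.
rewrite /visit_potential visit_mean_turn e; lra.
Qed.

Lemma visit_exists (u k a b : 'I_4) : uniq [:: u; k; a; b] ->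
  exists s : {perm 'I_4}, [/\ s idxU = u, s idxL = k, s idxX = a & s idxY = b].
Proof.
move=> uq; pose F (i : 'I_4) := nth u [:: u; k; a; b] i.
have Fi : injective F.
  move=> i j /eqP; rewrite /F nth_uniq// => /eqP; exact: val_inj.
by exists (perm Fi); rewrite !permE.
Qed.

Lemma edge_potential : exists h : 'I_n -> 'I_4 -> 'I_4 -> R,
  forall i a j s u k, glue T i a = Some (j, s) -> uniq [:: a; u; k] ->
  h j (s u) (s k) = h i u k +
    (w i (quad_separating u a) - w j (quad_separating (s u) (s a)))%:~R.
Proof.
(* Some labelling with the given [U] and [L]. The two possible ones differ by [vswap], which leaves
   the potential unchanged. *)
pose sel (u k : 'I_4) := odflt 1%g [pick s : {perm 'I_4} | (s idxU == u) && (s idxL == k)].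
have selE i (s : {perm 'I_4}) :
    visit_potential (i, sel (s idxU) (s idxL)) = visit_potential (i, s).
  rewrite /sel; case: pickP => [r /andP[/eqP rU /eqP rL]|/(_ s)]; last by rewrite !eqxx.
  rewrite /=; have [[_ UX UY] [LX LY _]] := uniq4_ne (visit_uniq ((i, s) : visit n)).
  have rX : r idxX != s idxU /\ r idxX != s idxL.
    by rewrite -rU -rL !(inj_eq perm_inj).
  have rY : r idxY != s idxU /\ r idxY != s idxL.
    by rewrite -rU -rL !(inj_eq perm_inj).
  have rXY : r idxX != r idxY by rewrite (inj_eq perm_inj).
  case: (uniq4_cases (r idxX) (visit_uniq ((i, s) : visit n))) => /= EX;
    rewrite EX ?eqxx in rX rXY; try by case: rX.
    suff -> : r = s by [].
    apply/permP => v; case: (uniq4_cases v (_ : uniq [:: idxU; idxL; idxX; idxY])) => // -> //.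
    case: (uniq4_cases (r idxY) (visit_uniq ((i, s) : visit n))) => /= EY //;
    by rewrite EY ?eqxx in rY rXY; case: rY.
  suff -> : (i, r) = vswap (i, s) by rewrite visit_potential_vswap.
  congr (_, _); apply/permP => v; rewrite permM.
  case: (uniq4_cases v (_ : uniq [:: idxU; idxL; idxX; idxY])) => // ->;
    rewrite ?tpermL ?tpermR ?tpermD//.
  case: (uniq4_cases (r idxY) (visit_uniq ((i, s) : visit n))) => /= EY //;
  by rewrite EY ?eqxx in rY rXY; case: rY.
exists (fun i u k => visit_potential (i, sel u k)) => i a j s u k e uq.
have [b uq4] : exists b, uniq [:: u; k; a; b].
  have [b ub] := one_more uq; exists b; move: ub.
  by rewrite uniq4_swap12 uniq4_swap23.
have [r [rU rL rX rY]] := visit_exists uq4.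
pose f : visit n := (i, r).
have gf : exit_glued T f by rewrite /exit_glued /= rX e.
have tE : turn f = (j, (tperm idxX idxY * r * s)%g).
  have [j' [s' [e' ->]]] := exit_gluedP gf.
  by move: e'; rewrite /= rX e => -[-> ->].
have := visit_potential_turn f; rewrite tE -selE !permM !tpermD// rU rL => ->.
rewrite -(selE i r) rU rL; congr (_ + _%:~R).
rewrite /jump gf tE /upward /downward /= !permM !tpermR !tpermD//.
by rewrite rU rX.
Qed.

End EdgePotential.

(** * Lifting over spheres and discs *)

Section RowVectors.
Variable R : realType.

Lemma rv_norm_le (d : nat) (x : 'rV[R]_d) (e : R) : 0 <= e ->
  (`|x| <= e) = [forall i, `|x 0 i| <= e].
Proof.
move=> e0; rewrite [in LHS]/Num.Def.normr /= mx_normrE.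
apply/bigmax_leP/forallP => [[_ h] i|h]; first exact: (h (0, i)).
by split=> // -[j i] _ /=; rewrite ord1; exact: h.
Qed.

Lemma rv_norm_coord (d : nat) (x : 'rV[R]_d) i : `|x 0 i| <= `|x|.
Proof. by move: i; apply/forallP; rewrite -rv_norm_le. Qed.

Lemma within_continuous_row (U : topologicalType) (d : nat) (A : set U)
    (f : U -> 'rV[R]_d) :
  (forall i, {within A, continuous (fun x => f x 0 i)}) -> {within A, continuous f}.
Proof.
move=> cf; apply/subspace_continuousP => x Ax.
apply/cvgrPdist_le => e e0; near=> y; rewrite rv_norm_le ?ltW//; apply/forallP => i.
rewrite !mxE; move: i; near: y; apply: filter_forall => i.
have /subspace_continuousP/(_ x Ax)/cvgrPdist_le/(_ e e0) := cf i.
exact.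
Unshelve. all: by end_near. Qed.

Lemma ball_set_compact d : compact (@ball_set R d).
Proof.
have -> : @ball_set R d = [set v : 'rV[R]_d | forall i, `[-1, 1]%classic (v ord0 i)].
  apply/seteqP; split => v; rewrite /ball_set /= rv_norm_le//.
    by move=> /forallP h i; rewrite in_itv /= -ler_norml.
  by move=> h; apply/forallP => i; have := h i; rewrite in_itv /= -ler_norml.
by have := (@rV_compact R d (fun=> `[-1, 1]%classic) (fun=> @segment_compact R (-1) 1)).
Qed.

Lemma closed_pre (U : topologicalType) (f : U -> R) (D : set R) :
  continuous f -> closed D -> closed (f @^-1` D).
Proof. by move=> cf cD; apply: preimage_closed cD => x _; exact: cf. Qed.

Lemma continuous_sum (U : topologicalType) (I : Type) (r : seq I) (P : pred I)
    (F : I -> U -> R) : (forall i, continuous (F i)) ->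
  continuous (fun x => \sum_(i <- r | P i) F i x).
Proof.
move=> cF; elim: r => [|i r IH] x.
  by under eq_fun do rewrite big_nil; exact: cvg_cst.
under eq_fun do rewrite big_cons.
case: (P i); last exact: IH.
by apply: cvgD; [exact: cF|exact: IH].
Qed.

Lemma continuous_minr (U : topologicalType) (f g : U -> R) :
  continuous f -> continuous g -> continuous (fun x => Num.min (f x) (g x)).
Proof. by move=> cf cg x; exact: (@continuous_min R U f g x (cf x) (cg x)). Qed.

Lemma continuous_maxr (U : topologicalType) (f g : U -> R) :
  continuous f -> continuous g -> continuous (fun x => Num.max (f x) (g x)).
Proof. by move=> cf cg x; exact: (@continuous_max R U f g x (cf x) (cg x)). Qed.

Lemma continuousBr (U : topologicalType) (f g : U -> R) :
  continuous f -> continuous g -> continuous (fun x => f x - g x).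
Proof. by move=> cf cg x; apply: cvgB; [exact: cf|exact: cg]. Qed.

Lemma continuousMr (U : topologicalType) (f g : U -> R) :
  continuous f -> continuous g -> continuous (fun x => f x * g x).
Proof. by move=> cf cg x; apply: cvgM; [exact: cf|exact: cg]. Qed.

Lemma continuous_cstr (U : topologicalType) (c : R) : continuous (fun _ : U => c).
Proof. by move=> x; exact: cvg_cst. Qed.

Lemma tetra_compact : compact (@tetra R).
Proof.
apply: (@subclosed_compact _ _ [set v : 'rV[R]_4 | forall i, `[0, 1]%classic (v ord0 i)]).
- have -> : @tetra R = (\bigcap_i [set x : 'rV[R]_4 | 0 <= x 0 i]) `&` [set x : 'rV[R]_4 | \sum_i x 0 i = 1].
    apply/seteqP; split=> x [h1 h2]; first by split=> // i _; exact: h1.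
    by split=> // i; exact: (h1 i I).
  apply: closedI.
    apply: closed_bigI => i _.
    exact: (@closed_pre _ (fun x : 'rV[R]_4 => x 0 i) [set y | 0 <= y] (@coord_continuous _ _ _ _ _) (@closed_ge _ _)).
  apply: (@closed_pre _ (fun x : 'rV[R]_4 => \sum_i x 0 i) [set y | y = 1]); last exact: closed_eq.
  by apply: continuous_sum => i; exact: coord_continuous.
- by have := (@rV_compact R 4 (fun=> `[0, 1]%classic) (fun=> @segment_compact R 0 1)).
- move=> x [x0 x1] i /=; rewrite in_itv /= x0 -x1 (bigD1 i)//= lerDl.
  by apply: sumr_ge0 => j _.
Qed.

End RowVectors.

(** * The surface of a cube as a quotient of a square *)

Section SphereParam.
Variable R : realType.

Definition row2 (a b : R) : 'rV[R]_2 := \row_i (if i == ord0 then a else b).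

Lemma row2E (a b : R) : (row2 a b 0 ord0 = a) * (row2 a b 0 ord_max = b).
Proof. by rewrite !mxE. Qed.

Lemma ord2_cases (i : 'I_2) : i = ord0 \/ i = ord_max.
Proof. by case: i => [[|[|//]] h]; [left|right]; exact: val_inj. Qed.

Lemma row2_eta (y : 'rV[R]_2) : y = row2 (y 0 ord0) (y 0 ord_max).
Proof. by apply/rowP => i; rewrite !mxE; case: (ord2_cases i) => ->. Qed.

Lemma norm2E (y : 'rV[R]_2) : `|y| = Num.max `|y 0 ord0| `|y 0 ord_max|.
Proof.
apply/le_anti/andP; split; last by rewrite ge_max !rv_norm_coord.
rewrite rv_norm_le ?le_max ?normr_ge0//; apply/forallP => i.
by case: (ord2_cases i) => ->; rewrite le_max lexx ?orbT.
Qed.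

Definition o3 : 'I_3 := lift ord0 ord0.

Definition row3 (a b c : R) : 'rV[R]_3 :=
  \row_i (if i == ord0 then a else if i == o3 then b else c).

Lemma row3E (a b c : R) :
  (row3 a b c 0 ord0 = a) * (row3 a b c 0 o3 = b) * (row3 a b c 0 ord_max = c).
Proof. by rewrite !mxE. Qed.

Lemma ord3_cases (i : 'I_3) : [\/ i = ord0, i = o3 | i = ord_max].
Proof.
by case: i => [[|[|[|//]]] h]; [constructor 1|constructor 2|constructor 3]; exact: val_inj.
Qed.

Lemma norm3E (y : 'rV[R]_3) :
  `|y| = Num.max (Num.max `|y 0 ord0| `|y 0 o3|) `|y 0 ord_max|.
Proof.
apply/le_anti/andP; split; last by rewrite !ge_max !rv_norm_coord.
rewrite rv_norm_le ?le_max ?normr_ge0 ?orbT//; apply/forallP => i.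
by case: (ord3_cases i) => ->; rewrite !le_max lexx ?orbT.
Qed.

(* The square is wrapped around the cube: its inner third (linear size) covers
   the top face, the middle ring the four sides, and the outer ring the bottom
   face, with the boundary collapsed to the centre of that face. *)
Definition wrap_scale (r : R) : R := Num.min 1 (3 * (1 - r)) / Num.max r (1 / 3).
Definition wrap_height (r : R) : R := Num.max (-1) (Num.min 1 (3 - 6 * r)).
Definition wrap (y : 'rV[R]_2) : 'rV[R]_3 :=
  row3 (wrap_scale `|y| * y 0 ord0) (wrap_scale `|y| * y 0 ord_max) (wrap_height `|y|).

Lemma wrap_top r : r <= 1 / 3 -> wrap_scale r = 3 /\ wrap_height r = 1.
Proof.
move=> h; rewrite /wrap_scale /wrap_height (min_idPl _); last by lra.
rewrite (max_idPr _)// (min_idPl _); last by lra.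
by rewrite (max_idPr _); [split; lra|lra].
Qed.

Lemma wrap_side r : 1 / 3 <= r -> r <= 2 / 3 ->
  wrap_scale r = r^-1 /\ wrap_height r = 3 - 6 * r.
Proof.
move=> h h'; rewrite /wrap_scale /wrap_height (min_idPl _); last by lra.
rewrite (max_idPl _)// (min_idPr _); last by lra.
by rewrite (max_idPr _) ?mul1r //; lra.
Qed.

Lemma wrap_bottom r : 2 / 3 <= r -> r <= 1 ->
  wrap_scale r = 3 * (1 - r) / r /\ wrap_height r = -1.
Proof.
move=> h h'; rewrite /wrap_scale /wrap_height (min_idPr _); last by lra.
rewrite (max_idPl _); last by lra.
rewrite (min_idPr _); last by lra.
by rewrite (max_idPl _)//; lra.
Qed.

Lemma wrap_norm (y : 'rV[R]_2) : 0 <= wrap_scale `|y| ->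
  Num.max `|wrap y 0 ord0| `|wrap y 0 o3| = wrap_scale `|y| * `|y|.
Proof.
by move=> h; rewrite /wrap !row3E !(normrM (wrap_scale _)) (ger0_norm h) -maxr_pMr// -norm2E.
Qed.

Lemma wrap_cases (r : R) : 0 <= r <= 1 ->
  [\/ r <= 1 / 3, 1 / 3 < r /\ r < 2 / 3 | 2 / 3 <= r].
Proof.
move=> /andP[r0 r1]; case: (leP r (1 / 3)) => h1; first by constructor 1.
by case: (ltP r (2 / 3)) => h2; [constructor 2|constructor 3].
Qed.

Lemma wrap_scale_ge0 r : 0 <= r <= 1 -> 0 <= wrap_scale r.
Proof.
move=> /andP[r0 r1]; rewrite divr_ge0// ?le_min ?le_max ?r0//; lra.
Qed.

Lemma wrap_sphere (y : 'rV[R]_2) : `|y| <= 1 -> `|wrap y| = 1.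
Proof.
move=> y1; have y01 : 0 <= `|y| <= 1 by rewrite normr_ge0.
rewrite norm3E wrap_norm ?wrap_scale_ge0// /wrap row3E.
case: (wrap_cases y01) => [h|[h h']|h].
- have [-> ->] := wrap_top h; rewrite normr1 (max_idPr _)//; lra.
- have [-> ->] := wrap_side (ltW h) (ltW h').
  rewrite mulVf; last by rewrite gt_eqF//; lra.
  by rewrite (max_idPl _)// ler_norml; apply/andP; split; lra.
- have [-> ->] := wrap_bottom h y1; rewrite normrN normr1 mulfVK.
    by rewrite (max_idPr _)//; lra.
  by rewrite gt_eqF//; lra.
Qed.

(** The height separates the three regions and gives the radius in the middle one. In the other two
    it is constant, and there the norm of the horizontal part gives the radius. The scale then
    allows the point itself to be recovered unless it vanishes, which happens only on the
    boundary. *)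
Lemma wrap_inj (y y' : 'rV[R]_2) : `|y| <= 1 -> `|y'| <= 1 -> wrap y = wrap y' ->
  y = y' \/ `|y| = 1 /\ `|y'| = 1.
Proof.
move=> y1 y1' e.
have y01 : 0 <= `|y| <= 1 by rewrite normr_ge0.
have y01' : 0 <= `|y'| <= 1 by rewrite normr_ge0.
have eh : wrap_height `|y| = wrap_height `|y'|.
  by have := congr1 (fun z : 'rV[R]_3 => z 0 ord_max) e; rewrite /wrap !row3E.
have e0 : wrap_scale `|y| * y 0 ord0 = wrap_scale `|y'| * y' 0 ord0.
  by have := congr1 (fun z : 'rV[R]_3 => z 0 ord0) e; rewrite /wrap !row3E.
have e1 : wrap_scale `|y| * y 0 ord_max = wrap_scale `|y'| * y' 0 ord_max.
  by have := congr1 (fun z : 'rV[R]_3 => z 0 o3) e; rewrite /wrap !row3E.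
have en : wrap_scale `|y| * `|y| = wrap_scale `|y'| * `|y'|.
  by rewrite -!wrap_norm ?wrap_scale_ge0// e.
have fin : `|y| = `|y'| -> wrap_scale `|y| != 0 -> y = y'.
  move=> E s0; rewrite -E in e0 e1.
  by rewrite (row2_eta y) (row2_eta y') (mulfI s0 e0) (mulfI s0 e1).
case: (wrap_cases y01) => [h|[h h']|h]; case: (wrap_cases y01') => [k|[k k']|k].
- left; move: en fin; rewrite (wrap_top h).1 (wrap_top k).1 => en; apply => //.
  by apply: (@mulfI _ 3) => //; rewrite pnatr_eq0.
- by move: eh; rewrite (wrap_top h).2 (wrap_side (ltW k) (ltW k')).2; lra.
- by move: eh; rewrite (wrap_top h).2 (wrap_bottom k y1').2; lra.
- by move: eh; rewrite (wrap_top k).2 (wrap_side (ltW h) (ltW h')).2; lra.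
- left; apply: fin.
    by move: eh; rewrite (wrap_side (ltW k) (ltW k')).2 (wrap_side (ltW h) (ltW h')).2; lra.
  by rewrite (wrap_side (ltW h) (ltW h')).1 invr_eq0 gt_eqF//; lra.
- by move: eh; rewrite (wrap_bottom k y1').2 (wrap_side (ltW h) (ltW h')).2; lra.
- by move: eh; rewrite (wrap_top k).2 (wrap_bottom h y1).2; lra.
- by move: eh; rewrite (wrap_side (ltW k) (ltW k')).2 (wrap_bottom h y1).2; lra.
- have n0 : `|y| != 0 by rewrite gt_eqF//; lra.
  have n0' : `|y'| != 0 by rewrite gt_eqF//; lra.
  have E : `|y| = `|y'|.
    move: en; rewrite (wrap_bottom k y1').1 (wrap_bottom h y1).1 !mulfVK//; lra.
  case: (eqVneq `|y| 1) => [E1|ne]; first by right; rewrite -E.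
  left; apply: fin => //; rewrite (wrap_bottom h y1).1 !mulf_neq0 ?invr_eq0//.
  by rewrite subr_eq0 eq_sym.
Qed.

Lemma wrap_boundary (y y' : 'rV[R]_2) : `|y| = 1 -> `|y'| = 1 -> wrap y = wrap y'.
Proof.
move=> e e'; have h : wrap_scale 1 = 0.
  by rewrite (wrap_bottom _ _).1 ?subrr ?mulr0 ?mul0r//; lra.
by rewrite /wrap e e' h !mul0r.
Qed.

Lemma wrap_surj (z : 'rV[R]_3) : `|z| = 1 -> exists2 y : 'rV[R]_2, `|y| <= 1 & wrap y = z.
Proof.
move=> z1; pose e := Num.max `|z 0 ord0| `|z 0 o3|.
have ze k : `|row2 (k * z 0 ord0) (k * z 0 o3)| = `|k| * e.
  by rewrite norm2E !row2E !normrM -maxr_pMr// normr_ge0.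
have e0 : 0 <= e by rewrite le_max normr_ge0.
have ez : Num.max e `|z 0 ord_max| = 1 by rewrite -z1 norm3E.
have e1 : e <= 1 by rewrite -ez le_max lexx.
have z21 : `|z 0 ord_max| <= 1 by rewrite -ez le_max lexx orbT.
have fin (y : 'rV[R]_2) : wrap_scale `|y| * y 0 ord0 = z 0 ord0 ->
    wrap_scale `|y| * y 0 ord_max = z 0 o3 -> wrap_height `|y| = z 0 ord_max -> wrap y = z.
  by move=> h0 h1 h2; apply/rowP => i; case: (ord3_cases i) => ->; rewrite /wrap row3E.
have [z2|z2] := eqVneq (z 0 ord_max) 1.
  pose y := row2 (3^-1 * z 0 ord0) (3^-1 * z 0 o3).
  have ny : `|y| <= 1 / 3 by rewrite ze ger0_norm ?invr_ge0//; lra.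
  exists y; first by lra.
  by apply: fin; rewrite ?(wrap_top ny).1 ?(wrap_top ny).2// !row2E; lra.
have [z2'|z2'] := eqVneq (z 0 ord_max) (-1).
  have [e00|en0] := eqVneq e 0.
    (* The centre of the bottom face is the image of the whole boundary; any boundary point
       serves. *)
    have n1 : `|row2 1 1| = 1 by rewrite norm2E !row2E normr1 maxxx.
    have [w1 w2] : wrap_scale 1 = 0 /\ wrap_height 1 = -1.
      have [|-> ->] := @wrap_bottom 1 _ (lexx 1); first by lra.
      by rewrite subrr mulr0 mul0r.
    have [z00 z01] : z 0 ord0 = 0 /\ z 0 o3 = 0.
      by split; apply/eqP; rewrite -normr_le0 -e00 le_max lexx ?orbT.
    by exists (row2 1 1); rewrite ?n1//; apply: fin; rewrite n1 ?w1 ?w2 ?z00 ?z01 ?mul0r.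
  have ep : 0 < e by rewrite lt_neqAle eq_sym en0.
  (* The radius [1 - e / 3] is the solution of [3 * (1 - r) = e]. *)
  pose k := (1 - e / 3) / e.
  have k0 : 0 < k by rewrite divr_gt0//; lra.
  pose y := row2 (k * z 0 ord0) (k * z 0 o3).
  have ny : `|y| = 1 - e / 3 by rewrite ze gtr0_norm// mulfVK.
  have [||w1 w2] := @wrap_bottom `|y|; [by rewrite ny; lra|by rewrite ny; lra|].
  have k1 : wrap_scale `|y| * k = 1.
    have k2 : 1 - e / 3 != 0 by rewrite gt_eqF//; lra.
    have k3 : 3 * (1 - (1 - e / 3)) = e by lra.
    by rewrite w1 ny /k k3 mulrA mulfVK// divff.
  exists y; first by lra.
  by apply: fin; rewrite ?w2 ?z2'// row2E mulrA k1 mul1r.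
have e1' : e = 1.
  move: ez; case: (leP e `|z 0 ord_max|) => // h E.
  have : `|z 0 ord_max| < 1.
    rewrite ltr_norml; move: z21; rewrite ler_norml => /andP[].
    by rewrite !le_eqVlt eq_sym (negPf z2) (negPf z2') /= => -> ->.
  by rewrite E ltxx.
move: z21; rewrite ler_norml => /andP[]; rewrite !le_eqVlt eq_sym (negPf z2) (negPf z2') /=.
(* The radius at which the height [3 - 6 * r] of the middle ring takes the given value. *)
move=> lo hi; pose k := (3 - z 0 ord_max) / 6.
have k0 : 0 < k by rewrite /k; lra.
pose y := row2 (k * z 0 ord0) (k * z 0 o3).
have ny : `|y| = k by rewrite ze gtr0_norm// e1' mulr1.
have [||w1 w2] := @wrap_side `|y|; [by rewrite ny /k; lra|by rewrite ny /k; lra|].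
exists y; first by rewrite ny /k; lra.
apply: fin.
- by rewrite w1 row2E ny mulKf// gt_eqF.
- by rewrite w1 row2E ny mulKf// gt_eqF.
- by rewrite w2 ny /k; lra.
Qed.

Lemma wrap_continuous : continuous wrap.
Proof.
have cn : continuous (fun y : 'rV[R]_2 => `|y|) by move=> y; exact: norm_continuous.
have cc (c : R) : continuous (fun _ : 'rV[R]_2 => c) by exact: continuous_cstr.
have cs : continuous (fun y : 'rV[R]_2 => wrap_scale `|y|).
  apply: continuousMr.
    apply: continuous_minr => //; apply: continuousMr => //; exact: continuousBr.
  move=> y; have y0 : Num.max `|y| (1 / 3) != 0.
    by rewrite gt_eqF// lt_max divr_gt0 ?orbT.
  have cm := @continuous_maxr R _ _ _ cn (cc (1 / 3)).
  exact: cvgV y0 (cm y).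
have ch : continuous (fun y : 'rV[R]_2 => wrap_height `|y|).
  apply: continuous_maxr => //; apply: continuous_minr => //.
  by apply: continuousBr => //; exact: continuousMr.
have : {within setT, continuous wrap}.
  apply: within_continuous_row => i; apply: continuous_subspaceT.
  case: (ord3_cases i) => ->; under eq_fun do rewrite /wrap row3E.
  - by apply: continuousMr => //; exact: coord_continuous.
  - by apply: continuousMr => //; exact: coord_continuous.
  - exact: ch.
by move=> h; apply/continuous_subspace_setT.
Qed.

End SphereParam.

(** * Lifting maps to the circle *)

Section IntegerLift.
Variable R : realType.

(** The boundary of the square is connected: every point is moved along at most two sides to the
    corner [(1, 1)]. *)
Lemma square_boundary_const (E : Type) (f : 'rV[R]_2 -> E) (e : R) : 0 < e ->
  (forall p q, `|p| = 1 -> `|q| = 1 -> `|p - q| < e -> f p = f q) ->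
  forall p q, `|p| = 1 -> `|q| = 1 -> f p = f q.
Proof.
move=> e0 fe.
have e20 : 0 < e / 2 by rewrite divr_gt0.
have seg (y t : R) : `|y| <= 1 -> 0 <= t <= 1 -> `|y + t * (1 - y)| <= 1.
  rewrite !ler_norml => /andP[h1 h2] /andP[h3 h4]; apply/andP; split; nra.
have segd (y s t : R) : `|y| <= 1 -> `|s - t| < e / 2 ->
    `|(y + s * (1 - y)) - (y + t * (1 - y))| < e.
  move=> y1 st; rewrite (_ : _ - _ = (s - t) * (1 - y)); last by ring.
  rewrite normrM; have : `|1 - y| <= 2.
    by move: y1; rewrite !ler_norml => /andP[h1 h2]; apply/andP; split; lra.
  have := normr_ge0 (s - t); have := normr_ge0 (1 - y); nra.
have vert k y : `|k| = 1 -> `|y| <= 1 -> f (row2 k y) = f (row2 k 1).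
  move=> k1 y1.
  have := @uniformly_const R E (fun t => f (row2 k (y + t * (1 - y)))) _ e20.
  rewrite mul0r addr0 mul1r (addrC y) subrK; apply => s t s01 t01 st; apply: fe.
  - by rewrite norm2E !row2E k1 (max_idPl _)// seg.
  - by rewrite norm2E !row2E k1 (max_idPl _)// seg.
  - by rewrite norm2E !mxE subrr normr0 gt_max e0 segd.
have horz k x : `|k| = 1 -> `|x| <= 1 -> f (row2 x k) = f (row2 1 k).
  move=> k1 x1.
  have := @uniformly_const R E (fun t => f (row2 (x + t * (1 - x)) k)) _ e20.
  rewrite mul0r addr0 mul1r (addrC x) subrK; apply => s t s01 t01 st; apply: fe.
  - by rewrite norm2E !row2E k1 (max_idPr _)// seg.
  - by rewrite norm2E !row2E k1 (max_idPr _)// seg.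
  - by rewrite norm2E !mxE subrr normr0 gt_max e0 segd.
have n1 : `|1 : R| = 1 by exact: normr1.
have nN1 : `|-1 : R| = 1 by rewrite normrN normr1.
have to1 p : `|p| = 1 -> f p = f (row2 1 1).
  move=> p1; pose x := p 0 ord0; pose y := p 0 ord_max.
  have h : Num.max `|x| `|y| = 1 by rewrite -norm2E.
  rewrite (row2_eta p) -/x -/y.
  have x1 : `|x| <= 1 by rewrite -[leRHS]h le_max lexx.
  have y1 : `|y| <= 1 by rewrite -[leRHS]h le_max lexx orbT.
  have corner k l : `|k| = 1 -> `|l| = 1 -> f (row2 k l) = f (row2 1 1).
    by move=> k1 l1; rewrite vert ?l1// horz ?k1.
  case: (leP `|x| `|y|) h => _ h; first by rewrite horz// vert.
  by rewrite vert// corner.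
by move=> p q p1 q1; rewrite to1// [RHS]to1.
Qed.

(** One notion for disc and sphere: distinct points with the same image lie on the boundary, and in
    that case the whole boundary is collapsed to a single point. *)
Definition wrapped_square (d : nat) (Y : set 'rV[R]_d) (pr : 'rV[R]_2 -> 'rV[R]_d) :=
  [/\ {within @ball_set R 2, continuous pr}, pr @` @ball_set R 2 = Y &
      forall p q, `|p| <= 1 -> `|q| <= 1 -> pr p = pr q -> p = q \/
        [/\ `|p| = 1, `|q| = 1 &
            forall p' q', `|p'| = 1 -> `|q'| = 1 -> pr p' = pr q']].

Lemma ball2_wrapped : wrapped_square (@ball_set R 2) id.
Proof.
split; last by left.
- by apply: continuous_subspaceT => x; exact: cvg_id.
- by rewrite image_id.
Qed.

Lemma sphere3_wrapped : wrapped_square (@sphere_set R 3) (@wrap R).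
Proof.
split.
- by apply: continuous_subspaceT; exact: wrap_continuous.
- apply/seteqP; split=> [_ [y y1 <-]|z /wrap_surj[y y1 <-]]; last by exists y.
  exact: wrap_sphere.
- move=> p q p1 q1 /wrap_inj[]//; first by left.
  by case=> e e'; right; split=> //; exact: wrap_boundary.
Qed.

(** Continuity of [G] as a map to [R / Z], expressed for real representatives that may themselves
    jump by integers. *)
Definition near_integers (d : nat) (Y : set 'rV[R]_d) (G : 'rV[R]_d -> R) :=
  forall y (e : R), Y y -> 0 < e -> exists2 r : R, 0 < r &
    forall y', Y y' -> `|y' - y| < r -> exists z : int, `|G y' - G y - z%:~R| < e.

(* A map to [R / Z] from a sphere or a disc lifts to [R]. *)
Lemma integer_lift (d : nat) (Y : set 'rV[R]_d) pr (G : 'rV[R]_d -> R) :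
  wrapped_square Y pr -> near_integers Y G ->
  exists s : 'rV[R]_d -> int, forall y, Y y -> exists2 r : R, 0 < r &
    forall y', Y y' -> `|y' - y| < r ->
      `|(G y' - (s y')%:~R) - (G y - (s y)%:~R)| < 1 / 2.
Proof.
move=> [cpr prY prinj] GY; pose X := @ball_set R 2.
have XY p : X p -> Y (pr p) by move=> Xp; rewrite -prY; exists p.
pose g p := G (pr p).
pose good (A : set 'rV[R]_2) := forall p q, A p -> A q ->
  exists z : int, `|g q - g p - z%:~R| < 1 / 8.
have [||e e0 he] := compact_uniform_scale (good := good) (@ball_set_compact R 2).
- by move=> A B AB gB p q /AB + /AB; exact: gB.
- move=> p Xp; have e16 : 0 < 1 / 16 :> R by rewrite divr_gt0.
  have [r r0 hr] := GY _ _ (XY p Xp) e16.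
  have [d' d0 hd] := within_continuous_ball cpr Xp r0.
  exists d' => // q q' [Xq pq] [Xq' pq'].
  have [z hz] := hr _ (XY q Xq) (hd q Xq pq).
  have [z' hz'] := hr _ (XY q' Xq') (hd q' Xq' pq').
  exists (z' - z); rewrite rmorphB /=; move: hz hz'; rewrite /g.
  by rewrite !ltr_norml => /andP[h1 h2] /andP[h3 h4]; apply/andP; split; lra.
(* The integer nearest to the increment of [g]. Around a small triangle the errors add up to less
   than [3 / 8], so the integers satisfy the cocycle identity exactly. *)
pose c p q : int := xget 0 [set z : int | `|g q - g p - z%:~R| < 1 / 8].
have X1 p : X p -> `|p| <= 1 by [].
have Xstar p (t : R) : X p -> 0 <= t <= 1 -> X (t *: p).
  move=> Xp /andP[t0 t1]; rewrite /X /ball_set /= normrZ ger0_norm//.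
  by rewrite mulr_ile1.
have cP p q : X p -> X q -> `|p - q| < e -> `|g q - g p - (c p q)%:~R| < 1 / 8.
  move=> Xp Xq pq.
  have [z hz] : exists z : int, `|g q - g p - z%:~R| < 1 / 8.
    apply: (he p Xp); first by split=> //; exact: ballxx.
    by split=> //; rewrite -ball_normE.
  exact: (@xgetI int 0 [set z0 : int | `|g q - g p - z0%:~R| < 1 / 8] z hz).
have int_small (z : int) : `|z%:~R : R| < 1 -> z = 0.
  by rewrite -intr_norm -[1](rmorph1 intr) ltr_int; lia.
have cc p q r : X p -> X q -> X r -> `|p - q| < e -> `|q - r| < e ->
    `|p - r| < e -> c p q + c q r = c p r.
  move=> Xp Xq Xr pq qr pr'; apply/eqP; rewrite -subr_eq0; apply/eqP/int_small.
  have := cP _ _ Xp Xq pq; have := cP _ _ Xq Xr qr; have := cP _ _ Xp Xr pr'.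
  rewrite rmorphB rmorphD /= !ltr_norml => /andP[h1 h2] /andP[h3 h4] /andP[h5 h6].
  apply/andP; split; lra.
have [s hs] := star_cocycle e0 X1 Xstar cc.
have e20 : 0 < e / 2 by rewrite divr_gt0.
have key1 p q : X p -> X q -> `|p - q| < e / 2 ->
    `|(g q - (s q)%:~R) - (g p - (s p)%:~R)| < 1 / 8.
  move=> Xp Xq pq; have pqe : `|p - q| < e by lra.
  have := cP p q Xp Xq pqe; rewrite -hs// rmorphB /=.
  by rewrite !ltr_norml => /andP[h1 h2]; apply/andP; split; lra.
(* [s] descends to [Y]: on a collapsed boundary [g] is constant, so [s] changes by less than 1
   between close boundary points and is constant all the way round. *)
have key2 p q : X p -> X q -> pr p = pr q -> s p = s q.
  move=> Xp Xq h; case: (prinj p q Xp Xq h) => [->//|[p1 q1 bd]].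
  apply: (square_boundary_const e20) p1 q1 => p' q' p1' q1' pq.
  apply/esym/eqP; rewrite -subr_eq0; apply/eqP/int_small.
  have Xp' : X p' by rewrite /X /ball_set /= p1'.
  have Xq' : X q' by rewrite /X /ball_set /= q1'.
  have := key1 p' q' Xp' Xq' pq; rewrite /g (bd _ _ p1' q1') rmorphB /=.
  by rewrite !ltr_norml => /andP[h1 h2]; apply/andP; split; lra.
pose sect y := xget 0 [set p | X p /\ pr p = y].
have sectP y : Y y -> X (sect y) /\ pr (sect y) = y.
  rewrite -prY => -[p Xp py]; exact: (@xgetI _ 0 [set p | X p /\ pr p = y] p (conj Xp py)).
pose sg y := s (sect y).
have sgE p : X p -> sg (pr p) = s p.
  by move=> Xp; have [Xs ps] := sectP _ (XY p Xp); exact: key2.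
exists sg => y Yy.
(* Back from the square to [Y]: outside a neighbourhood of the fibre over [y] the square is compact,
   so its image there is closed and misses [y]. Points of [Y] near [y] thus have all their preimages
   close to this fibre. *)
pose O := \bigcup_(p in [set p | X p /\ pr p = y]) ball p (e / 2).
have Oo : open O by apply: bigcup_open => p _; exact: ball_open.
pose K := X `&` ~` O.
have Kc : compact K.
  by apply: compact_closedI; [exact: ball_set_compact | exact: open_closedC].
have cK : {within K, continuous pr}.
  by apply: continuous_subspaceW cpr => p [].
have Kc' := continuous_compact cK Kc.
have Kcl : closed (pr @` K).
  by apply: compact_closed Kc'; exact: norm_hausdorff.
have ny : (~` (pr @` K)) y.
  move=> [p [Xp nO] py]; apply: nO; exists p => //; exact: ballxx.
have := open_nbhs_nbhs (conj (closed_openC Kcl) ny).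
move=> /nbhs_ballP[r /= r0 hr]; exists r => // y' Yy' yy'.
have ny' : (~` (pr @` K)) y'.
  by apply: hr; rewrite -ball_normE /= distrC.
have [Xs ps] := sectP y' Yy'.
have [p [Xp py] pb] : O (sect y').
  by apply: contrapT => nO; apply: ny'; exists (sect y').
move: pb; rewrite -ball_normE /= => pb.
have := key1 _ _ Xp Xs pb; rewrite /g ps py -/(sg y') -(sgE p Xp) py.
rewrite !ltr_norml => /andP[h1 h2]; apply/andP; split; lra.
Qed.

End IntegerLift.

(** * Numbers of triangles *)

Section LinkPotential.
Variables (R : realType) (n : nat) (T : face_gluing n).
Variables (J : 'I_n -> 'I_4 -> 'I_4 -> int) (h : 'I_n -> 'I_4 -> 'I_4 -> R).
Hypothesis hJ : forall i a j s u k, glue T i a = Some (j, s) -> uniq [:: a; u; k] ->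
  h j (s u) (s k) = h i u k + (J i u a)%:~R.

Definition link_triangle (u : 'I_4) : set 'rV[R]_4 := [set x | tetra x /\ x 0 u = 2 / 3].

(** The affine extension of [h i u] over the link triangle, with value [h i u k] at the corner on
    the edge [uk]. The factor 3 is there because the other three coordinates add up to [1 / 3]. *)
Definition link_value i u (x : 'rV[R]_4) : R := 3 * \sum_(k | k != u) h i u k * x 0 k.

Lemma link_triangle_unique u u' x : link_triangle u x -> link_triangle u' x -> u = u'.
Proof.
move=> [tx xu] [_ xu']; apply/eqP/negPn/negP => ne.
have [c [d uq]] := two_more ne; have := tetra_sum4 uq tx; rewrite xu xu'.
by have := tx.1 c; have := tx.1 d; lra.
Qed.

Lemma link_rest u x : link_triangle u x -> \sum_(k | k != u) x 0 k = 1 / 3.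
Proof. by move=> [[_ s1] xu]; move: s1; rewrite (bigD1 u)//= xu; lra. Qed.

Lemma link_value_step (p q : 'I_n * 'rV[R]_4) a s : glue T p.1 a = Some (q.1, s) ->
  face a p.2 -> (forall v, q.2 0 (s v) = p.2 0 v) -> forall u, link_triangle u p.2 ->
  link_value q.1 (s u) q.2 = link_value p.1 u p.2 + (J p.1 u a)%:~R.
Proof.
move=> e [tp pa] qp u pu; rewrite /link_value.
have au : a != u.
  by apply/eqP => au; move: pa; rewrite au pu.2; apply/eqP; rewrite mulf_neq0// invr_neq0.
rewrite (reindex_inj (@perm_inj _ s)) /=.
transitivity (3 * \sum_(k | k != u) (h p.1 u k + (J p.1 u a)%:~R) * p.2 0 k).
  congr (_ * _); apply: eq_big => [k|k]; first by rewrite (inj_eq perm_inj).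
  rewrite (inj_eq perm_inj) qp => ku.
  have [->|ka] := eqVneq k a; first by rewrite pa !mulr0.
  by rewrite (hJ e)//= !inE negb_or au eq_sym ka eq_sym ku.
rewrite (eq_bigr (fun k => h p.1 u k * p.2 0 k + (J p.1 u a)%:~R * p.2 0 k)).
  by rewrite big_split -mulr_sumr (link_rest pu) /=; lra.
by move=> k _; rewrite mulrDl.
Qed.

Lemma tetra_perm (x y : 'rV[R]_4) (s : {perm 'I_4}) :
  (forall v, y 0 (s v) = x 0 v) -> tetra x -> tetra y.
Proof.
move=> yx [x0 x1]; split=> [v|]; first by rewrite -(permKV s v) yx.
by rewrite -x1 (reindex_inj (@perm_inj _ s)); apply: eq_bigr => v _; rewrite yx.
Qed.

Lemma link_value_identified (p q : 'I_n * 'rV[R]_4) : identified T p q ->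
  exists s : {perm 'I_4}, (forall v, q.2 0 (s v) = p.2 0 v) /\
  forall u, link_triangle u p.2 ->
    exists z : int, link_value q.1 (s u) q.2 = link_value p.1 u p.2 + z%:~R.
Proof.
elim=> [{}p {}q [a [s [e pa qp]]]|{}p|{}p {}q _ [s [qp IH]]|{}p r {}q _ [s [rp IH]] _ [s' [qr IH']]].
- exists s; split=> // u pu; exists (J p.1 u a); exact: link_value_step e pa qp u pu.
- by exists 1%g; split=> [v|u _]; rewrite perm1//; exists 0; rewrite addr0.
- exists (s^-1)%g; split=> [v|u qu]; first by rewrite -qp permKV.
  have pu : link_triangle ((s^-1)%g u) p.2.
    split; last by rewrite -qp permKV qu.2.
    apply: (tetra_perm (s := (s^-1)%g)) qu.1 => v; by rewrite -qp permKV.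
  by have [z] := IH _ pu; rewrite permKV => ->; exists (- z); rewrite rmorphN addrK.
- exists (s * s')%g; split=> [v|u pu]; first by rewrite permM qr.
  have ru : link_triangle (s u) r.2.
    by split; [exact: tetra_perm rp pu.1 | rewrite rp pu.2].
  have [z hz] := IH _ pu; have [z' hz'] := IH' _ ru.
  by exists (z + z'); rewrite permM hz' hz rmorphD addrA.
Qed.

(** A chain of face gluings acts on barycentric coordinates by one permutation, and each gluing adds
    an integer jump. Link values are therefore well defined modulo [Z] on the link. *)
Lemma link_value_mod p q u u' : identified T p q ->
  link_triangle u p.2 -> link_triangle u' q.2 ->
  exists z : int, link_value q.1 u' q.2 = link_value p.1 u p.2 + z%:~R.
Proof.
move=> /link_value_identified[s [qp H]] pu qu'.
have qu : link_triangle (s u) q.2 by split; [exact: qu'.1|rewrite qp pu.2].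
by have [z hz] := H u pu; exists z; rewrite -hz (link_triangle_unique qu qu').
Qed.

Lemma link_value_continuous i u : continuous (link_value i u).
Proof.
apply: continuousMr; first exact: continuous_cstr.
apply: continuous_sum => k; apply: continuousMr; first exact: continuous_cstr.
exact: coord_continuous.
Qed.

Lemma link_triangle_closed u : closed (link_triangle u).
Proof.
have -> : link_triangle u = @tetra R `&` [set x | x 0 u = 2 / 3] by [].
apply: closedI; first by apply: compact_closed; [exact: norm_hausdorff|exact: tetra_compact].
exact: (@closed_pre _ _ (fun x : 'rV[R]_4 => x 0 u) [set y | y = 2 / 3] (@coord_continuous _ _ _ _ _) (@closed_eq _ _)).
Qed.

Variables (i0 : 'I_n) (v0 : 'I_4) (d : nat) (Y : set 'rV[R]_d) (pr : 'rV[R]_2 -> 'rV[R]_d).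
Hypothesis hY : wrapped_square Y pr.
Hypothesis hlink : homeomorphic_to T (vertex_link T i0 v0) Y.

Definition linked j u := identified T (i0, tetra_vertex R v0) (j, tetra_vertex R u).

Lemma locally_const_segment (f : R -> R) :
  (forall t, 0 <= t <= 1 -> exists2 e : R, 0 < e &
     forall t', 0 <= t' <= 1 -> `|t' - t| < e -> f t' = f t) -> f 0 = f 1.
Proof.
move=> loc; pose good (A : set R) := forall s t, A s -> A t -> f s = f t.
have [||e e0 he] := compact_uniform_scale (good := good) (@segment_compact R 0 1).
- by move=> A B AB gB s t /AB + /AB; exact: gB.
- move=> t; rewrite /= in_itv /= => t01; have [e e0 he] := loc t t01; exists e => //.
  move=> s s' []; rewrite /= in_itv /= => s01 + []; rewrite /= in_itv /= => + s01'.
  by rewrite -ball_normE /= distrC => hs; rewrite distrC => hs'; rewrite he// he.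
apply: (uniformly_const e0) => s t s01 t01 st.
apply: (he s); rewrite ?in_itv //=; split; rewrite /= ?in_itv//; first exact: ballxx.
Qed.

Lemma link_potential : exists t : 'I_n -> 'I_4 -> int,
  forall i a j s u, linked i u -> glue T i a = Some (j, s) -> a != u ->
  t j (s u) = t i u + J i u a.
Proof.
have [_ [phi [cphi phiE phiY]]] := hlink.
have LA j u x : linked j u -> link_triangle u x -> vertex_link T i0 v0 j x.
  by move=> lj [tx xu]; split=> //; exists u.
have phiYx j u x : linked j u -> link_triangle u x -> Y (phi j x).
  by move=> lj xu; rewrite -phiY; exists j => //; exists x => //; exact: LA xu.
have cphiL j u : linked j u -> {within link_triangle u, continuous (phi j)}.
  by move=> lj; apply: continuous_subspaceW (cphi j) => x; exact: LA.
pose is_rep y (r : 'I_n * 'I_4 * 'rV[R]_4) :=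
  [/\ linked r.1.1 r.1.2, link_triangle r.1.2 r.2 & phi r.1.1 r.2 = y].
pose rep y := xget (i0, v0, 0) [set r | is_rep y r].
have repP y : Y y -> is_rep y (rep y).
  rewrite -phiY => -[j _ [x [tx [u lj xu]] e]].
  by apply: (@xgetI _ _ [set r | is_rep y r] (j, u, x)).
(* The link value at a chosen point over [y]. The choices at different [y] are unrelated, so [G] is
   meaningful modulo [Z] only. *)
pose G y := link_value (rep y).1.1 (rep y).1.2 (rep y).2.
have Gmod j u x : linked j u -> link_triangle u x ->
    exists z : int, link_value j u x = G (phi j x) + z%:~R.
  move=> lj xu; have [lr ru re] := repP _ (phiYx _ _ _ lj xu).
  apply: (@link_value_mod ((rep (phi j x)).1.1, (rep (phi j x)).2) (j, x)) => //.
  apply/phiE; [exact: LA ru|exact: LA xu|exact: re].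
have nearG : near_integers Y G.
  move=> y e Yy e0.
  (* Points near [y] may be represented in other link triangles. In each of these, the points whose
     value stays at distance at least [e] from [G y] modulo [Z] form a compact set, and its closed
     image misses [y]. *)
  pose bad j u := link_triangle u `&`
    [set x | forall z : int, e <= `|link_value j u x - G y - z%:~R|].
  have badC j u : compact (bad j u).
    apply: (subclosed_compact _ (@tetra_compact R)); last by move=> x [[]].
    apply: closedI; first exact: link_triangle_closed.
    have -> : [set x | forall z : int, e <= `|link_value j u x - G y - z%:~R|] =
        \bigcap_z (fun x => `|link_value j u x - G y - z%:~R|) @^-1` [set r | e <= r].
      by apply/seteqP; split=> [x hx z _|x hx z]; [exact: hx|exact: (hx z I)].
    apply: closed_bigI => z _.
    have cf : continuous (fun x => `|link_value j u x - G y - z%:~R|).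
      have cb : continuous (fun x => link_value j u x - G y - z%:~R).
        apply: continuousBr; last exact: continuous_cstr.
        by apply: continuousBr; [exact: link_value_continuous|exact: continuous_cstr].
      by move=> x; exact: (cvg_norm (cb x)).
    exact: (@closed_pre _ _ _ [set r | e <= r] cf (@closed_ge _ _)).
  have : \forall y' \near y, forall ju : 'I_n * 'I_4, linked ju.1 ju.2 ->
      ~ (phi ju.1 @` bad ju.1 ju.2) y'.
    have ff := @filter_forall 'rV[R]_d ('I_n * 'I_4)%type (fun ju y' => linked ju.1 ju.2 ->
      ~ (phi ju.1 @` bad ju.1 ju.2) y') (nbhs y) (nbhs_filter y).
    apply: ff => -[j u] /=.
    have [lj|nl] := pselect (linked j u); last by apply: nearW => y'.
    have cl : closed (phi j @` bad j u).
      apply: compact_closed; first exact: norm_hausdorff.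
      apply: continuous_compact (badC j u); apply: continuous_subspaceW (cphiL j u lj).
      by move=> x [].
    have ny : (~` (phi j @` bad j u)) y.
      move=> [x [xu bx] xy]; have [z hz] := Gmod j u x lj xu.
      have := bx z; rewrite hz xy (_ : _ - _ - _ = 0) ?normr0 ?leNgt ?e0//; by ring.
    have := open_nbhs_nbhs (conj (closed_openC cl) ny).
    by apply: filterS => y' h' _; exact: h'.
  move=> /nbhs_ballP[r /= r0 hr]; exists r => // y' Yy' yy'.
  have [lr ru re] := repP y' Yy'.
  apply: contrapT => nz.
  have by' : ball y r y' by rewrite -ball_normE /= distrC.
  apply: (hr y' by' ((rep y').1.1, (rep y').1.2) lr); exists (rep y').2 => //.
  split=> // z; rewrite leNgt; apply/negP => hz; apply: nz; exists z; exact: hz.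
have [sg hsg] := integer_lift hY nearG.
(* The difference of the affine function and the lift. It is integer-valued, and near any point each
   of the two varies by less than [1 / 2], so it is constant on every link triangle. Across a gluing
   the lift is unchanged while the affine function jumps. *)
pose tau j u x := link_value j u x - (G (phi j x) - (sg (phi j x))%:~R).
have tauZ j u x : linked j u -> link_triangle u x -> exists z : int, tau j u x = z%:~R.
  move=> lj xu; have [z hz] := Gmod j u x lj xu; exists (z + sg (phi j x)).
  by rewrite /tau hz rmorphD /=; ring.
have tau_loc j u x : linked j u -> link_triangle u x -> exists2 e : R, 0 < e &
    forall x', link_triangle u x' -> `|x' - x| < e -> tau j u x' = tau j u x.
  move=> lj xu; have [r r0 hr] := hsg _ (phiYx _ _ _ lj xu).
  have [e1 e10 h1] := within_continuous_ball (cphiL j u lj) xu r0.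
  have cl : {within link_triangle u, continuous (link_value j u)}.
    by apply: continuous_subspaceT; exact: link_value_continuous.
  have e20 : 0 < 1 / 2 :> R by rewrite divr_gt0.
  have [e2 e2' h2] := within_continuous_ball cl xu e20.
  exists (Num.min e1 e2); first by rewrite lt_min e10.
  move=> x' xu'; rewrite lt_min => /andP[d1 d2].
  have b1 := h1 x' xu'; have b2 := h2 x' xu'.
  rewrite -!ball_normE /= !(distrC x) in b1 b2.
  have := hr _ (phiYx _ _ _ lj xu') (b1 d1); have := b2 d2.
  have [z hz] := tauZ j u x lj xu; have [z' hz'] := tauZ j u x' lj xu'.
  move=> l2 l1; have : `|tau j u x' - tau j u x| < 1.
    move: l1 l2; rewrite /tau !ltr_norml => /andP[a1 a2] /andP[a3 a4].
    by apply/andP; split; lra.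
  rewrite hz hz' -rmorphB /= -intr_norm -[1](rmorph1 intr) ltr_int => zz.
  by congr (_%:~R); clear -zz; lia.
have tau_const j u x x' : linked j u -> link_triangle u x -> link_triangle u x' ->
    tau j u x = tau j u x'.
  move=> lj xu xu'; pose g (t : R) := x + t *: (x' - x).
  have gL t : 0 <= t <= 1 -> link_triangle u (g t).
    move=> /andP[t0 t1]; have [[x0 x1] xe] := xu; have [[x0' x1'] xe'] := xu'.
    split; last by rewrite !mxE xe xe'; ring.
    split=> [v|]; first by rewrite !mxE; have := x0 v; have := x0' v; nra.
    under eq_bigr do rewrite !mxE.
    by rewrite big_split -mulr_sumr /= sumrB x1 x1' subrr mulr0 addr0.
  have := @locally_const_segment (fun t => tau j u (g t)).
  have -> : g 0 = x by rewrite /g scale0r addr0.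
  have -> : g 1 = x' by rewrite /g scale1r addrC subrK.
  apply=> t t01.
  have [e e0 he] := tau_loc j u _ lj (gL t t01).
  exists (e / (1 + `|x' - x|)).
    by rewrite divr_gt0// ltr_pwDl.
  move=> t' t01' tt; apply: he; first exact: gL.
  rewrite /g opprD addrACA subrr add0r -scalerBl normrZ.
  apply: le_lt_trans (_ : `|t' - t| * (1 + `|x' - x|) < e); last by rewrite -ltr_pdivlMr// ltr_pwDl.
  by rewrite ler_wpM2l// lerDr.
pose base (u : 'I_4) : 'rV[R]_4 := \row_k (if k == u then 2 / 3 else 1 / 9).
have baseL u : link_triangle u (base u).
  split; last by rewrite mxE eqxx.
  split=> [v|]; first by rewrite mxE; case: ifP => _; rewrite divr_ge0.
  have [b [c [d' uq]]] := side_partner ord0 u; have {}uq := uq.1.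
  have [[ub uc ud] _] := uniq4_ne uq.
  rewrite (big_uniq4 _ uq) !mxE eqxx !(eq_sym _ u) (negPf ub) (negPf uc) (negPf ud); lra.
exists (fun j u => Num.floor (tau j u (base u))) => i a j s u li e au.
have floorE j' u' x : linked j' u' -> link_triangle u' x ->
    (Num.floor (tau j' u' (base u')))%:~R = tau j' u' x.
  move=> lj xu; rewrite (tau_const j' u' _ x lj (baseL u') xu).
  by have [z ->] := tauZ j' u' x lj xu; rewrite intrKfloor.
have [k [l uq]] := two_more au; have [[_ ak al] [uk ul kl]] := uniq4_ne uq.
(* The corner of the link triangle on the edge [uk], which lies in the glued face; the two adjacent
   link triangles are compared at this common point. *)
pose x : 'rV[R]_4 := \row_v (if v == u then 2 / 3 else if v == k then 1 / 3 else 0).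
have xu : link_triangle u x.
  split; last by rewrite mxE eqxx.
  split=> [v|]; first by rewrite mxE; do ?case: ifP => _; rewrite ?divr_ge0.
  rewrite (big_uniq4 _ uq) !mxE !eqxx (negPf au) (negPf ak) (eq_sym k) (negPf uk).
  by rewrite (eq_sym l) (negPf ul) (eq_sym l) (negPf kl); lra.
have xa : face a x by split; [exact: xu.1|rewrite mxE (negPf au) (negPf ak)].
pose y : 'rV[R]_4 := \row_v x 0 ((s^-1)%g v).
have yx v : y 0 (s v) = x 0 v by rewrite mxE permK.
have yu : link_triangle (s u) y by split; [exact: tetra_perm yx xu.1|rewrite yx xu.2].
have lj : linked j (s u).
  apply: identified_trans li _; apply: rst_step; exists a, s; split=> //=.
    split; last by rewrite mxE eqxx (negPf au).
    split=> [v|]; first by rewrite mxE; case: eqP.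
    by rewrite (bigD1 u)//= mxE !eqxx big1 ?addr0// => v /negPf vu; rewrite mxE vu andbF.
  by move=> v; rewrite !mxE !eqxx (inj_eq perm_inj).
have idxy : identified T (i, x) (j, y) by apply: rst_step; exists a, s.
have pE : phi i x = phi j y by apply/phiE => //; [exact: LA xu|exact: LA yu].
apply: (@intr_inj R); rewrite rmorphD /= (floorE _ _ y lj yu) (floorE _ _ x li xu).
rewrite /tau -pE (@link_value_step (i, x) (j, y) a s e xa yx u xu) /=; ring.
Qed.

End LinkPotential.

(** * From the links to all tetrahedra at once *)

Section VertexPotential.
Variables (R : realType) (n : nat) (T : face_gluing n).

Lemma vertex_step i a j s u : glue T i a = Some (j, s) -> a != u ->
  identified T (i, tetra_vertex R u) (j, tetra_vertex R (s u)).
Proof.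
move=> e au; apply: rst_step; exists a, s; split=> //=.
  split; last by rewrite mxE eqxx (negPf au).
  split=> [v|]; first by rewrite mxE; case: eqP.
  by rewrite (bigD1 u)//= mxE !eqxx big1 ?addr0// => v /negPf vu; rewrite mxE vu andbF.
by move=> v; rewrite !mxE !eqxx (inj_eq perm_inj).
Qed.

(** [t] stands for triangles and octagon together, the part of a corner count common to all faces at
    [u]; the equation makes corner counts agree across a gluing. Strict positivity leaves one unit
    to be given to an octagon. *)
Lemma vertex_potential (w : 'M[int]_(n, 3)) :
  (forall i v, homeomorphic_to T (vertex_link (R := R) T i v) (@sphere_set R 3) \/
               homeomorphic_to T (vertex_link (R := R) T i v) (@ball_set R 2)) ->
  matching_equations R T w ->
  exists t : 'I_n -> 'I_4 -> int, (forall i u, 0 < t i u) /\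
    forall i a j s u, glue T i a = Some (j, s) -> a != u ->
      t i u + w i (quad_separating a u) = t j (s u) + w j (quad_separating (s a) (s u)).
Proof.
move=> hlinks hw; have [h hh] := edge_potential hw.
have sepC a b : quad_separating a b = quad_separating b a.
  by rewrite /quad_separating; under eq_pick do rewrite same_sideC.
pose J i u a : int := if glue T i a is Some (j, s)
  then w i (quad_separating a u) - w j (quad_separating (s a) (s u)) else 0.
have hJ i a j s u k : glue T i a = Some (j, s) -> uniq [:: a; u; k] ->
    h j (s u) (s k) = h i u k + (J i u a)%:~R.
  by move=> e uq; rewrite (hh _ _ _ _ _ _ e uq) /J e (sepC u) (sepC (s u)).
have loc (r : 'I_n * 'I_4) : exists t : 'I_n -> 'I_4 -> int,
    forall i a j s u, linked R T r.1 r.2 i u -> glue T i a = Some (j, s) -> a != u ->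
    t j (s u) = t i u + J i u a.
  have [hl|hl] := hlinks r.1 r.2.
    by have H := link_potential hJ (sphere3_wrapped R) hl.
  by have H := link_potential hJ (ball2_wrapped R) hl.
have [tt htt] := boolp.choice loc.
(* The same representative throughout a vertex class, so that glued neighbours read off the
   potential of one and the same link. *)
pose rep i u := odflt (i, u) [pick r : 'I_n * 'I_4 | `[< linked R T r.1 r.2 i u >]].
have repP i u : linked R T (rep i u).1 (rep i u).2 i u.
  rewrite /rep; case: pickP => [r /asboolP //|/(_ (i, u)) /=].
  by move=> /asboolP; case; exact: rst_refl.
have repE i a j s u : glue T i a = Some (j, s) -> a != u -> rep i u = rep j (s u).
  move=> e au; have st := vertex_step e au; rewrite /rep.
  rewrite (@eq_pick _ _ (fun r => `[< linked R T r.1 r.2 j (s u) >])); last first.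
    move=> r; apply/asboolP/asboolP => hr; first exact: identified_trans hr st.
    by apply: identified_trans hr _; exact: rst_sym.
  case: pickP => // /(_ (j, s u)) /= /asboolP; case; exact: rst_refl.
pose t0 i u := tt (rep i u) i u.
(* Adding a constant preserves all jumps; this one exceeds every [|t0 i u|]. *)
pose C : int := 1 + \sum_i \sum_u `|t0 i u|.
exists (fun i u => t0 i u + C); split=> [i u|i a j s u e au].
  rewrite /C (bigD1 i)//= (bigD1 u)//=.
  have : 0 <= \sum_(k | k != i) \sum_u `|t0 k u| by do 2 (apply: sumr_ge0 => ? _).
  have : 0 <= \sum_(k | k != u) `|t0 i k| by apply: sumr_ge0.
  have := ler_norm (- t0 i u); rewrite normrN.
  move: (\sum_(k | k != i) _) (\sum_(k | k != u) _) (t0 i u) => A B x; lia.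
rewrite {2}/t0 -(repE _ _ _ _ _ e au) (htt (rep i u) _ _ _ _ _ (repP i u) e au).
by rewrite /J e -/(t0 i u); ring.
Qed.

End VertexPotential.

(** * Pieces in a tetrahedron *)

Lemma uniq4_en (U : eqType) (a b c d : U) : uniq [:: a; b; c; d] ->
  [/\ b != a, c != a & d != a] /\ [/\ c != b, d != b & d != c].
Proof.
by rewrite -rev_uniq => /uniq4_ne[[? ? ?] [? ? ?]].
Qed.

(** * Equally spaced crossings and the planes through them *)

Section Levels.
Variables (R : realType) (W : 'I_4 -> 'I_4 -> nat).
Hypothesis Wsym : forall u v, W u v = W v u.

(* If the edge bc carries [W b c] equally spaced crossings for every c, then those
   numbered k from b lie on [level b = k]. *)
Definition level (b : 'I_4) (x : 'rV[R]_4) : R :=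
  \sum_u (if u == b then 0 else (W b u).+1%:R) * x 0 u.

Lemma levelE a b c d x : uniq [:: a; b; c; d] ->
  level b x = (W b a).+1%:R * x 0 a + (W b c).+1%:R * x 0 c + (W b d).+1%:R * x 0 d.
Proof.
move=> u; have [[ab ac ad] [bc bd cd]] := uniq4_ne u.
rewrite /level (big_uniq4 _ u) eqxx (negPf ab) (eq_sym c) (negPf bc) (eq_sym d) (negPf bd).
by rewrite mul0r addr0.
Qed.

Lemma levelD b x y : level b (x + y) = level b x + level b y.
Proof. by rewrite /level -big_split; apply: eq_bigr => u _; rewrite mxE mulrDr. Qed.

Lemma levelZ b (c : R) x : level b (c *: x) = c * level b x.
Proof. by rewrite /level mulr_sumr; apply: eq_bigr => u _; rewrite mxE mulrCA. Qed.

Definition edge_point (b c : 'I_4) (k : nat) : 'rV[R]_4 :=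
  \row_v (if v == b then 1 - k%:R / (W b c).+1%:R else
          if v == c then k%:R / (W b c).+1%:R else 0).

Lemma edge_pointE b c k : b != c ->
  (edge_point b c k 0 b = 1 - k%:R / (W b c).+1%:R) *
  (edge_point b c k 0 c = k%:R / (W b c).+1%:R).
Proof. by move=> bc; rewrite !mxE !eqxx eq_sym (negPf bc). Qed.

Lemma edge_point0 b c k v : v != b -> v != c -> edge_point b c k 0 v = 0.
Proof. by move=> vb vc; rewrite mxE (negPf vb) (negPf vc). Qed.

Lemma ratio_bounds (k w : nat) : (k <= w.+1)%N ->
  0 <= k%:R / w.+1%:R :> R /\ 0 <= 1 - k%:R / w.+1%:R :> R.
Proof.
move=> kw; rewrite subr_ge0 divr_ge0 ?ler0n// ler_pdivrMr ?ltr0n// mul1r ler_nat.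
by rewrite kw.
Qed.

Lemma ratio_bounds_lt (k w : nat) : (0 < k <= w)%N ->
  0 < k%:R / w.+1%:R :> R /\ 0 < 1 - k%:R / w.+1%:R :> R.
Proof.
move=> /andP[k0 kw]; rewrite subr_gt0 divr_gt0 ?ltr0n// ltr_pdivrMr ?ltr0n// mul1r ltr_nat.
by rewrite ltnS kw.
Qed.

Lemma edge_point_edge b c k : b != c -> (k <= (W b c).+1)%N -> edge b c (edge_point b c k).
Proof.
move=> bc kw; have [r0 r1] := ratio_bounds kw.
split; last by move=> v vb vc; exact: edge_point0.
split=> [v|]; first by rewrite mxE; do ?case: ifP.
have [a [d u]] := two_more bc; have [[_ ba bd] [ca cd _]] := uniq4_ne u.
have [[cb ab db] [ac dc da]] := uniq4_en u.
by rewrite (big_uniq4 _ u) !edge_pointE// !edge_point0// !addr0 subrK.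
Qed.

Lemma edge_point_interior b c k : b != c -> (0 < k <= W b c)%N ->
  edge_interior b c (edge_point b c k).
Proof.
move=> bc kw; have [r0 r1] := ratio_bounds_lt kw; split.
  by apply: edge_point_edge => //; case/andP: kw => _ kw; exact: leqW.
by rewrite !edge_pointE.
Qed.

Lemma edge_point_sym b c k : b != c -> (k <= (W b c).+1)%N ->
  edge_point b c k = edge_point c b ((W b c).+1 - k).
Proof.
move=> bc kw; have cb : c != b by rewrite eq_sym.
have e : ((W b c).+1 - k)%:R / (W b c).+1%:R = 1 - k%:R / (W b c).+1%:R :> R.
  by rewrite natrB// mulrBl divff// pnatr_eq0.
apply/rowP => v; have [->|vb] := eqVneq v b.
  by rewrite !edge_pointE// (Wsym c b) e.
have [->|vc] := eqVneq v c; last by rewrite !edge_point0.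
by rewrite !edge_pointE// (Wsym c b) e subKr.
Qed.

Lemma level_edge_point b c k : b != c -> level b (edge_point b c k) = k%:R.
Proof.
move=> bc; have [a [d u]] := two_more bc.
have u' : uniq [:: c; b; a; d] by rewrite uniq4_swap12.
rewrite (levelE _ u') edge_pointE// mulrC mulfVK ?pnatr_eq0//.
have [[_ ba bd] [ca cd _]] := uniq4_ne u.
have [[cb ab db] [ac dc da]] := uniq4_en u.
by rewrite !edge_point0// !mulr0 !addr0.
Qed.

Lemma edge_level b c k x : b != c -> edge b c x -> level b x = k%:R ->
  x = edge_point b c k.
Proof.
move=> bc ex lx; have [a [d u]] := two_more bc.
have [[_ ba bd] [ca cd _]] := uniq4_ne u.
have u' : uniq [:: c; b; a; d] by rewrite uniq4_swap12.
have xc : x 0 c = k%:R / (W b c).+1%:R.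
  have [[cb ab db] [ac dc da]] := uniq4_en u.
  move: lx; rewrite (levelE _ u') (ex.2 a)// (ex.2 d)//.
  rewrite !mulr0 !addr0 => <-; by rewrite mulrC mulKf// pnatr_eq0.
have := edge_sum bc ex; rewrite xc => xb; apply/rowP => v.
have [->|vb] := eqVneq v b; first by rewrite edge_pointE//; apply/eqP; rewrite eq_sym subr_eq xb.
have [->|vc] := eqVneq v c; first by rewrite edge_pointE.
by rewrite edge_point0// ex.2.
Qed.

(** On the face opposite [b] the level is an average of the numbers [W b u + 1], taken over the
    vertices with nonzero coordinate. *)
Lemma level_low b x (w : nat) : tetra x -> x 0 b = 0 ->
  (forall u, u != b -> x 0 u != 0 -> (w < (W b u).+1)%N) -> w.+1%:R <= level b x.
Proof.
move=> [x0 x1] xb hw; rewrite -[leLHS]mulr1 -[X in _ * X <= _]x1 mulr_sumr; apply: ler_sum => u _.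
have [->|ub] := eqVneq u b; first by rewrite xb !mulr0.
have [->|xu] := eqVneq (x 0 u) 0; first by rewrite !mulr0.
by rewrite /= ler_wpM2r// ler_nat hw.
Qed.

Lemma frac_cancel (w x k : R) : w != 0 -> k != 0 -> w * x / k * (k / w) = x.
Proof. by move=> w0 k0; rewrite [w * x]mulrC mulrA mulfVK// mulfK. Qed.

Lemma corner_segment a b c d k x : uniq [:: a; b; c; d] -> (0 < k)%N ->
  face a x -> level b x = k%:R -> exists2 r : R, 0 <= r <= 1 &
    x = (1 - r) *: edge_point b c k + r *: edge_point b d k.
Proof.
move=> u k0 [tx xa]; have [[ab ac ad] [bc bd cd]] := uniq4_ne u.
have [[ba ca da] [cb db dc]] := uniq4_en u.
have kR : k%:R != 0 :> R by rewrite pnatr_eq0 -lt0n.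
have wc : (W b c).+1%:R != 0 :> R by rewrite pnatr_eq0.
have wd : (W b d).+1%:R != 0 :> R by rewrite pnatr_eq0.
rewrite (levelE _ u) xa mulr0 add0r => lx.
have xc0 := tx.1 c; have xd0 := tx.1 d.
have hc : 0 <= (W b c).+1%:R * x 0 c by rewrite mulr_ge0.
have hd : 0 <= (W b d).+1%:R * x 0 d by rewrite mulr_ge0.
(* The share of the term of [d] in the level of [x]. *)
exists ((W b d).+1%:R * x 0 d / k%:R).
  rewrite divr_ge0 ?ler0n//= ler_pdivrMr ?ltr0n// mul1r -lx.
  by rewrite lerDr.
have e1 : 1 - (W b d).+1%:R * x 0 d / k%:R = (W b c).+1%:R * x 0 c / k%:R.
  by rewrite -[X in X - _](divff kR) -mulrBl -lx addrK.
have xs := tetra_sum4 u tx; rewrite xa add0r in xs.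
have gE r v : ((1 - r) *: edge_point b c k + r *: edge_point b d k) 0 v =
  (1 - r) * edge_point b c k 0 v + r * edge_point b d k 0 v by rewrite !mxE.
apply/rowP => v; rewrite gE e1; case: (uniq4_cases v u) => ->.
- by rewrite !edge_point0// xa !mulr0 addr0.
- rewrite !edge_pointE//.
  have ec : (W b c).+1%:R * x 0 c / k%:R * (k%:R / (W b c).+1%:R) = x 0 c.
    exact: frac_cancel.
  have ed : (W b d).+1%:R * x 0 d / k%:R * (k%:R / (W b d).+1%:R) = x 0 d.
    exact: frac_cancel.
  rewrite !mulrBr !mulr1 ec ed.
  have : (W b c).+1%:R * x 0 c / k%:R + (W b d).+1%:R * x 0 d / k%:R = 1.
    by rewrite -mulrDl lx divff.
  by move: xs; clear; lra.
- by rewrite edge_pointE// (@edge_point0 b d)// mulr0 addr0 frac_cancel.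
- by rewrite (@edge_point0 b c)// mulr0 add0r edge_pointE// frac_cancel.
Qed.

Lemma corner_arc_normal a b c d k : uniq [:: a; b; c; d] ->
  (0 < k)%N -> (k <= W b c)%N -> (k <= W b d)%N ->
  normal_arc a [set x | face a x /\ level b x = k%:R].
Proof.
move=> u k0 kc kd; have [[ab ac ad] [bc bd cd]] := uniq4_ne u.
have [[ba ca da] [cb db dc]] := uniq4_en u.
have kc' : (0 < k <= W b c)%N by rewrite k0.
have kd' : (0 < k <= W b d)%N by rewrite k0.
exists b, c, d; split=> //.
pose P := edge_point b c k; pose Q := edge_point b d k.
have Pi := edge_point_interior bc kc'; have Qi := edge_point_interior bd kd'.
rewrite -/P in Pi; rewrite -/Q in Qi.
have [Pc0 Pb0] := ratio_bounds_lt kc'; have [Qd0 Qb0] := ratio_bounds_lt kd'.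
have Pa : P 0 a = 0 by rewrite /P edge_point0.
have Pb : P 0 b = 1 - k%:R / (W b c).+1%:R by rewrite /P edge_pointE.
have Pc : P 0 c = k%:R / (W b c).+1%:R by rewrite /P edge_pointE.
have Pd : P 0 d = 0 by rewrite /P edge_point0.
have Qa : Q 0 a = 0 by rewrite /Q edge_point0.
have Qb : Q 0 b = 1 - k%:R / (W b d).+1%:R by rewrite /Q edge_pointE.
have Qc : Q 0 c = 0 by rewrite /Q edge_point0.
have Qd : Q 0 d = k%:R / (W b d).+1%:R by rewrite /Q edge_pointE.
pose g (t : R) := (1 - t) *: P + t *: Q.
have gE t v : g t 0 v = (1 - t) * P 0 v + t * Q 0 v by rewrite !mxE.
have [tP _] := Pi.1; have [tQ _] := Qi.1.
have gt t : 0 <= t <= 1 -> tetra (g t).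
  move=> /andP[t0 t1]; split=> [v|].
    by rewrite gE addr_ge0// mulr_ge0// ?subr_ge0//; [exact: tP.1|exact: tQ.1].
  under eq_bigr do rewrite gE.
  by rewrite big_split -!mulr_sumr /= tP.2 tQ.2 !mulr1 subrK.
exists g; split.
- apply: within_continuous_row => i; apply: continuous_subspaceT.
  under eq_fun do rewrite gE.
  move=> x; apply: cvgD; apply: cvgM; try exact: cvg_cst; last exact: cvg_id.
  by apply: cvgB; [exact: cvg_cst|exact: cvg_id].
- move=> s t _ _ /rowP/(_ c); rewrite !gE Qc !mulr0 !addr0.
  by move=> /mulIf; rewrite Pc gt_eqF// => /(_ isT)/addrI/oppr_inj.
- by rewrite /g subr0 subrr !scale0r !scale1r addr0 add0r.
- move=> t /andP[t0 t1]; have t01 : 0 <= t <= 1 by rewrite !ltW.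
  split; first by split; [exact: gt|rewrite gE Pa Qa !mulr0 addr0].
  move=> v va; rewrite gE; case: (uniq4_cases v u) va => ->; rewrite ?eqxx// => _.
  + by rewrite Pb Qb addr_gt0// mulr_gt0// subr_gt0.
  + by rewrite Qc mulr0 addr0 Pc mulr_gt0// subr_gt0.
  + by rewrite Pd mulr0 add0r Qd mulr_gt0.
- apply/seteqP; split=> [x [fx lx]|y [t]].
    have [r r01 ->] := corner_segment u k0 fx lx.
    by exists r => //=; rewrite in_itv.
  rewrite /= in_itv /= => t01 <-; split.
    by split; [exact: gt|rewrite gE Pa Qa !mulr0 addr0].
  rewrite /g levelD !levelZ /P /Q !level_edge_point//; ring.
Qed.

End Levels.

(** * Planar triangles and quadrilaterals as discs *)

Section Discs.
Variable R : realType.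

Lemma continuousDr (U : topologicalType) (f g : U -> R) :
  continuous f -> continuous g -> continuous (fun x => f x + g x).
Proof. by move=> cf cg x; apply: cvgD; [exact: cf|exact: cg]. Qed.

Lemma continuous_ext (U : topologicalType) (f g : U -> R) :
  (forall x, f x = g x) -> continuous g -> continuous f.
Proof. by move=> /funext ->. Qed.

Definition mk4 (a b c : 'I_4) (xa xb xc xd : R) : 'rV[R]_4 :=
  \row_u (if u == a then xa else if u == b then xb else if u == c then xc else xd).

Lemma mk4E a b c d xa xb xc xd : uniq [:: a; b; c; d] ->
  [/\ mk4 a b c xa xb xc xd 0 a = xa, mk4 a b c xa xb xc xd 0 b = xb,
      mk4 a b c xa xb xc xd 0 c = xc & mk4 a b c xa xb xc xd 0 d = xd].
Proof.
move=> u; have [[/negPf ba /negPf ca /negPf da] [/negPf cb /negPf db /negPf dc]] := uniq4_en u.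
by rewrite !mxE !eqxx ba ca da cb db dc.
Qed.

Lemma tetra4 a b c d (x : 'rV[R]_4) : uniq [:: a; b; c; d] ->
  0 <= x 0 a -> 0 <= x 0 b -> 0 <= x 0 c -> 0 <= x 0 d ->
  x 0 a + x 0 b + x 0 c + x 0 d = 1 -> tetra x.
Proof.
move=> u ha hb hc hd s; split; last by rewrite (big_uniq4 _ u).
by move=> v; case: (uniq4_cases v u) => ->.
Qed.

Lemma row4_eq a b c d (x y : 'rV[R]_4) : uniq [:: a; b; c; d] ->
  x 0 a = y 0 a -> x 0 b = y 0 b -> x 0 c = y 0 c -> x 0 d = y 0 d -> x = y.
Proof.
by move=> u *; apply/rowP => v; case: (uniq4_cases v u) => ->.
Qed.

(** The unit square, rescaled, is the unit ball of the sup norm. The last hypothesis says that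
    exactly the boundary of the square goes to the boundary of the tetrahedron. *)
Lemma disc_param (D : set 'rV[R]_4) (H : R -> R -> 'rV[R]_4)
    (I := fun r : R => 0 <= r <= 1) :
  (forall i p, I p.1 -> I p.2 -> {for p, continuous (fun p : R * R => H p.1 p.2 0 i)}) ->
  (forall r s r' s', I r -> I s -> I r' -> I s' -> H r s = H r' s' -> r = r' /\ s = s') ->
  (forall r s, I r -> I s -> D (H r s)) ->
  (forall x, D x -> exists r s, [/\ I r, I s & x = H r s]) ->
  D `<=` @tetra R ->
  (forall r s, I r -> I s -> (exists a, H r s 0 a = 0) <-> [\/ r = 0, r = 1, s = 0 | s = 1]) ->
  properly_embedded_disc D.
Proof.
move=> cH iH DH sD Dt bd.
pose u0 (y : 'rV[R]_2) := (1 + y 0 ord0) / 2; pose u1 (y : 'rV[R]_2) := (1 + y 0 ord_max) / 2.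
pose h y := H (u0 y) (u1 y).
have I0 y : `|y| <= 1 -> I (u0 y).
  move=> y1; have := le_trans (rv_norm_coord y ord0) y1; rewrite ler_norml /u0 /I => /andP[h1 h2].
  by apply/andP; split; lra.
have I1 y : `|y| <= 1 -> I (u1 y).
  move=> y1; have := le_trans (rv_norm_coord y ord_max) y1; rewrite ler_norml /u1 /I => /andP[h1 h2].
  by apply/andP; split; lra.
have ex r s : I r -> I s -> exists y, [/\ `|y| <= 1, u0 y = r & u1 y = s].
  move=> /andP[r0 r1] /andP[s0 s1]; exists (row2 (2 * r - 1) (2 * s - 1)).
  rewrite norm2E /u0 /u1 !row2E ge_max !ler_norml; split; [|lra|lra].
  by apply/andP; split; apply/andP; split; lra.
have nb y : `|y| <= 1 -> `|y| = 1 <-> [\/ u0 y = 0, u0 y = 1, u1 y = 0 | u1 y = 1].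
  move=> y1; rewrite norm2E /u0 /u1; move: y1; rewrite norm2E ge_max => /andP[y1 y1'].
  split=> [|hs].
    by case: (leP `|y 0 ord0| `|y 0 ord_max|) => _ /eqP; rewrite eqr_norml ler01 andbT;
      case/orP => /eqP ->; [constructor 4|constructor 3|constructor 2|constructor 1]; lra.
  apply/le_anti; rewrite ge_max y1 y1' le_max /=; apply/orP.
  by case: hs => hs; [left|left|right|right];
    [rewrite (_ : y 0 ord0 = -1)|rewrite (_ : y 0 ord0 = 1)|
     rewrite (_ : y 0 ord_max = -1)|rewrite (_ : y 0 ord_max = 1)];
    rewrite ?normrN ?normr1//; lra.
have c0 : {within @ball_set R 2, continuous u0}.
  apply: continuous_subspaceT; apply: continuousMr; last exact: continuous_cstr.
  by apply: continuousDr; [exact: continuous_cstr|exact: coord_continuous].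
have c1 : {within @ball_set R 2, continuous u1}.
  apply: continuous_subspaceT; apply: continuousMr; last exact: continuous_cstr.
  by apply: continuousDr; [exact: continuous_cstr|exact: coord_continuous].
exists h; split.
- apply: within_continuous_row => i; apply/subspace_continuousP => y y1.
  have yI0 := I0 y y1; have yI1 := I1 y y1.
  have c := cH i (u0 y, u1 y) yI0 yI1.
  apply: (@cvg_comp _ _ _ (fun y => (u0 y, u1 y)) (fun p : R * R => H p.1 p.2 0 i)); last exact: c.
  have d0 : u0 z @[z --> within (@ball_set R 2) (nbhs y)] --> u0 y.
    by move: c0 => /subspace_continuousP/(_ y y1).
  have d1 : u1 z @[z --> within (@ball_set R 2) (nbhs y)] --> u1 y.
    by move: c1 => /subspace_continuousP/(_ y y1).
  exact: (cvg_pair d0 d1).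
- move=> y y' /set_mem y1 /set_mem y1' /iH.
  case; [exact: I0|exact: I1|exact: I0|exact: I1|].
  rewrite /u0 /u1 => e0 e1; rewrite (row2_eta y) (row2_eta y').
  by congr row2; lra.
- apply/seteqP; split=> [x /sD[r [s [Ir Is ->]]]|_ [y y1 <-]].
    by have [y [y1 <- <-]] := ex r s Ir Is; exists y.
  by apply: DH; [exact: I0|exact: I1].
- exact: Dt.
- apply/seteqP; split=> [x [Dx [a _ [_ xa]]]|_ [y y1 <-]].
    have [r [s [Ir Is xE]]] := sD x Dx.
    have [y [y1 yr ys]] := ex r s Ir Is; exists y; last by rewrite /h yr ys.
    by apply/nb => //; rewrite yr ys; apply/bd => //; exists a; rewrite -xE.
  have y1' : `|y| <= 1 by rewrite y1.
  have Dh : D (h y) by apply: DH; [exact: I0|exact: I1].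
  split=> //; have [a ha] : exists a, h y 0 a = 0 by apply/bd; [exact: I0|exact: I1|exact/nb].
  by exists a => //; split=> //; exact: Dt.
Qed.

Lemma convex_lt1 (x y z p q r : R) : 0 <= x -> 0 <= y -> 0 <= z ->
  x + y + z = 1 -> p < 1 -> q < 1 -> r < 1 -> x * p + y * q + z * r < 1.
Proof.
move=> x0 y0 z0 s p1 q1 r1; pose M := Num.max p (Num.max q r).
have M1 : M < 1 by rewrite !gt_max p1 q1 r1.
apply: le_lt_trans M1; rewrite -[leRHS]mul1r -s !mulrDl !lerD// ler_wpM2l//.
- by rewrite le_max lexx.
- by rewrite !le_max lexx orbT.
- by rewrite !le_max lexx !orbT.
Qed.

Lemma tri_disc (v a b c : 'I_4) (pa pb pc : R) (D : set 'rV[R]_4) :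
  uniq [:: v; a; b; c] -> 0 < pa < 1 -> 0 < pb < 1 -> 0 < pc < 1 ->
  (forall x, D x <-> tetra x /\ x 0 a / pa + x 0 b / pb + x 0 c / pc = 1) ->
  properly_embedded_disc D.
Proof.
move=> u /andP[a0 a1] /andP[b0 b1] /andP[c0 c1] DE.
(* Barycentric weights carrying the square onto a triangle: three corners go to the vertices and
   [(1, 1)] to the midpoint of the side [wc = 0], which is the image of the two sides [r = 1] and
   [s = 1]. *)
pose mn (r s : R) : R := Num.min r s / 2.
pose wa (r s : R) : R := r - mn r s; pose wb (r s : R) : R := s - mn r s.
pose wc (r s : R) : R := 1 - Num.max r s.
pose H r s := mk4 v a b (1 - (wa r s * pa + wb r s * pb + wc r s * pc))
  (wa r s * pa) (wb r s * pb) (wc r s * pc).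
have HE r s : [/\ H r s 0 v = 1 - (wa r s * pa + wb r s * pb + wc r s * pc),
    H r s 0 a = wa r s * pa, H r s 0 b = wb r s * pb & H r s 0 c = wc r s * pc].
  exact: mk4E.
have w0 r s : 0 <= r <= 1 -> 0 <= s <= 1 -> [/\ 0 <= wa r s, 0 <= wb r s & 0 <= wc r s].
  by move=> /andP[r0 r1] /andP[s0 s1]; rewrite /wa /wb /wc /mn; case: (leP r s) => rs; split; lra.
have ws r s : wa r s + wb r s + wc r s = 1.
  by rewrite /wa /wb /wc /mn; case: (leP r s) => rs; lra.
have Hv0 r s : 0 <= r <= 1 -> 0 <= s <= 1 -> 0 < H r s 0 v.
  move=> Ir Is; have [-> _ _ _] := HE r s; have [h1 h2 h3] := w0 r s Ir Is.
  by rewrite subr_gt0 convex_lt1// ws.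
have Ht r s : 0 <= r <= 1 -> 0 <= s <= 1 -> tetra (H r s).
  move=> Ir Is; have Hv := Hv0 r s Ir Is; have [h1 h2 h3] := w0 r s Ir Is.
  have [ev ea eb ec] := HE r s; apply: (tetra4 u).
  - exact: ltW.
  - by rewrite ea mulr_ge0// ltW.
  - by rewrite eb mulr_ge0// ltW.
  - by rewrite ec mulr_ge0// ltW.
  - by rewrite ev ea eb ec; lra.
have [na nb nc] : [/\ pa != 0, pb != 0 & pc != 0] by rewrite !gt_eqF.
apply: (@disc_param D H) => //.
- have cmn : continuous (fun p : R * R => mn p.1 p.2).
    apply: continuousMr; last exact: continuous_cstr.
    by apply: continuous_minr => p; [exact: cvg_fst|exact: cvg_snd].
  have cwa : continuous (fun p : R * R => wa p.1 p.2).
    by apply: continuousBr => // p; exact: cvg_fst.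
  have cwb : continuous (fun p : R * R => wb p.1 p.2).
    by apply: continuousBr => // p; exact: cvg_snd.
  have cwc : continuous (fun p : R * R => wc p.1 p.2).
    apply: continuousBr; first exact: continuous_cstr.
    by apply: continuous_maxr => p; [exact: cvg_fst|exact: cvg_snd].
  have cc (k : R) : continuous (fun _ : R * R => k) by exact: continuous_cstr.
  have ev p := let: And4 e _ _ _ := HE p.1 p.2 in e.
  have ea p := let: And4 _ e _ _ := HE p.1 p.2 in e.
  have eb p := let: And4 _ _ e _ := HE p.1 p.2 in e.
  have ec p := let: And4 _ _ _ e := HE p.1 p.2 in e.
  suff cH i : continuous (fun p : R * R => H p.1 p.2 0 i) by move=> i p _ _; exact: cH.
  case: (uniq4_cases i u) => ->.
  + apply: (continuous_ext ev); apply: continuousBr => //.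
    by apply: continuousDr; [apply: continuousDr|]; exact: continuousMr.
  + by apply: (continuous_ext ea); exact: continuousMr.
  + by apply: (continuous_ext eb); exact: continuousMr.
  + by apply: (continuous_ext ec); exact: continuousMr.
- move=> r s r' s' Ir Is Ir' Is' E.
  have [_ ea eb ec] := HE r s; have [_ ea' eb' ec'] := HE r' s'.
  have : wa r s = wa r' s' by apply: (mulIf na); rewrite -ea -ea' E.
  have : wb r s = wb r' s' by apply: (mulIf nb); rewrite -eb -eb' E.
  rewrite /wa /wb /mn; clear; case: (leP r s) => rs; case: (leP r' s') => rs' *; split; lra.
- move=> r s Ir Is; apply/DE; split; first exact: Ht.
  by have [_ -> -> ->] := HE r s; rewrite !mulfK.
- move=> x /DE[tx e]; have xs := tetra_sum4 u tx.
  set xa := x 0 a / pa in e; set xb := x 0 b / pb in e; set xc := x 0 c / pc in e.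
  have [xa0 xb0 xc0] : [/\ 0 <= xa, 0 <= xb & 0 <= xc].
    by have := tx.1; split; rewrite divr_ge0// ltW.
  (* The inverse map: the smaller of the first two weights equals [mn r s]. *)
  exists (xa + Num.min xa xb), (xb + Num.min xa xb).
  have [e1 e2] : wa (xa + Num.min xa xb) (xb + Num.min xa xb) = xa /\
      wb (xa + Num.min xa xb) (xb + Num.min xa xb) = xb.
    by rewrite /wa /wb /mn -addr_minl; lra.
  have e3 : wc (xa + Num.min xa xb) (xb + Num.min xa xb) = xc.
    by have := ws (xa + Num.min xa xb) (xb + Num.min xa xb); rewrite e1 e2; lra.
  have [i1 i2] : 0 <= xa + Num.min xa xb <= 1 /\ 0 <= xb + Num.min xa xb <= 1.
    move: xa0 xb0 xc0 e; clear; move: xa xb xc => xa xb xc *.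
    by case: (leP xa xb) => h; split; apply/andP; split; lra.
  split=> //.
  have [ev ea eb ec] := HE (xa + Num.min xa xb) (xb + Num.min xa xb).
  have [fa fb fc] : [/\ x 0 a = xa * pa, x 0 b = xb * pb & x 0 c = xc * pc].
    by rewrite /xa /xb /xc !divfK.
  apply: (row4_eq u); rewrite ?ev ?ea ?eb ?ec ?e1 ?e2 ?e3 //; lra.
- by move=> x /DE[].
- move=> r s Ir Is; have [ev ea eb ec] := HE r s; have Hv := Hv0 r s Ir Is.
  have key : (exists i, H r s 0 i = 0) <-> [\/ wa r s = 0, wb r s = 0 | wc r s = 0].
    split=> [[i]|].
      case: (uniq4_cases i u) => ->; rewrite ?ea ?eb ?ec.
      - by move=> h; rewrite h ltxx in Hv.
      - by move/eqP; rewrite mulf_eq0 (negPf na) orbF => /eqP; constructor 1.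
      - by move/eqP; rewrite mulf_eq0 (negPf nb) orbF => /eqP; constructor 2.
      - by move/eqP; rewrite mulf_eq0 (negPf nc) orbF => /eqP; constructor 3.
    by case=> e; [exists a; rewrite ea e mul0r|exists b; rewrite eb e mul0r|exists c; rewrite ec e mul0r].
  apply: (iff_trans key); move: Ir Is => /andP[r0 r1] /andP[s0 s1].
  rewrite /wa /wb /wc /mn; case: (leP r s) => rs; split.
  + by case=> e; [constructor 1; lra|constructor 3; lra|constructor 4; lra].
  + by case=> e; [constructor 1; lra|constructor 3; lra|constructor 1; lra|constructor 3; lra].
  + by case=> e; [constructor 1; lra|constructor 3; lra|constructor 2; lra].
  + by case=> e; [constructor 1; lra|constructor 3; lra|constructor 2; lra|constructor 3; lra].
Qed.

Lemma weighted_sum_gt0 (k l x y : R) : 0 < k -> 0 < l -> 0 <= x -> 0 <= y ->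
  (0 < k * x + l * y) = (0 < x + y).
Proof.
move=> k0 l0 x0 y0; rewrite !lt_neqAle !addr_ge0 ?mulr_ge0 ?(ltW k0) ?(ltW l0)// !andbT.
rewrite ![0 == _]eq_sym !paddr_eq0 ?mulr_ge0 ?(ltW k0) ?(ltW l0)//.
by rewrite !mulf_eq0 (gt_eqF k0) (gt_eqF l0).
Qed.

Lemma ratio_coord (y s t k : R) : s != 0 -> t != 0 -> k != 0 ->
  y = y / s * (k / t) / (k / (s * t)).
Proof. by move=> s0 t0 k0; field; rewrite ?s0 ?t0 ?k0. Qed.

Lemma quad_disc (a b c d : 'I_4) (ka kb kc kd : R) (D : set 'rV[R]_4) :
  uniq [:: a; b; c; d] -> 0 < ka -> 0 < kb -> 0 < kc -> 0 < kd ->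
  (forall x, D x <-> tetra x /\ ka * x 0 a + kb * x 0 b = kc * x 0 c + kd * x 0 d) ->
  properly_embedded_disc D.
Proof.
move=> u a0 b0 c0 d0 DE.
(* [r] and [s] are the ratios in which the coordinates are shared within [ab] and within [cd]. The
   equation of the plane then forces the two pairs to have total weights in the ratio of [Q s] to
   [P r]. *)
pose P (r : R) := r * ka + (1 - r) * kb; pose Q (s : R) := s * kc + (1 - s) * kd.
pose N r s := P r + Q s.
pose H r s := mk4 a b c (r * Q s / N r s) ((1 - r) * Q s / N r s)
  (s * P r / N r s) ((1 - s) * P r / N r s).
have HE r s : [/\ H r s 0 a = r * Q s / N r s, H r s 0 b = (1 - r) * Q s / N r s,
    H r s 0 c = s * P r / N r s & H r s 0 d = (1 - s) * P r / N r s].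
  exact: mk4E.
have P0 r : 0 <= r <= 1 -> 0 < P r by move=> /andP[r0 r1]; rewrite /P; nra.
have Q0 s : 0 <= s <= 1 -> 0 < Q s by move=> /andP[s0 s1]; rewrite /Q; nra.
have N0 r s : 0 <= r <= 1 -> 0 <= s <= 1 -> 0 < N r s.
  by move=> Ir Is; rewrite addr_gt0 ?P0 ?Q0.
have I1 (r : R) : 0 <= r <= 1 -> 0 <= 1 - r by case/andP=> *; lra.
have I0 (r : R) : 0 <= r <= 1 -> 0 <= r by case/andP.
have Ht r s : 0 <= r <= 1 -> 0 <= s <= 1 -> tetra (H r s).
  move=> Ir Is; have [ea eb ec ed] := HE r s.
  have Pr := ltW (P0 r Ir); have Qs := ltW (Q0 s Is); have Nrs := N0 r s Ir Is.
  have Nge := ltW Nrs; have rr := I1 r Ir; have ss := I1 s Is.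
  have r0 := I0 r Ir; have s0 := I0 s Is.
  apply: (tetra4 u).
  - by rewrite ea divr_ge0// mulr_ge0.
  - by rewrite eb divr_ge0// mulr_ge0.
  - by rewrite ec divr_ge0// mulr_ge0.
  - by rewrite ed divr_ge0// mulr_ge0.
  rewrite ea eb ec ed -!mulrDl -[RHS](@divff _ (N r s)) ?gt_eqF//.
  by congr (_ / _); rewrite /N; ring.
have sab r s : 0 <= r <= 1 -> 0 <= s <= 1 -> H r s 0 a + H r s 0 b = Q s / N r s.
  by move=> Ir Is; have [-> -> _ _] := HE r s; ring.
have scd r s : 0 <= r <= 1 -> 0 <= s <= 1 -> H r s 0 c + H r s 0 d = P r / N r s.
  by move=> Ir Is; have [_ _ -> ->] := HE r s; ring.
apply: (@disc_param D H) => //.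
- have cP : continuous (fun p : R * R => P p.1).
    apply: continuousDr; apply: continuousMr; try exact: continuous_cstr; first by move=> p; exact: cvg_fst.
    by apply: continuousBr; [exact: continuous_cstr|move=> p; exact: cvg_fst].
  have cQ : continuous (fun p : R * R => Q p.2).
    apply: continuousDr; apply: continuousMr; try exact: continuous_cstr; first by move=> p; exact: cvg_snd.
    by apply: continuousBr; [exact: continuous_cstr|move=> p; exact: cvg_snd].
  have c1 : continuous (fun p : R * R => p.1) by move=> p; exact: cvg_fst.
  have c2 : continuous (fun p : R * R => p.2) by move=> p; exact: cvg_snd.
  have c11 : continuous (fun p : R * R => 1 - p.1) by apply: continuousBr => //; exact: continuous_cstr.
  have c12 : continuous (fun p : R * R => 1 - p.2) by apply: continuousBr => //; exact: continuous_cstr.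
  move=> i p I1p I2p.
  have cV : {for p, continuous (fun p : R * R => (N p.1 p.2)^-1)}.
    have np : N p.1 p.2 != 0 by rewrite gt_eqF// N0.
    have cN := @continuousDr _ _ _ cP cQ; exact: cvgV np (cN p).
  have ea (p : R * R) := let: And4 e _ _ _ := HE p.1 p.2 in e.
  have eb (p : R * R) := let: And4 _ e _ _ := HE p.1 p.2 in e.
  have ec (p : R * R) := let: And4 _ _ e _ := HE p.1 p.2 in e.
  have ed (p : R * R) := let: And4 _ _ _ e := HE p.1 p.2 in e.
  have fin (f g : R * R -> R) : (forall p, f p = g p / N p.1 p.2) -> continuous g ->
      {for p, continuous f}.
    by move=> /funext -> cg; exact: cvgM (cg p) cV.
  case: (uniq4_cases i u) => ->.
  + exact: fin ea (continuousMr c1 cQ).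
  + exact: fin eb (continuousMr c11 cQ).
  + exact: fin ec (continuousMr c2 cP).
  + exact: fin ed (continuousMr c12 cP).
- move=> r s r' s' Ir Is Ir' Is' E.
  have [ea _ ec _] := HE r s; have [ea' _ ec' _] := HE r' s'.
  have n1 : Q s / N r s != 0 by rewrite gt_eqF// divr_gt0 ?Q0 ?N0.
  have n2 : P r / N r s != 0 by rewrite gt_eqF// divr_gt0 ?P0 ?N0.
  have e1 : Q s / N r s = Q s' / N r' s' by rewrite -!sab// E.
  have e2 : P r / N r s = P r' / N r' s' by rewrite -!scd// E.
  split.
    by apply: (mulIf n1); rewrite {2}e1 !mulrA -ea -ea' E.
  by apply: (mulIf n2); rewrite {2}e2 !mulrA -ec -ec' E.
- move=> r s Ir Is; apply/DE; split; first exact: Ht.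
  by have [-> -> -> ->] := HE r s; rewrite !mulrA -!mulrDl; congr (_ / _); rewrite /P /Q; ring.
- move=> x /DE[tx e]; have xs := tetra_sum4 u tx.
  have := tx.1 a; have := tx.1 b; have := tx.1 c; have := tx.1 d.
  have [xa ea] : exists y, x 0 a = y by exists (x 0 a).
  have [xb eb] : exists y, x 0 b = y by exists (x 0 b).
  have [xc ec] : exists y, x 0 c = y by exists (x 0 c).
  have [xd ed] : exists y, x 0 d = y by exists (x 0 d).
  rewrite ea eb ec ed => d1 d2 d3 d4; rewrite ea eb ec ed in e xs.
  set K := ka * xa + kb * xb in e.
  have K0 : 0 < K.
    have [h|h] : 0 < xa + xb \/ 0 < xc + xd.
      by case: (ltP 0 (xa + xb)) => h; [left|right; move: h xs; clear; lra].
    - by rewrite /K weighted_sum_gt0.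
    - by rewrite e weighted_sum_gt0.
  have s0 : 0 < xa + xb by rewrite -(weighted_sum_gt0 a0 b0).
  have t0 : 0 < xc + xd by rewrite -(weighted_sum_gt0 c0 d0)// -e.
  have ns : xa + xb != 0 by rewrite gt_eqF.
  have nt : xc + xd != 0 by rewrite gt_eqF.
  have nK : K != 0 by rewrite gt_eqF.
  exists (xa / (xa + xb)), (xc / (xc + xd)).
  have eP : P (xa / (xa + xb)) = K / (xa + xb) by rewrite /P /K; field.
  have eQ : Q (xc / (xc + xd)) = K / (xc + xd) by rewrite e /Q; field.
  have eN : N (xa / (xa + xb)) (xc / (xc + xd)) = K / ((xa + xb) * (xc + xd)).
    rewrite /N eP eQ -[in RHS](mulr1 K) -xs; field; by rewrite ns nt.
  split.
  + by rewrite divr_ge0 ?addr_ge0//= ler_pdivrMr// mul1r lerDl.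
  + by rewrite divr_ge0 ?addr_ge0//= ler_pdivrMr// mul1r lerDl.
  have [ha hb hc hd] := HE (xa / (xa + xb)) (xc / (xc + xd)).
  have cmp (y z : R) : y + z != 0 -> 1 - y / (y + z) = z / (y + z).
    by move=> yz; rewrite -[X in X - _](divff yz) -mulrBl addrC addKr.
  apply: (row4_eq u).
  + by rewrite ea ha eN eQ; exact: ratio_coord.
  + by rewrite eb hb eN eQ cmp//; exact: ratio_coord.
  + by rewrite ec hc eN eP [_ * (xc + xd)]mulrC; exact: ratio_coord.
  + by rewrite ed hd eN eP cmp// [_ * (xc + xd)]mulrC; exact: ratio_coord.
- by move=> x /DE[].
- move=> r s Ir Is; have [ea eb ec ed] := HE r s.
  have nN : N r s != 0 by rewrite gt_eqF// N0.
  have nP : P r != 0 by rewrite gt_eqF// P0.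
  have nQ : Q s != 0 by rewrite gt_eqF// Q0.
  split=> [[i]|].
    case: (uniq4_cases i u) => ->; rewrite ?ea ?eb ?ec ?ed => /eqP;
    rewrite !mulf_eq0 invr_eq0 (negPf nN) ?(negPf nP) ?(negPf nQ) !orbF => /eqP h.
    + by constructor 1.
    + by constructor 2; lra.
    + by constructor 3.
    + by constructor 4; lra.
  case=> E; [exists a|exists b|exists c|exists d]; rewrite ?ea ?eb ?ec ?ed E ?subrr !mul0r //.
Qed.

End Discs.

(** * The octagon *)

Section Octagon.
Variables (R : realType) (t : 'I_4 -> nat) (m : 'I_3).

Definition octw (u v : 'I_4) : nat := (t u + t v + (if same_side m u v then 2 else 1))%N.

Lemma octw_sym u v : octw u v = octw v u.
Proof. by rewrite /octw same_sideC (addnC (t u)). Qed.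

(** The first crossing on [uv] beyond the triangles at [u]. On an edge met twice, [octv u v] and
    [octv v u] are the two points of the octagon; on any other edge they coincide. *)
Definition octv (u v : 'I_4) : 'rV[R]_4 := edge_point R octw u v (t u).+1.

Lemma octv_sym (u v : 'I_4) : u != v -> same_side m u v = false -> octv u v = octv v u.
Proof.
move=> uv s; rewrite /octv (edge_point_sym _ octw_sym uv).
  by congr edge_point; rewrite /octw s; lia.
by rewrite /octw s; lia.
Qed.

Lemma octv_interior (u v : 'I_4) : u != v -> edge_interior u v (octv u v).
Proof. by move=> uv; apply: edge_point_interior => //; rewrite /octw; case: ifP; lia. Qed.

Lemma rowD (x y : 'rV[R]_4) i : (x + y) 0 i = x 0 i + y 0 i. Proof. by rewrite mxE. Qed.
Lemma rowZ (k : R) (x : 'rV[R]_4) i : (k *: x) 0 i = k * x 0 i. Proof. by rewrite mxE. Qed.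

Definition pos (r : R) : R := Num.max r 0.

Lemma pos_ge0 r : 0 <= pos r. Proof. by rewrite le_max lexx orbT. Qed.
Lemma posE r : 0 <= r -> pos r = r. Proof. by move=> h; rewrite /pos (max_idPl _). Qed.
Lemma pos0 r : r <= 0 -> pos r = 0. Proof. by move=> h; rewrite /pos (max_idPr _). Qed.

(* The octagon is the cone over its boundary octagon: the square [|s|, |t| <= 1]
   is cut into eight triangles by its axes and diagonals, its corners and edge
   midpoints go to the eight points on the edges of the tetrahedron, and [s = 1],
   [s = -1], [t = 1], [t = -1] give the arcs around [a], [b], [c], [d]. *)
Definition oct_edge (a b c d : 'I_4) (r s : R) : 'rV[R]_4 :=
  pos (r - `|s|) *: octv a b + pos (- r - `|s|) *: octv b a +
  pos (s - `|r|) *: octv c d + pos (- s - `|r|) *: octv d c +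
  (Num.min (pos r) (pos s) *: octv a c + Num.min (pos r) (pos (- s)) *: octv a d +
   (Num.min (pos (- r)) (pos s) *: octv b c + Num.min (pos (- r)) (pos (- s)) *: octv b d)).

(** Every vertex lies on one of the two edges met twice, so this average has only positive
    coordinates and the cone meets the boundary of the tetrahedron in its base alone. *)
Definition oct_centre (a b c d : 'I_4) : 'rV[R]_4 :=
  (1 / 4) *: (octv a b + octv b a + (octv c d + octv d c)).

Definition oct_point (a b c d : 'I_4) (r s : R) : 'rV[R]_4 :=
  (1 - Num.max `|r| `|s|) *: oct_centre a b c d + oct_edge a b c d r s.

Lemma oct_edge_row a b c d r s i : oct_edge a b c d r s 0 i =
  pos (r - `|s|) * octv a b 0 i + pos (- r - `|s|) * octv b a 0 i +
  pos (s - `|r|) * octv c d 0 i + pos (- s - `|r|) * octv d c 0 i +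
  (Num.min (pos r) (pos s) * octv a c 0 i + Num.min (pos r) (pos (- s)) * octv a d 0 i +
   (Num.min (pos (- r)) (pos s) * octv b c 0 i + Num.min (pos (- r)) (pos (- s)) * octv b d 0 i)).
Proof. by rewrite /oct_edge 7!rowD 8!rowZ. Qed.

Definition oct_labels a b c d := uniq [:: a; b; c; d] /\ same_side m a b.

Lemma oct_labels_ab a b c d : oct_labels a b c d -> oct_labels b a c d.
Proof. by case=> u s; split; rewrite 1?uniq4_swap12 1?same_sideC. Qed.

Lemma oct_labels_rot a b c d : oct_labels a b c d -> oct_labels c d a b.
Proof.
case=> u s; split; first by rewrite -(rot_uniq 2).
by have [] := same_side_uniq u s.
Qed.

Lemma oct_edge_ab a b c d r s : oct_edge a b c d r s = oct_edge b a c d (- r) s.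
Proof.
rewrite /oct_edge (opprK r) (normrN r).
by rewrite [LHS](AC (4*(2*2)) ((2*1*3*4)*((7*8)*(5*6)))).
Qed.

Lemma oct_edge_cd a b c d r s : oct_edge a b c d r s = oct_edge a b d c r (- s).
Proof.
rewrite /oct_edge (opprK s) (normrN s).
by rewrite [LHS](AC (4*(2*2)) ((1*2*4*3)*((6*5)*(8*7)))).
Qed.

Lemma oct_edge_rot a b c d r s : oct_labels a b c d ->
  oct_edge a b c d r s = oct_edge c d a b s r.
Proof.
case=> u ss; have [[_ ac ad] [bc bd _]] := uniq4_ne u.
have [_ sac sad sbc sbd] := same_side_uniq u ss.
rewrite /oct_edge (octv_sym ac sac) (octv_sym ad sad) (octv_sym bc sbc) (octv_sym bd sbd).
rewrite (minC (pos r)) (minC (pos r)) (minC (pos (- r))) (minC (pos (- r))).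
by rewrite [LHS](AC (4*(2*2)) ((3*4*1*2)*((5*7)*(6*8)))).
Qed.

Lemma oct_norm_cases (r s : R) :
  [\/ `|s| <= r, `|s| <= - r, `|r| <= s | `|r| <= - s].
Proof.
case: (leP `|s| `|r|) => h.
  by case: (ger0P r) h => _ h; [constructor 1|constructor 2].
by case: (ger0P s) h => _ /ltW h; [constructor 3|constructor 4].
Qed.

(** The symmetries of the labelling permute the four sectors into which the diagonals cut the
    square, so a claim compatible with them need only be checked in the sector belonging to [a]. *)
Lemma oct_wlog (P : 'I_4 -> 'I_4 -> 'I_4 -> 'I_4 -> R -> R -> Prop) :
  (forall a b c d r s, oct_labels a b c d -> `|s| <= r -> P a b c d r s) ->
  (forall a b c d r s, oct_labels a b c d -> P b a c d (- r) s -> P a b c d r s) ->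
  (forall a b c d r s, oct_labels a b c d -> P c d a b s r -> P a b c d r s) ->
  forall a b c d r s, oct_labels a b c d -> P a b c d r s.
Proof.
move=> h1 h2 h3 a b c d r s l; case: (oct_norm_cases r s) => h.
- exact: h1.
- by apply: h2 => //; apply: h1 => //; exact: oct_labels_ab.
- by apply: h3 => //; apply: h1 => //; exact: oct_labels_rot.
- apply: h3 => //; apply: h2; first exact: oct_labels_rot.
  by apply: h1 => //; apply: oct_labels_ab; exact: oct_labels_rot.
Qed.

Lemma posB (r : R) : pos r - pos (- r) = r.
Proof. by case: (leP 0 r) => h; [rewrite (posE h) pos0|rewrite (pos0 (ltW h)) posE]; lra. Qed.

Lemma posD (r : R) : pos r + pos (- r) = `|r|.
Proof. by case: (ger0P r) => h; [rewrite (posE h) pos0|rewrite (pos0 (ltW h)) posE]; lra. Qed.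

Lemma oct_edge_side a b c d r s : `|s| <= r ->
  oct_edge a b c d r s = (r - `|s|) *: octv a b + (pos s *: octv a c + pos (- s) *: octv a d).
Proof.
move=> h; have s0 := normr_ge0 s; have r0 : 0 <= r by lra.
have := posD s; have := pos_ge0 s; have := pos_ge0 (- s) => n0 p0 ps.
have h1 : s <= `|s| by exact: ler_norm.
have h2 : - s <= `|s| by rewrite -normrN; exact: ler_norm.
rewrite /oct_edge (ger0_norm r0) (posE r0) (@posE (r - `|s|)); last by lra.
rewrite (@pos0 (- r - `|s|)); last by lra.
rewrite (@pos0 (s - r)); last by lra.
rewrite (@pos0 (- s - r)); last by lra.
rewrite (@pos0 (- r)); last by lra.
rewrite (min_idPr _); last by lra.
rewrite (@min_idPr _ _ r (pos (- s)) _); last by lra.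
by rewrite !(min_idPl _)// !scale0r !addr0.
Qed.

Lemma oct_norm_side (r s : R) : `|s| <= r -> Num.max `|r| `|s| = r.
Proof.
move=> h; have r0 : 0 <= r by apply: le_trans h.
by rewrite (ger0_norm r0) (max_idPl _).
Qed.

Lemma octv_tetra u v : u != v -> tetra (octv u v).
Proof. by move=> uv; have [[]] := octv_interior uv. Qed.

Lemma octv_gt0 u v : u != v -> 0 < octv u v 0 u /\ 0 < octv u v 0 v.
Proof. by move=> uv; have [_] := octv_interior uv. Qed.

Lemma octv_0 u v i : i != u -> i != v -> octv u v 0 i = 0.
Proof. by move=> iu iv; rewrite /octv edge_point0. Qed.

Lemma oct_edge_ge0 a b c d r s i : oct_labels a b c d -> 0 <= oct_edge a b c d r s 0 i.
Proof.
move: a b c d r s; apply: oct_wlog => a b c d r s l.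
- move=> h; rewrite oct_edge_side// !rowD !rowZ.
  have [[ab ac ad] _] := uniq4_ne l.1.
  have := (octv_tetra ab).1 i; have := (octv_tetra ac).1 i; have := (octv_tetra ad).1 i.
  have := pos_ge0 s; have := pos_ge0 (- s) => p1 p2 h1 h2 h3.
  by rewrite !addr_ge0// mulr_ge0// subr_ge0.
- by rewrite (oct_edge_ab a b c d).
- by rewrite (oct_edge_rot _ _ l).
Qed.

Lemma oct_edge_sum a b c d r s : oct_labels a b c d ->
  \sum_i oct_edge a b c d r s 0 i = Num.max `|r| `|s|.
Proof.
move: a b c d r s; apply: oct_wlog => a b c d r s l.
- move=> h; rewrite oct_edge_side// oct_norm_side//.
  have [[ab ac ad] _] := uniq4_ne l.1.
  under eq_bigr do rewrite !rowD !rowZ.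
  rewrite !big_split -!mulr_sumr /= (octv_tetra ab).2 (octv_tetra ac).2 (octv_tetra ad).2.
  by rewrite !mulr1 posD subrK.
- by rewrite (oct_edge_ab a b c d) normrN.
- by rewrite (oct_edge_rot _ _ l) maxC.
Qed.

Lemma oct_edge_has0 a b c d r s : oct_labels a b c d ->
  exists i, oct_edge a b c d r s 0 i = 0.
Proof.
move: a b c d r s; apply: oct_wlog => a b c d r s l.
- move=> h; rewrite oct_edge_side//.
  have [[ba ca da] [cb db dc]] := uniq4_en l.1.
  have [_ [bc bd cd]] := uniq4_ne l.1.
  case: (leP 0 s) => s0.
    exists d; rewrite !rowD !rowZ (@pos0 (- s)); last by lra.
    by rewrite (octv_0 da db) (octv_0 da dc) !mulr0 mul0r !addr0.
  exists c; rewrite !rowD !rowZ (@pos0 s); last by lra.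
  by rewrite (octv_0 ca cb) (octv_0 ca cd) !mulr0 mul0r !addr0.
- by rewrite (oct_edge_ab a b c d).
- by rewrite (oct_edge_rot _ _ l).
Qed.

Notation lev := (level octw).

Lemma level_octv a b : a != b -> lev a (octv a b) = (t a).+1%:R.
Proof. by move=> ab; rewrite /octv level_edge_point. Qed.

Lemma level_octv_back a b : a != b -> same_side m a b -> lev a (octv b a) = (t a).+2%:R.
Proof.
move=> ab ss; have ba : b != a by rewrite eq_sym.
rewrite /octv (edge_point_sym _ octw_sym ba); last by rewrite /octw; lia.
rewrite level_edge_point//; congr (_%:R); rewrite /octw same_sideC ss; lia.
Qed.

Lemma level_octv_far a u v : a != u -> a != v -> u != v -> (t a).+2%:R <= lev a (octv u v).
Proof.
move=> au av uv; apply: level_low; first exact: octv_tetra.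
  exact: octv_0.
by move=> x _ _; rewrite /octw; case: ifP; lia.
Qed.

(** All eight points have level at least [t a + 1] about [a], with equality only for the first
    crossings on the three edges at [a]; the others exceed it by at least 1. The excess [N - pos r]
    lets the sector be recognised from the image. *)
Lemma level_oct_edge a b c d r s : oct_labels a b c d ->
  let N := Num.max `|r| `|s| in
  (t a).+1%:R * N + (N - pos r) <= lev a (oct_edge a b c d r s).
Proof.
move=> l /=; have [u ss] := l; have [[ab ac ad] [bc bd cd]] := uniq4_ne u.
have [[ba ca da] [cb db dc]] := uniq4_en u.
have [_ sac sad sbc sbd] := same_side_uniq u ss.
have lb : oct_labels b a c d by exact: oct_labels_ab.
have lc : oct_labels c d a b by exact: oct_labels_rot.
have ld : oct_labels d c a b by exact: oct_labels_ab.
have S2 : (t a).+2%:R = (t a).+1%:R + 1 :> R by rewrite -natr1.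
have fbc := level_octv_far ab ac bc; have fbd := level_octv_far ab ad bd.
have fcd := level_octv_far ac ad cd; have fdc := level_octv_far ad ac dc.
have fcb := level_octv_far ac ab cb; have fdb := level_octv_far ad ab db.
have eba := level_octv_back ab ss.
have eca : lev a (octv c a) = (t a).+1%:R by rewrite -octv_sym// level_octv.
have eda : lev a (octv d a) = (t a).+1%:R by rewrite -octv_sym// level_octv.
rewrite S2 in fbc fbd fcd fdc fcb fdb eba; set k := (t a).+1%:R in fbc fbd fcd fdc fcb fdb eba eca eda *.
have le2 (x y z : R) : 0 <= x -> y <= z -> x * y <= x * z by move=> *; exact: ler_wpM2l.
have ps := pos_ge0 s; have pns := pos_ge0 (- s); have pr := pos_ge0 r; have pnr := pos_ge0 (- r).
have Ds := posD s; have Dr := posD r.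
case: (oct_norm_cases r s) => h.
- rewrite oct_edge_side// oct_norm_side// !levelD !levelZ !level_octv// -/k.
  rewrite posE; last by apply: le_trans h.
  by rewrite subrr addr0 -mulrDl -mulrDl Ds subrK mulrC.
- rewrite (oct_edge_ab a b c d) oct_edge_side// -(normrN r) oct_norm_side// !levelD !levelZ eba.
  rewrite (@pos0 r); last by rewrite -oppr_ge0; apply: le_trans h.
  have h0 : 0 <= - r - `|s| by rewrite subr_ge0.
  have := le2 _ _ _ ps fbc; have := le2 _ _ _ pns fbd; move: Ds; clear -h0; nra.
- rewrite (oct_edge_rot _ _ l) oct_edge_side// maxC oct_norm_side// !levelD !levelZ eca.
  have h0 : 0 <= s - `|r| by rewrite subr_ge0.
  have := le2 _ _ _ h0 fcd; have := le2 _ _ _ pnr fcb; move: Dr; clear; nra.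
- rewrite (oct_edge_rot _ _ l) (oct_edge_ab c d a b) oct_edge_side// maxC -(normrN s) oct_norm_side//.
  rewrite !levelD !levelZ eda.
  have h0 : 0 <= - s - `|r| by rewrite subr_ge0.
  have := le2 _ _ _ h0 fdc; have := le2 _ _ _ pnr fdb; move: Dr; clear; nra.
Qed.

Lemma oct_edge_inj a b c d r s r' s' : oct_labels a b c d ->
  Num.max `|r| `|s| = Num.max `|r'| `|s'| ->
  oct_edge a b c d r s = oct_edge a b c d r' s' -> r = r' /\ s = s'.
Proof.
move=> l; move: r' s'; move: a b c d r s l.
apply: oct_wlog => a b c d r s l.
- move=> h r' s' eN e; have [u ss] := l; have [[ab ac ad] [bc bd cd]] := uniq4_ne u.
  have [[ba ca da] [cb db dc]] := uniq4_en u.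
  have Nr := oct_norm_side h; rewrite Nr in eN.
  have r0 : 0 <= r by apply: le_trans h.
  (* In the sector of [a] the level is exactly [t a + 1] times the radius, so the lower bound for
     the other point forces it into the same sector. *)
  have rr : pos r' = r /\ `|s'| <= r.
    have := level_oct_edge r' s' l; rewrite /= -eN -e oct_edge_side// !levelD !levelZ !level_octv//.
    rewrite -!mulrDl posD subrK mulrC.
    have h1 : `|r'| <= r by rewrite eN le_max lexx.
    have h2 : `|s'| <= r by rewrite eN le_max lexx orbT.
    have h3 : r' <= `|r'| by exact: ler_norm.
    have h4 : pos r' <= `|r'| by rewrite -posD lerDl pos_ge0.
    move: h1 h2 h3 h4; clear; split=> //; lra.
  have r'r : r' = r.
    have [pr h2] := rr; case: (leP 0 r') => r'0; first by rewrite -pr posE.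
    move: pr; rewrite pos0 ?(ltW r'0)// => r00.
    have : `|r'| <= r by rewrite eN le_max lexx.
    by rewrite -r00 normr_le0 => /eqP.
  move: rr => [_ s'r]; rewrite r'r in e *; split=> //.
  rewrite !oct_edge_side// in e.
  have vc := (octv_gt0 ac).2; have vd := (octv_gt0 ad).2.
  have ec : pos s = pos s'.
    apply: (mulIf (lt0r_neq0 vc)).
    move/rowP/(_ c): e; rewrite !rowD !rowZ (octv_0 ca cb) (octv_0 ca cd).
    by rewrite !mulr0 !addr0 !add0r.
  have ed : pos (- s) = pos (- s').
    apply: (mulIf (lt0r_neq0 vd)).
    move/rowP/(_ d): e; rewrite !rowD !rowZ (octv_0 da db) (octv_0 da dc).
    by rewrite !mulr0 !add0r.
  by rewrite -(posB s) -(posB s') ec ed.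
- move=> H r' s'; rewrite !(oct_edge_ab a b c d) -(normrN r) -(normrN r') => e1 e2.
  by have [/oppr_inj -> ->] := H _ _ e1 e2.
- move=> H r' s'; rewrite !(oct_edge_rot _ _ l) (maxC `|r|) (maxC `|r'|) => e1 e2.
  by have [-> ->] := H _ _ e1 e2.
Qed.

Lemma oct_centre_gt0 a b c d i : oct_labels a b c d -> 0 < oct_centre a b c d 0 i.
Proof.
move=> l; have [u ss] := l; have [[ab ac ad] [bc bd cd]] := uniq4_ne u.
have [[ba ca da] [cb db dc]] := uniq4_en u.
have nn x y : x != y -> 0 <= octv x y 0 i by move=> xy; exact: (octv_tetra xy).1.
have hab := nn a b ab; have hba := nn b a ba; have hcd := nn c d cd; have hdc := nn d c dc.
rewrite rowZ !rowD mulr_gt0//.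
case: (uniq4_cases i u) => E.
- by rewrite ltr_pwDl ?addr_ge0// ltr_pwDl// E (octv_gt0 ab).1.
- by rewrite ltr_pwDl ?addr_ge0// ltr_pwDl// E (octv_gt0 ab).2.
- by rewrite ltr_wpDl ?addr_ge0// ltr_pwDl// E (octv_gt0 cd).1.
- by rewrite ltr_wpDl ?addr_ge0// ltr_pwDl// E (octv_gt0 cd).2.
Qed.

Lemma oct_centre_sum a b c d : oct_labels a b c d -> \sum_i oct_centre a b c d 0 i = 1.
Proof.
move=> [u _]; have [[ab _ _] [_ _ cd]] := uniq4_ne u.
have [[ba _ _] [_ _ dc]] := uniq4_en u.
under eq_bigr do rewrite rowZ !rowD.
rewrite -mulr_sumr !big_split /= (octv_tetra ab).2 (octv_tetra ba).2 (octv_tetra cd).2.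
by rewrite (octv_tetra dc).2; lra.
Qed.

Lemma oct_point_row a b c d r s i : oct_point a b c d r s 0 i =
  (1 - Num.max `|r| `|s|) * oct_centre a b c d 0 i + oct_edge a b c d r s 0 i.
Proof. by rewrite rowD rowZ. Qed.

Definition oct_set a b c d : set 'rV[R]_4 :=
  [set x | exists r s, Num.max `|r| `|s| <= 1 /\ x = oct_point a b c d r s].

Lemma oct_point_tetra a b c d r s : oct_labels a b c d -> Num.max `|r| `|s| <= 1 ->
  tetra (oct_point a b c d r s).
Proof.
move=> l N1; split=> [i|].
  by rewrite oct_point_row addr_ge0 ?oct_edge_ge0// mulr_ge0 ?subr_ge0// ltW// oct_centre_gt0.
under eq_bigr do rewrite oct_point_row.
by rewrite big_split -mulr_sumr /= oct_centre_sum// oct_edge_sum// mulr1 subrK.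
Qed.

Lemma oct_point_zero a b c d r s i : oct_labels a b c d -> Num.max `|r| `|s| <= 1 ->
  oct_point a b c d r s 0 i = 0 -> Num.max `|r| `|s| = 1 /\ oct_edge a b c d r s 0 i = 0.
Proof.
move=> l N1; rewrite oct_point_row => /eqP.
have O0 := oct_centre_gt0 i l.
rewrite paddr_eq0 ?oct_edge_ge0//; last by rewrite mulr_ge0 ?subr_ge0// ltW.
by rewrite mulf_eq0 (gt_eqF O0) orbF subr_eq0 eq_sym => /andP[/eqP-> /eqP->].
Qed.

Lemma oct_point_inj a b c d r s r' s' : oct_labels a b c d ->
  Num.max `|r| `|s| <= 1 -> Num.max `|r'| `|s'| <= 1 ->
  oct_point a b c d r s = oct_point a b c d r' s' -> r = r' /\ s = s'.
Proof.
move=> l N1 N1' e.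
(* A coordinate that vanishes on the base part of the first point comes from the centre alone;
   comparing it in both points compares their radii. *)
have le12 r1 s1 r2 s2 : oct_point a b c d r1 s1 = oct_point a b c d r2 s2 ->
    Num.max `|r1| `|s1| <= Num.max `|r2| `|s2|.
  move=> E; have [i ei] := oct_edge_has0 r1 s1 l.
  have O0 := oct_centre_gt0 i l.
  move/rowP/(_ i): E; rewrite !oct_point_row ei addr0 => E.
  have := oct_edge_ge0 r2 s2 i l.
  have : (1 - Num.max `|r2| `|s2|) * oct_centre a b c d 0 i <=
         (1 - Num.max `|r1| `|s1|) * oct_centre a b c d 0 i.
    by rewrite E lerDl oct_edge_ge0.
  by rewrite ler_pM2r// lerD2l lerN2.
have eN : Num.max `|r| `|s| = Num.max `|r'| `|s'|.
  by apply/le_anti; rewrite !le12.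
apply: (oct_edge_inj l eN); move: e; rewrite /oct_point eN; exact: addrI.
Qed.

Lemma oct_disc a b c d : oct_labels a b c d -> properly_embedded_disc (oct_set a b c d).
Proof.
move=> l; exists (fun y => oct_point a b c d (y 0 ord0) (y 0 ord_max)); split.
- apply: within_continuous_row => i; apply: continuous_subspaceT.
  have c0 : continuous (fun y : 'rV[R]_2 => y 0 ord0) by exact: coord_continuous.
  have c1 : continuous (fun y : 'rV[R]_2 => y 0 ord_max) by exact: coord_continuous.
  have cn (f : 'rV[R]_2 -> R) : continuous f -> continuous (fun y => `|f y|).
    by move=> cf y; exact: (cvg_norm (cf y)).
  have cN (f : 'rV[R]_2 -> R) : continuous f -> continuous (fun y => - f y).
    by move=> cf y; exact: (cvgN (cf y)).
  have cp (f : 'rV[R]_2 -> R) : continuous f -> continuous (fun y => pos (f y)).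
    by move=> cf; apply: continuous_maxr => //; exact: continuous_cstr.
  have cB := @continuousBr R 'rV[R]_2; have cM := @continuousMr R 'rV[R]_2.
  have cD := @continuousDr R 'rV[R]_2; have cc := @continuous_cstr R 'rV[R]_2.
  have cm := @continuous_minr R 'rV[R]_2; have cx := @continuous_maxr R 'rV[R]_2.
  rewrite (_ : (fun x => _) = (fun y : 'rV[R]_2 =>
    (1 - Num.max `|y 0 ord0| `|y 0 ord_max|) * oct_centre a b c d 0 i +
    oct_edge a b c d (y 0 ord0) (y 0 ord_max) 0 i)); last first.
    by apply/funext => y; rewrite oct_point_row.
  refine (cD _ _ (cM _ _ (cB _ _ (cc 1) (cx _ _ (cn _ c0) (cn _ c1))) (cc _)) _).
  have c1N := cN _ c1; have c0N := cN _ c0; have c1n := cn _ c1; have c0n := cn _ c0.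
  rewrite [X in continuous X](_ : _ = (fun y : 'rV[R]_2 =>
    pos (y 0 ord0 - `|y 0 ord_max|) * octv a b 0 i + pos (- y 0 ord0 - `|y 0 ord_max|) * octv b a 0 i +
    pos (y 0 ord_max - `|y 0 ord0|) * octv c d 0 i + pos (- y 0 ord_max - `|y 0 ord0|) * octv d c 0 i +
    (Num.min (pos (y 0 ord0)) (pos (y 0 ord_max)) * octv a c 0 i +
     Num.min (pos (y 0 ord0)) (pos (- y 0 ord_max)) * octv a d 0 i +
     (Num.min (pos (- y 0 ord0)) (pos (y 0 ord_max)) * octv b c 0 i +
      Num.min (pos (- y 0 ord0)) (pos (- y 0 ord_max)) * octv b d 0 i)))); last first.
    by apply/funext => y; exact: oct_edge_row.
  have cMc (f : 'rV[R]_2 -> R) k : continuous f -> continuous (fun y => f y * k).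
    by move=> cf; exact: (cM _ _ cf (cc k)).
  refine (cD _ _ (cD _ _ (cD _ _ (cD _ _ _ _) _) _) (cD _ _ (cD _ _ _ _) (cD _ _ _ _)));
    apply: (cMc).
  + by apply: cp; exact: (cB _ _ c0 c1n).
  + by apply: cp; exact: (cB _ _ c0N c1n).
  + by apply: cp; exact: (cB _ _ c1 c0n).
  + by apply: cp; exact: (cB _ _ c1N c0n).
  + exact: (cm _ _ (cp _ c0) (cp _ c1)).
  + exact: (cm _ _ (cp _ c0) (cp _ c1N)).
  + exact: (cm _ _ (cp _ c0N) (cp _ c1)).
  + exact: (cm _ _ (cp _ c0N) (cp _ c1N)).
- move=> y y' /set_mem y1 /set_mem y1' e.
  rewrite /ball_set /= norm2E in y1; rewrite /ball_set /= norm2E in y1'.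
  have [e1 e2] := oct_point_inj l y1 y1' e.
  by rewrite (row2_eta y) (row2_eta y') e1 e2.
- apply/seteqP; split=> [x [r [s [N1 ->]]]|_ [y y1 <-]].
    by exists (row2 r s); rewrite /ball_set /= ?norm2E !row2E.
  by exists (y 0 ord0), (y 0 ord_max); split=> //; rewrite -norm2E.
- by move=> x [r [s [N1 ->]]]; exact: oct_point_tetra.
- apply/seteqP; split=> [x [[r [s [N1 ->]]] [i _ [_ xi]]]|_ [y y1 <-]].
    exists (row2 r s); last by rewrite !row2E.
    by rewrite /sphere_set /= norm2E !row2E; have [] := oct_point_zero l N1 xi.
  rewrite /sphere_set /= norm2E in y1; split.
    by exists (y 0 ord0), (y 0 ord_max); split=> //; rewrite y1.
  have [i hi] := oct_edge_has0 (y 0 ord0) (y 0 ord_max) l; exists i => //.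
  split; first by apply: oct_point_tetra => //; rewrite y1.
  by rewrite oct_point_row y1 subrr mul0r add0r.
Qed.

(** Keeps the octagon away from the triangles at [a], whose levels are at most [t a]. *)
Lemma level_oct_point a b c d x : oct_labels a b c d -> oct_set a b c d x ->
  (t a).+1%:R <= lev a x.
Proof.
move=> l [r [s [N1 ->]]]; have [u ss] := l.
have [[ab ac ad] [bc bd cd]] := uniq4_ne u; have [[ba ca da] [cb db dc]] := uniq4_en u.
rewrite /oct_point levelD levelZ.
have := level_oct_edge r s l.
have : (t a).+1%:R <= lev a (oct_centre a b c d).
  rewrite /oct_centre levelZ !levelD level_octv// level_octv_back//.
  have := level_octv_far ac ad cd; have := level_octv_far ad ac dc.
  rewrite -!(natr1 (t a).+1); lra.
have : pos r <= Num.max `|r| `|s| by rewrite le_max -posD lerDl pos_ge0.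
move: N1; rewrite /=; move: (Num.max _ _) (lev a _) (lev a _) (pos r) (t a).+1%:R => N x1 x2 p k.
nra.
Qed.

Lemma level_oct_side a b c d r s : oct_labels a b c d -> `|s| <= r ->
  lev a (oct_edge a b c d r s) = (t a).+1%:R * r.
Proof.
move=> l h; have [[ab ac ad] _] := uniq4_ne l.1.
by rewrite oct_edge_side// !levelD !levelZ !level_octv// -!mulrDl posD subrK mulrC.
Qed.

Lemma oct_point1 a b c d r s : Num.max `|r| `|s| = 1 ->
  oct_point a b c d r s = oct_edge a b c d r s.
Proof. by move=> N1; rewrite /oct_point N1 subrr scale0r add0r. Qed.

(** A point of the octagon in a face has radius 1. In the sector of [a] the coordinate [a] would be
    positive. In the sector of [b] only [octv b a] contributes to that coordinate, so its
    coefficient vanishes and the point is a corner shared with the sector of [c] or [d]. Those two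
    sectors are the two arcs. *)
Lemma oct_trace a b c d x : oct_labels a b c d -> face a x ->
  oct_set a b c d x <-> lev c x = (t c).+1%:R \/ lev d x = (t d).+1%:R.
Proof.
move=> l fx; have [u ss] := l.
have [[ab ac ad] [bc bd cd]] := uniq4_ne u; have [[ba ca da] [cb db dc]] := uniq4_en u.
have lc := oct_labels_rot l; have ld := oct_labels_ab lc.
split.
- move=> [r [s [N1 xE]]]; have [_ xa] := fx.
  rewrite xE in xa; have [eN ea] := oct_point_zero l N1 xa.
  have fc : `|r| <= s -> lev c x = (t c).+1%:R.
    move=> h; rewrite xE oct_point1// (oct_edge_rot _ _ l) level_oct_side//.
    by rewrite maxC oct_norm_side// in eN; rewrite eN mulr1.
  have fd : `|r| <= - s -> lev d x = (t d).+1%:R.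
    move=> h; rewrite xE oct_point1// (oct_edge_rot _ _ l) (oct_edge_ab c d a b) level_oct_side//.
    by rewrite maxC -(normrN s) oct_norm_side// in eN; rewrite eN mulr1.
  case: (oct_norm_cases r s) => h; [|suff : r = - `|s| |by left; exact: fc|by right; exact: fd].
  + have r1 : r = 1 by rewrite -eN oct_norm_side.
    have p1 := pos_ge0 s; have p2 := pos_ge0 (- s); have Ds := posD s.
    have q0 : 0 <= r - `|s| by rewrite subr_ge0.
    have := (octv_gt0 ab).1; have := (octv_gt0 ac).1; have := (octv_gt0 ad).1.
    move: ea; rewrite oct_edge_side// !rowD !rowZ => ea v1 v2 v3; exfalso.
    have z1 : 0 <= (r - `|s|) * octv a b 0 a by rewrite mulr_ge0// ltW.
    have z2 : 0 <= pos s * octv a c 0 a by rewrite mulr_ge0// ltW.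
    have z3 : 0 <= pos (- s) * octv a d 0 a by rewrite mulr_ge0// ltW.
    have nn (x1 x2 x3 : R) : 0 <= x1 -> 0 <= x2 -> 0 <= x3 -> x1 + (x2 + x3) = 0 ->
        [/\ x1 = 0, x2 = 0 & x3 = 0].
      by clear=> h1 h2 h3 h4; split; lra.
    have [e1 e2 e3] := nn _ _ _ z1 z2 z3 ea.
    have nz (k v : R) : 0 < v -> k * v = 0 -> k = 0.
      by move=> v0 /eqP; rewrite mulf_eq0 (gt_eqF v0) orbF => /eqP.
    move: (nz _ _ v3 e1) (nz _ _ v2 e2) (nz _ _ v1 e3) Ds; rewrite r1; clear; lra.
  + move=> rs; case: (ger0P s) => s0.
      by left; apply: fc; rewrite rs normrN normr_id ger0_norm.
    by right; apply: fd; rewrite rs normrN normr_id ltr0_norm.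
  + move: ea; rewrite (oct_edge_ab a b c d) oct_edge_side// !rowD !rowZ.
    rewrite (octv_0 ab ac) (octv_0 ab ad) !mulr0 !addr0 => /eqP.
    by rewrite mulf_eq0 (gt_eqF (octv_gt0 ba).2) orbF subr_eq0 => /eqP <-; rewrite opprK.
- have I (y : R) : 0 <= y <= 1 -> `|- y| <= 1 /\ pos (- - y) = y /\ pos (- y) = 0.
    move=> /andP[y0 y1]; rewrite normrN ger0_norm// opprK posE// pos0//.
    by rewrite oppr_le0.
  have uc : uniq [:: a; c; d; b] by rewrite uniq4_swap34 uniq4_swap23.
  have ud : uniq [:: a; d; c; b] by rewrite uniq4_swap34 uniq4_swap23 uniq4_swap34.
  case=> lx.
  + have [y y01 ->] := corner_segment uc (ltn0Sn _) fx lx; have [h1 [h2 h3]] := I y y01.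
    have N1 : Num.max `|- y| `|1 : R| = 1 by rewrite normr1 (max_idPr _).
    exists (- y), 1; split; first by rewrite N1.
    rewrite oct_point1// (oct_edge_rot _ _ l) oct_edge_side// h2 h3 scale0r add0r.
    by rewrite normrN ger0_norm//; case/andP: y01.
  + have [y y01 ->] := corner_segment ud (ltn0Sn _) fx lx; have [h1 [h2 h3]] := I y y01.
    have N1 : Num.max `|- y| `|-1 : R| = 1 by rewrite (normrN 1) normr1 (max_idPr _).
    exists (- y), (-1); split; first by rewrite N1.
    rewrite oct_point1// (oct_edge_rot _ _ l) (oct_edge_ab c d a b) opprK oct_edge_side//.
    by rewrite h2 h3 scale0r add0r normrN ger0_norm//; case/andP: y01.
Qed.

Lemma oct_set_ab a b c d : oct_set a b c d = oct_set b a c d.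
Proof.
have sub x y : oct_set x y c d `<=` oct_set y x c d.
  move=> z [r [s [N1 ->]]]; exists (- r); exists s; rewrite normrN; split; first exact: N1.
  have e : oct_centre x y c d = oct_centre y x c d by rewrite /oct_centre (addrC (octv x y)).
  by rewrite /oct_point normrN (oct_edge_ab x y c d) e.
by apply/seteqP; split.
Qed.

Lemma oct_set_cd a b c d : oct_set a b c d = oct_set a b d c.
Proof.
have sub x y : oct_set a b x y `<=` oct_set a b y x.
  move=> z [r [s [N1 ->]]]; exists r; exists (- s); rewrite normrN; split; first exact: N1.
  have e : oct_centre a b x y = oct_centre a b y x by rewrite /oct_centre (addrC (octv x y)).
  by rewrite /oct_point normrN (oct_edge_cd a b x y) e.
by apply/seteqP; split.
Qed.

Lemma oct_set_rot a b c d : oct_labels a b c d -> oct_set a b c d = oct_set c d a b.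
Proof.
have sub x y z w : oct_labels x y z w -> oct_set x y z w `<=` oct_set z w x y.
  move=> l p [r [s [N1 ->]]]; exists s; exists r; rewrite maxC; split; first exact: N1.
  have e : oct_centre x y z w = oct_centre z w x y by rewrite /oct_centre (addrC (octv x y + _)).
  by rewrite /oct_point maxC (oct_edge_rot _ _ l) e.
by move=> l; apply/seteqP; split; apply: sub => //; exact: oct_labels_rot.
Qed.

Lemma oct_set_labels a b c d a' b' c' d' : oct_labels a b c d ->
  oct_labels a' b' c' d' -> oct_set a b c d = oct_set a' b' c' d'.
Proof.
have same a1 b1 c1 d1 b2 c2 d2 : oct_labels a1 b1 c1 d1 -> oct_labels a1 b2 c2 d2 ->
    oct_set a1 b1 c1 d1 = oct_set a1 b2 c2 d2.
  move=> [u s] [u' s']; have [_ sc sd _ _] := same_side_uniq u s.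
  have [[_ ac ad] [bc bd cd]] := uniq4_ne u'; have [[ab _ _] _] := uniq4_en u'.
  have b21 : b2 = b1.
    case: (uniq4_cases b2 u) => E //.
    - by rewrite E eqxx in ab.
    - by rewrite E sc in s'.
    - by rewrite E sd in s'.
  have [[ec ed]|[ec ed]] : (c2 = c1 /\ d2 = d1) \/ (c2 = d1 /\ d2 = c1).
    rewrite b21 in bc bd.
    case: (uniq4_cases c2 u) => Ec; rewrite Ec ?eqxx // in ac bc cd *;
    by case: (uniq4_cases d2 u) => Ed; rewrite Ed ?eqxx // in ad bd cd *; first [by left | by right].
  - by rewrite b21 ec ed.
  - by rewrite b21 ec ed oct_set_cd.
move=> l l'; have lb := oct_labels_ab l; have lc := oct_labels_rot l; have ld := oct_labels_ab lc.
case: (uniq4_cases a' l.1) => E; rewrite E in l' *.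
- exact: (same _ _ _ _ _ _ _ l l').
- rewrite (oct_set_ab a b); exact: (same _ _ _ _ _ _ _ lb l').
- rewrite (oct_set_rot l); exact: (same _ _ _ _ _ _ _ lc l').
- rewrite (oct_set_rot l) (oct_set_ab c d); exact: (same _ _ _ _ _ _ _ ld l').
Qed.

End Octagon.

Lemma card_uniq_seq (U : choiceType) (A : set U) (s : seq U) : uniq s ->
  (forall x, A x <-> x \in s) -> (A #= `I_(size s))%card.
Proof.
move=> us As.
have -> : A = [set` [fset x | x in s]%fset].
  by apply/seteqP; split=> x /=; rewrite !inE /= => /As.
by apply/card_eq_fsetP; rewrite card_fseq undup_id.
Qed.

(** * Normal pieces recognised by their traces in the faces *)

Section Traces.
Variables (R : realType) (W : 'I_4 -> 'I_4 -> nat) (nc : 'I_4 -> 'I_4 -> nat).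
Hypothesis Wsym : forall u v, W u v = W v u.
Hypothesis Wnc : forall a b c, uniq [:: a; b; c] -> W b c = (nc a b + nc a c)%N.
Notation lev := (level W).

Lemma uniq4_uniq3 (a b c d : 'I_4) : uniq [:: a; b; c; d] -> uniq [:: a; b; c].
Proof.
by move=> u; have [[ab ac _] [bc _ _]] := uniq4_ne u; rewrite /= !inE !negb_or ab ac bc.
Qed.

(** The sum of the two levels is an average of [W b c + 1] and [W b d + W c d + 2], both of which
    exceed [k + l]. *)
Lemma corners_disjoint a b c d k l (x : 'rV[R]_4) : uniq [:: a; b; c; d] ->
  (k <= nc a b)%N -> (l <= nc a c)%N ->
  face a x -> lev b x = k%:R -> lev c x = l%:R -> False.
Proof.
move=> u kb lc [tx xa] lb lcx.
have ub : uniq [:: c; b; a; d] by rewrite uniq4_swap12 uniq4_swap23 uniq4_swap12.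
have uc : uniq [:: b; c; a; d] by rewrite uniq4_swap12.
have ud : uniq [:: a; d; b] /\ uniq [:: a; d; c].
  have u1 : uniq [:: a; d; b; c] by rewrite uniq4_swap23 uniq4_swap34.
  by split; [exact: uniq4_uniq3 u1|apply: (@uniq4_uniq3 a d c b); rewrite uniq4_swap34].
have := tetra_sum4 u tx.
move: lb lcx; rewrite (levelE _ _ ub) (levelE _ _ uc) xa !mulr0 !addr0 add0r (Wsym c b).
have hb := tx.1 b; have hc := tx.1 c; have hd := tx.1 d.
have e1 := Wnc (uniq4_uniq3 u); have e2 := Wnc ud.1; have e3 := Wnc ud.2.
have kl : (k + l)%N%:R + 1 <= (W b c).+1%:R :> R by rewrite natr1 ler_nat e1; clear -kb lc; lia.
have kd : (k + l)%N%:R + 1 <= (W b d).+1%:R + (W c d).+1%:R :> R.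
  by rewrite natr1 -natrD ler_nat !(Wsym _ d) e2 e3; clear -kb lc; lia.
move: kl kd; rewrite natrD; move: (W b c).+1%:R (W b d).+1%:R (W c d).+1%:R => p q r.
move: (x 0 b) (x 0 c) (x 0 d) k%:R l%:R hb hc hd => xb xc xd k' l'; clear.
move=> hb hc hd e1 e2 s h1 h2.
have p1 : 0 <= (p - (k' + l' + 1)) * (xb + xc) by apply: mulr_ge0; [rewrite subr_ge0|exact: addr_ge0].
have p2 : 0 <= (q + r - (k' + l' + 1)) * xd by apply: mulr_ge0; rewrite // subr_ge0.
by move: p1 p2; nra.
Qed.

Lemma corner_edge a b c d k (x : 'rV[R]_4) : uniq [:: a; b; c; d] ->
  (0 < k)%N -> (k <= nc a d)%N -> edge b c x -> lev d x = k%:R -> False.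
Proof.
move=> u k0 kd [tx x0].
have [[ab ac ad] [bc bd cd]] := uniq4_ne u; have [[ba ca da] [cb db dc]] := uniq4_en u.
have u1 : uniq [:: a; d; b; c] by rewrite uniq4_swap23 uniq4_swap34.
have e1 := Wnc (uniq4_uniq3 u1).
have e2 : W d c = (nc a d + nc a c)%N.
  by apply: Wnc; apply: (@uniq4_uniq3 a d c b); rewrite uniq4_swap34.
have := @level_low R W d x k tx (x0 d db dc) _.
move=> h lx; have /h : forall v, v != d -> x 0 v != 0 -> (k < (W d v).+1)%N.
  move=> v vd; case: (uniq4_cases v u) => E; rewrite E in vd *.
  - by rewrite (x0 a)// eqxx.
  - by rewrite e1 ltnS => _; apply: leq_trans kd _; rewrite leq_addr.
  - by rewrite e2 ltnS => _; apply: leq_trans kd _; rewrite leq_addr.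
  - by rewrite eqxx in vd.
by rewrite lx ler_nat ltnn.
Qed.

Lemma edge_in_face a b c (x : 'rV[R]_4) : a != b -> a != c -> edge b c x -> face a x.
Proof. by move=> ab ac [tx x0]; split=> //; exact: x0. Qed.

(** [tr a b] is the level of the arc about [b] in the face opposite [a], and 0 if there is none. The
    arcs are then level segments, kept apart by [corners_disjoint], and the points on [bc] are the
    ends of the arcs about [b] and [c] in one face containing [bc]. *)
Lemma normal_piece_trace ty (D : set 'rV[R]_4) (tr : 'I_4 -> 'I_4 -> nat) :
  properly_embedded_disc D ->
  (forall a b, b != a -> (tr a b <= nc a b)%N) ->
  (forall a x, face a x ->
    (D x <-> exists b, [/\ b != a, (0 < tr a b)%N & lev b x = (tr a b)%:R])) ->
  (forall a b c d, uniq [:: a; b; c; d] ->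
    ((0 < tr a b) + (0 < tr a c) + (0 < tr a d))%N = face_arcs ty a) ->
  (forall a b c d, uniq [:: a; b; c; d] ->
    ((0 < tr a b) + (0 < tr a c))%N = edge_weight ty b c) ->
  normal_piece ty D.
Proof.
move=> dD trle trD trF trE; split=> //.
- move=> a; pose s := [seq b <- enum 'I_4 | (b != a) && (0 < tr a b)%N].
  have us : uniq s by rewrite filter_uniq// enum_uniq.
  have ss : size s = face_arcs ty a.
    have [b [c [d [u _]]]] := side_partner ord0 a.
    have [[ba ca da] _] := uniq4_en u.
    rewrite -(trF _ _ _ _ u) size_filter -sum1_count big_enum_cond /= big_mkcond /=.
    by rewrite (big_uniq4 _ u) eqxx ba ca da /=; do 3!case: (0 < _)%N.
  pose b (l : 'I_(face_arcs ty a)) := nth a s l.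
  have bs l : b l \in s by rewrite mem_nth// ss.
  have bl l : (b l != a) && (0 < tr a (b l))%N by have := bs l; rewrite mem_filter => /andP[].
  have frees l : exists c d, uniq [:: a; b l; c; d].
    by apply: two_more; rewrite eq_sym; case/andP: (bl l).
  exists (fun l => [set x | face a x /\ lev (b l) x = (tr a (b l))%:R]); split.
  + move=> l; have [c [d u]] := frees l; have /andP[ba l0] := bl l.
    have e1 := Wnc (uniq4_uniq3 u).
    have e2 : W (b l) d = (nc a (b l) + nc a d)%N.
      by apply: Wnc; apply: (@uniq4_uniq3 a (b l) d c); rewrite uniq4_swap34.
    have tl := trle _ _ ba.
    by refine (@corner_arc_normal R W _ _ _ _ _ u l0 _ _); rewrite ?e1 ?e2; apply: leq_trans tl _; rewrite leq_addr.
  + apply/trivIsetP => l l' _ _ ll'; apply/seteqP; split=> // x [[fx h1] [_ h2]].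
    have bb : b l != b l' by rewrite nth_uniq ?ss// -val_eqE in ll' *.
    have /andP[ba _] := bl l; have /andP[ba' _] := bl l'.
    have [|d u] := @one_more a (b l) (b l').
      by rewrite /= !inE !negb_or bb !(eq_sym a) ba ba'.
    exact: (corners_disjoint u (trle _ _ ba) (trle _ _ ba') fx h1 h2).
  + apply/seteqP; split=> [x [Dx fx]|x [l _ [fx lx]]].
      have [c [ca c0 lx]] := (trD a x fx).1 Dx.
      have cs : c \in s by rewrite mem_filter ca c0 mem_enum.
      have il : (index c s < face_arcs ty a)%N by rewrite -ss index_mem.
      by exists (Ordinal il) => //=; rewrite /b /= nth_index.
    have /andP[ba l0] := bl l.
    by split=> //; apply/(trD a x fx); exists (b l).
- move=> b c bc; have [a [d u']] := two_more bc.
  have u : uniq [:: a; b; c; d] by rewrite uniq4_swap12 uniq4_swap23.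
  have [[ab ac ad] [_ bd cd]] := uniq4_ne u; have [[ba ca da] [cb db dc]] := uniq4_en u.
  have e := Wnc (uniq4_uniq3 u).
  have tb := trle _ _ ba; have tc := trle _ _ ca.
  pose P k := edge_point R W b c k.
  have Pe k : (k <= W b c)%N -> edge b c (P k).
    by move=> kW; apply: edge_point_edge => //; exact: leqW.
  have Pinj k l : P k = P l -> k = l.
    move=> /(congr1 (lev b)); rewrite !level_edge_point// => /eqP.
    by rewrite eqr_nat => /eqP.
  (* Crossings on [bc] are numbered from [b]; the one with number [tr a c] from [c] has the
     complementary number. *)
  pose k1 := tr a b; pose k2 := ((W b c).+1 - tr a c)%N.
  have k2E : P k2 = edge_point R W c b (tr a c).
    rewrite /P (edge_point_sym _ Wsym bc) /k2; last by rewrite leq_subr.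
    by rewrite subKn// e; clear -tc; lia.
  have k12 : (k1 < k2)%N by rewrite /k1 /k2 e; clear -tb tc; lia.
  pose s := (if (0 < tr a b)%N then [:: P k1] else [::]) ++
            (if (0 < tr a c)%N then [:: P k2] else [::]).
  have -> : edge_weight ty b c = size s.
    by rewrite -(trE _ _ _ _ u) /s; do 2!case: (0 < _)%N.
  apply: card_uniq_seq.
    rewrite /s; do 2!case: (0 < _)%N => //=; rewrite inE andbT.
    by apply/negP => /eqP/Pinj k; rewrite k ltnn in k12.
  have sE x : x \in s <-> ((0 < tr a b)%N /\ x = P k1) \/ ((0 < tr a c)%N /\ x = P k2).
    rewrite /s mem_cat; do 2!case: (0 < _)%N => /=; rewrite ?inE ?orbF; split.
    - by case/orP => /eqP ->; [left|right].
    - by case=> -[_ ->]; rewrite eqxx ?orbT.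
    - by move/eqP ->; left.
    - by case=> -[// _ ->].
    - by move/eqP ->; right.
    - by case=> -[// _ ->].
    - by [].
    - by case=> -[].
  move=> x; split.
  + move=> [Dx ex]; apply/sE; have fx := edge_in_face ab ac ex.
    have [v [va v0 lx]] := (trD a x fx).1 Dx.
    case: (uniq4_cases v u) => E; rewrite E ?eqxx // in va v0 lx.
    * by left; split=> //; exact: edge_level lx.
    * right; split=> //; rewrite k2E; apply: edge_level lx => //.
      by case: ex => tx x0; split=> // o oc ob; exact: x0.
    * by case: (corner_edge u v0 (trle _ _ va) ex lx).
  + move/sE; case=> -[h0 ->].
    * have ex : edge b c (P k1) by apply: Pe; rewrite e /k1; clear -tb; lia.
      split=> //; apply/(trD a _ (edge_in_face ab ac ex)).
      by exists b; split=> //; rewrite level_edge_point.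
    * have ex : edge b c (P k2) by apply: Pe; rewrite /k2 e; clear -h0; lia.
      split=> //; apply/(trD a _ (edge_in_face ab ac ex)).
      by exists c; split=> //; rewrite k2E level_edge_point.
Qed.

End Traces.

(** * All the pieces of one tetrahedron *)

Section TetraPieces.
Variables (R : realType) (t : 'I_4 -> nat) (m : 'I_3) (q : nat) (o : bool).

Definition corners (a b : 'I_4) : nat :=
  (t b + (if o then (~~ same_side m a b : nat) else if same_side m a b then q else 0))%N.

Definition crossings (u v : 'I_4) : nat :=
  (t u + t v + (if o then (if same_side m u v then 2 else 1)
                else if same_side m u v then 0 else q))%N.

Notation lev := (level crossings).

Lemma crossings_sym u v : crossings u v = crossings v u.
Proof. by rewrite /crossings same_sideC (addnC (t u)). Qed.

Lemma crossings_corners a b c : uniq [:: a; b; c] ->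
  crossings b c = (corners a b + corners a c)%N.
Proof.
move=> /one_more[d u]; rewrite /crossings /corners.
case: (same_side_cases m u) => s.
- have [_ -> _ -> _] := same_side_uniq u s; rewrite s; case: o => /=; lia.
- have u' : uniq [:: a; c; b; d] by rewrite uniq4_swap23.
  have [_ -> _ s' _] := same_side_uniq u' s; rewrite (same_sideC m b) s' s; case: o => /=; lia.
- have u' : uniq [:: a; d; b; c] by rewrite uniq4_swap23 uniq4_swap34.
  by have [-> -> -> _ _] := same_side_uniq u' s; case: o => /=; lia.
Qed.

Lemma crossings_ge u v : (t u + t v <= crossings u v)%N.
Proof. by rewrite leq_addr. Qed.

(** Separates triangles at different vertices: their levels at a common point would add up to at
    most [t u + t v]. *)
Lemma level_pair u v (x : 'rV[R]_4) : u != v -> tetra x ->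
  (t u + t v)%N.+1%:R <= lev u x + lev v x.
Proof.
move=> uv tx; have [c [d w]] := two_more uv.
have w1 : uniq [:: v; u; c; d] by rewrite uniq4_swap12.
rewrite (levelE _ _ w) (levelE _ _ w1) (crossings_sym v u).
have := tetra_sum4 w tx; have := tx.1 u; have := tx.1 v; have := tx.1 c; have := tx.1 d.
have h : (t u + t v)%N.+1%:R <= (crossings u v).+1%:R :> R by rewrite ler_nat ltnS crossings_ge.
have h' z : (t u + t v)%N.+1%:R <= (crossings u z).+1%:R + (crossings v z).+1%:R :> R.
  by rewrite -natrD ler_nat; have := crossings_ge u z; have := crossings_ge v z; lia.
move: (h' c) (h' d) h; clear.
move: (crossings _ _).+1%:R (crossings _ _).+1%:R (crossings _ _).+1%:R => w1 w2 w3.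
move: (crossings _ _).+1%:R (crossings _ _).+1%:R => w4 w5.
move: (x 0 u) (x 0 v) (x 0 c) (x 0 d) => xu xv xc xd; move: _.+1%:R => k.
move=> hc hd h d0 c0 v0 u0 e.
have := ler_wpM2r c0 hc; have := ler_wpM2r d0 hd; have := ler_wpM2r u0 h; have := ler_wpM2r v0 h.
by move: e; clear => e; rewrite -[k]mulr1 -e; nra.
Qed.

Lemma same_side_left a b z : same_side m a b -> same_side m z b = same_side m z a.
Proof. by rewrite /same_side => /eqP ->. Qed.

Lemma same_side_negl a b z : same_side m a b = false -> same_side m z b = ~~ same_side m z a.
Proof. by rewrite /same_side; do 3!case: (_ || _). Qed.

(* In the face opposite the partner of [b] this is [level b - t b] if [b] is in
   the block of vertex 0, and [t b + q + 1 - level b] otherwise.  Hence the quadrilaterals [quad_level = 1, ..., q]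
   continue the numbering of the triangles around every vertex. *)
Definition quad_level (x : 'rV[R]_4) : R :=
  \sum_u (if same_side m ord0 u then - (t u)%:R else (t u + q).+1%:R) * x 0 u.

(** The numbering of the quadrilaterals as seen from [a], reversed when [a] is not in the block of
    vertex 0. *)
Definition side_level (a : 'I_4) (x : 'rV[R]_4) : R :=
  if same_side m ord0 a then quad_level x else q.+1%:R - quad_level x.

Definition side_index (a : 'I_4) (l : nat) : nat :=
  if same_side m ord0 a then l else (q.+1 - l)%N.

Lemma side_levelE a b c d x : uniq [:: a; b; c; d] -> same_side m a b -> tetra x ->
  side_level a x = (t c + q).+1%:R * x 0 c + (t d + q).+1%:R * x 0 d -
                   (t a)%:R * x 0 a - (t b)%:R * x 0 b.
Proof.
move=> u s tx; have [_ sc sd _ _] := same_side_uniq u s.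
rewrite /side_level /quad_level (big_uniq4 _ u) (same_side_left _ s) (same_side_negl _ sc).
rewrite (same_side_negl _ sd); case: (same_side m ord0 a) => /=.
  by rewrite !mulNr; move: (_ * _) (_ * _) (_ * _) (_ * _) => p1 p2 p3 p4; lra.
have := tetra_sum4 u tx; rewrite -!natr1 !natrD; nra.
Qed.

(** The middle term vanishes on the face opposite the partner [b], where the quadrilaterals continue
    the numbering of the triangles, and is nonnegative everywhere, which keeps the quadrilaterals
    beyond the triangles at [a]. *)
Lemma level_side a b c d x : o = false -> uniq [:: a; b; c; d] -> same_side m a b -> tetra x ->
  lev a x = (t a)%:R + (t b + t b).+1%:R * x 0 b + side_level a x.
Proof.
move=> oF u s tx; rewrite (side_levelE u s tx).
have u' : uniq [:: b; a; c; d] by rewrite uniq4_swap12.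
have [_ sc sd _ _] := same_side_uniq u s.
rewrite (levelE _ _ u') /crossings s sc sd oF addn0 -!natr1 !natrD.
have := tetra_sum4 u tx; nra.
Qed.

Lemma side_level_index a l x : (l <= q)%N ->
  quad_level x = l%:R <-> side_level a x = (side_index a l)%:R.
Proof.
move=> lq; rewrite /side_level /side_index; case: ifP => // _.
rewrite natrB; last exact: leqW.
split=> [->//|]; lra.
Qed.

Definition quad_piece l : set 'rV[R]_4 := [set x | tetra x /\ quad_level x = l%:R].
Definition tri_piece v k : set 'rV[R]_4 := [set x | tetra x /\ lev v x = k%:R].
Definition oct_piece : set 'rV[R]_4 :=
  [set x | exists a b c d, oct_labels m a b c d /\ oct_set t m a b c d x].

Lemma oct_pieceE a b c d : oct_labels m a b c d -> oct_piece = oct_set t m a b c d.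
Proof.
move=> l; apply/seteqP; split=> [x [a' [b' [c' [d' [l']]]]]|x Ox].
  by rewrite (oct_set_labels R t l' l).
by exists a, b, c, d.
Qed.

Lemma side_index_gt0 a l : (0 < l <= q)%N -> (0 < side_index a l)%N.
Proof. by rewrite /side_index; case: ifP => _; lia. Qed.

Lemma quad_piece_level v l x : o = false -> (0 < l <= q)%N -> quad_piece l x ->
  (t v).+1%:R <= lev v x.
Proof.
move=> oF l0 [tx lx]; have [b [c [d [u s]]]] := side_partner m v.
have lq : (l <= q)%N by case/andP: l0.
rewrite (level_side oF u s tx) ((side_level_index v x lq).1 lx) -natr1.
have : 1 <= (side_index v l)%:R :> R by rewrite (ler_nat _ 1) side_index_gt0.
have : 0 <= (t b + t b).+1%:R * x 0 b by rewrite mulr_ge0// tx.1.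
lra.
Qed.

Lemma oct_piece_level v x : o -> oct_piece x -> (t v).+1%:R <= lev v x.
Proof.
move=> ot; have [b [c [d l]]] := side_partner m v; rewrite (oct_pieceE l) => /(level_oct_point l).
by rewrite /crossings ot.
Qed.

Lemma tri_piece_disc v k : (0 < k <= t v)%N -> properly_embedded_disc (tri_piece v k).
Proof.
move=> /andP[k0 kt]; have [a [b [c [u _]]]] := side_partner m v.
have u' : uniq [:: a; v; b; c] by rewrite uniq4_swap12.
have r z : 0 < (k%:R / (crossings v z).+1%:R : R) < 1.
  have [|h1 h2] := @ratio_bounds_lt R k (crossings v z).
    by rewrite k0 (leq_trans kt)// (leq_trans _ (crossings_ge _ _))// leq_addr.
  by rewrite h1 -subr_gt0.
apply: (tri_disc u (r a) (r b) (r c)) => x.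
have kR : k%:R != 0 :> R by rewrite pnatr_eq0 -lt0n.
rewrite !invf_div !mulrA -!mulrDl -!(mulrC _.+1%:R) -(levelE _ _ u').
split=> -[tx e]; split=> //; first by rewrite e divff.
by apply: (mulIf (invr_neq0 kR)); rewrite e divff.
Qed.

Lemma quad_piece_disc l : (0 < l <= q)%N -> properly_embedded_disc (quad_piece l).
Proof.
move=> /andP[l0 lq]; have [b [c [d [u s]]]] := side_partner m ord0.
(* The equation [quad_level = l] is made homogeneous by multiplying [l] by the sum of the
   coordinates; separating the two blocks then leaves four positive coefficients. *)
have pos4 (k : nat) : 0 < (k + l)%:R :> R by rewrite ltr0n; lia.
have pos4' (k : nat) : 0 < (k + (q.+1 - l))%:R :> R by rewrite ltr0n; lia.
apply: (quad_disc u (pos4 (t ord0)) (pos4 (t b)) (pos4' (t c)) (pos4' (t d))) => x.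
have e : tetra x -> quad_level x = side_level ord0 x by rewrite /side_level /same_side eqxx.
split=> -[tx h]; split=> //; move: h; rewrite (e tx) (side_levelE u s tx);
  have := tetra_sum4 u tx; rewrite !natrD !(natrB _ (leqW lq)) -!natr1 ?natrD; clear => h1 h2.
- have := congr1 (fun z => l%:R * z) h1; rewrite mulr1 -{2}h2; lra.
- have := congr1 (fun z => l%:R * z) h1; rewrite mulr1; lra.
Qed.

Lemma oct_piece_disc : o -> properly_embedded_disc oct_piece.
Proof.
move=> ot; have [b [c [d l]]] := side_partner m ord0; rewrite (oct_pieceE l).
exact: oct_disc.
Qed.

(** Triangles by vertex and level, quadrilaterals by position, and ['I_o] for the octagon, with the
    Boolean [o] read as 0 or 1. *)
Definition label : finType := ({v : 'I_4 & 'I_(t v)} + ('I_q + 'I_o))%type.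

Definition label_type (l : label) : disc_type :=
  match l with inl p => Tri (tag p) | inr (inl _) => Quad m | inr (inr _) => Oct m end.

Definition label_set (l : label) : set 'rV[R]_4 :=
  match l with
  | inl p => tri_piece (tag p) (tagged p).+1
  | inr (inl k) => quad_piece k.+1
  | inr (inr _) => oct_piece
  end.

(* The piece [l] meets face [a] in the arcs cutting off a corner [b] at level
   [label_trace l a b], when this is positive. *)
Definition label_trace (l : label) (a b : 'I_4) : nat :=
  match l with
  | inl p => if b == tag p then (tagged p).+1 else 0
  | inr (inl k) => if same_side m a b then (t b + side_index b k.+1)%N else 0
  | inr (inr _) => if same_side m a b then 0 else (t b).+1
  end.

Hypothesis oq : o -> q = 0%N.

Lemma quad_notoct : 'I_q -> o = false.
Proof. by case: o oq => // /(_ isT) -> []. Qed.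

Lemma oct_isoct : 'I_o -> o.
Proof. by case; case: o. Qed.

Lemma label_disc l : properly_embedded_disc (label_set l).
Proof.
case: l => [[v k]|[k|k]] /=; [apply: tri_piece_disc|apply: quad_piece_disc|];
  rewrite ?ltn_ord//.
exact: oct_piece_disc (oct_isoct k).
Qed.

Lemma side_index_le a l : (0 < l <= q)%N -> (side_index a l <= q)%N.
Proof. by rewrite /side_index; case: ifP => _; lia. Qed.

Lemma label_trace_le l a b : b != a -> (label_trace l a b <= corners a b)%N.
Proof.
move=> ba; rewrite /corners; case: l => [[v k]|[k|k]] /=.
- case: eqVneq => // ->; have := ltn_ord k; lia.
- case: ifP => // s; rewrite (quad_notoct k) leq_add2l.
  by apply: side_index_le; rewrite /= ltn_ord.
- by case: ifP => // s; rewrite (oct_isoct k) /= addn1.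
Qed.

Lemma side_uniq_others a b c d : uniq [:: a; b; c; d] ->
  (same_side m a b + same_side m a c + same_side m a d)%N = 1%N.
Proof.
move=> u; case: (same_side_cases m u) => s.
- by have [_ -> -> _ _] := same_side_uniq u s; rewrite s.
- have u' : uniq [:: a; c; b; d] by rewrite uniq4_swap23.
  by have [_ -> -> _ _] := same_side_uniq u' s; rewrite s.
- have u' : uniq [:: a; d; b; c] by rewrite uniq4_swap23 uniq4_swap34.
  by have [_ -> -> _ _] := same_side_uniq u' s; rewrite s.
Qed.

Lemma same_side_opp a b c d : uniq [:: a; b; c; d] -> same_side m b c = same_side m a d.
Proof.
move=> u; have u' : uniq [:: a; d; b; c] by rewrite uniq4_swap23 uniq4_swap34.
have u'' : uniq [:: b; c; a; d] by move: u; rewrite !uniq4E (eq_sym a b) (eq_sym a c); lia.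
apply/idP/idP => s; first by have [] := same_side_uniq u'' s.
by have [] := same_side_uniq u' s.
Qed.

Lemma label_trace_face l a b c d : uniq [:: a; b; c; d] ->
  ((0 < label_trace l a b) + (0 < label_trace l a c) + (0 < label_trace l a d))%N =
  face_arcs (label_type l) a.
Proof.
move=> u; have S := side_uniq_others u; case: l => [[v k]|[k|k]] /=.
- have p z : (0 < (if z == v then (k : nat).+1 else 0))%N = (z == v) by case: ifP.
  rewrite !p; have [[ab ac ad] [bc bd cd]] := uniq4_ne u.
  move=> {p k}; case: (uniq4_cases v u) => ->; rewrite ?eqxx.
  + by rewrite !(eq_sym _ a) (negPf ab) (negPf ac) (negPf ad).
  + by rewrite !(eq_sym _ b) (negPf bc) (negPf bd) eq_sym ab.
  + by rewrite (eq_sym d) (negPf bc) (negPf cd) ac.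
  + by rewrite (negPf bd) (negPf cd) ad.
- have p z : (0 < (if same_side m a z then t z + side_index z k.+1 else 0))%N = same_side m a z.
    by case: ifP => // _; rewrite addn_gt0 side_index_gt0 ?orbT//= ltn_ord.
  by rewrite !p.
- have p z : (0 < (if same_side m a z then 0 else (t z).+1))%N = ~~ same_side m a z by case: ifP.
  by rewrite !p; move: S; do 3!case: (same_side _ _ _).
Qed.

Lemma label_trace_edge l a b c d : uniq [:: a; b; c; d] ->
  ((0 < label_trace l a b) + (0 < label_trace l a c))%N = edge_weight (label_type l) b c.
Proof.
move=> u; have S := side_uniq_others u; have O := same_side_opp u; case: l => [[v k]|[k|k]] /=.
- have p z : (0 < (if z == v then (k : nat).+1 else 0))%N = (z == v) by case: ifP.
  rewrite !p => {p k}; have [_ [bc _ _]] := uniq4_ne u.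
  case: (eqVneq b v) bc => [->|_ _]; last by case: eqVneq.
  by rewrite eq_sym => /negPf ->.
- have p z : (0 < (if same_side m a z then t z + side_index z k.+1 else 0))%N = same_side m a z.
    by case: ifP => // _; rewrite addn_gt0 side_index_gt0 ?orbT//= ltn_ord.
  by rewrite !p O; move: S; do 3!case: (same_side _ _ _).
- have p z : (0 < (if same_side m a z then 0 else (t z).+1))%N = ~~ same_side m a z by case: ifP.
  by rewrite !p O; move: S; do 3!case: (same_side _ _ _).
Qed.

Lemma label_set_face l a x : face a x -> label_set l x <->
  exists b, [/\ b != a, (0 < label_trace l a b)%N & lev b x = (label_trace l a b)%:R].
Proof.
move=> fx; have [tx xa] := fx; case: l => [[v k]|[k|k]] /=.
- split=> [[_ lx]|[b [ba]]]; last by case: eqVneq => // -> _ lx; split.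
  exists v; rewrite eqxx; split=> //; apply/negP => /eqP E; rewrite E in k lx *.
  have := @level_low R crossings a x (t a) tx xa _.
  rewrite lx ler_nat ltnNge ltn_ord => h; suff : ~~ true by []; apply: h => u _ _.
  by rewrite ltnS (leq_trans _ (crossings_ge _ _))// leq_addr.
- have oF := quad_notoct k; have kq : (0 < k.+1 <= q)%N by rewrite /= ltn_ord.
  have key b c d : uniq [:: a; b; c; d] -> same_side m a b ->
      (quad_level x = k.+1%:R <-> lev b x = (t b + side_index b k.+1)%N%:R).
    move=> u s; have u' : uniq [:: b; a; c; d] by rewrite uniq4_swap12.
    rewrite (level_side oF u' _ tx) 1?same_sideC// xa mulr0 addr0 natrD.
    have := side_level_index b x (ltn_ord k) => h; rewrite h.
    by split=> [->//|/addrI].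
  split.
    move=> [_ lx]; have [b [c [d [u s]]]] := side_partner m a.
    have [[ba _ _] _] := uniq4_en u; exists b; rewrite s; split=> //.
      by rewrite addn_gt0 side_index_gt0 ?orbT.
    exact/(key b c d u s).
  move=> [b [ba]]; case: ifP => // s _ lx; split=> //.
  have [|c [d u]] := @two_more a b; first by rewrite eq_sym.
  exact/(key b c d u s).
- have ot := oct_isoct k; have [b [c [d [u s]]]] := side_partner m a.
  have l : oct_labels m a b c d by [].
  rewrite (oct_pieceE l) (oct_trace t l fx).
  have -> : octw t m = crossings by apply/funext=> u1; apply/funext=> u2; rewrite /crossings ot.
  have [_ sc sd _ _] := same_side_uniq u s; have [[ba ca da] _] := uniq4_en u.
  split; first by case=> h; [exists c; rewrite sc|exists d; rewrite sd].
  move=> [z [za]]; case: ifP => // sz _ lz.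
  case: (uniq4_cases z u) => E; rewrite E ?eqxx // in za sz lz *.
  - by rewrite s in sz.
  - by left.
  - by right.
Qed.

Lemma label_normal l : normal_piece (label_type l) (label_set l).
Proof.
apply: (normal_piece_trace crossings_sym crossings_corners) (label_disc l) _ _ _ _.
- exact: label_trace_le.
- by move=> a x; exact: label_set_face.
- exact: label_trace_face.
- exact: label_trace_edge.
Qed.

(** The numbering about a corner has no gaps: the triangles take the levels up to [t b], and the
    quadrilaterals counted from the side of [b], or the octagon, take the rest. *)
Lemma label_onto a b k : b != a -> (0 < k <= corners a b)%N ->
  exists l, label_trace l a b = k.
Proof.
move=> ba /andP[k0]; rewrite /corners => kc.
case: (ltnP k (t b).+1) => kt.
  have k1 : (k.-1 < t b)%N by clear -k0 kt; lia.
  by exists (inl (Tagged (fun v => 'I_(t v)) (Ordinal k1))); rewrite /= eqxx prednK.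
move: kc; case: ifP => ot.
  case s : (same_side m a b) => /= kc; first by clear -kt kc; lia.
  have o0 : (0 < o)%N by rewrite ot.
  pose z : 'I_o := Ordinal o0; exists (inr (inr z) : label); rewrite /= s.
  by clear -kt kc; lia.
case: ifP => s kc; last by clear -kt kc; lia.
pose j := (k - t b)%N; have j0 : (0 < j <= q)%N by rewrite /j; clear -kt kc; lia.
have jq : ((side_index b j).-1 < q)%N by have := side_index_le b j0; have := side_index_gt0 b j0; lia.
exists (inr (inl (Ordinal jq))); rewrite /= s prednK ?side_index_gt0//.
have -> : side_index b (side_index b j) = j.
  by move: j0; rewrite /side_index; case: (same_side m ord0 b) => //; clear; lia.
by rewrite /j subnKC// ltnW.
Qed.

(** In a face the union of the pieces is described by corner counts and edge crossings alone, with
    no reference to the kinds of pieces. This is what lets different tetrahedra match. *)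
Lemma labels_face a x : face a x -> (exists l, label_set l x) <->
  exists b k, [/\ b != a, (0 < k <= corners a b)%N & lev b x = k%:R].
Proof.
move=> fx; split=> [[l /(label_set_face l fx)[b [ba b0 lx]]]|[b [k [ba kc lx]]]].
  by exists b, (label_trace l a b); rewrite b0 label_trace_le.
have [l lk] := label_onto ba kc; exists l; apply/(label_set_face l fx).
by exists b; rewrite lk; split=> //; case/andP: kc.
Qed.

(** Triangles at one vertex, and quadrilaterals among themselves, lie on different levels;
    [level_pair] separates triangles at different vertices. Quadrilaterals and the octagon lie
    beyond all triangles, and they do not occur together. *)
Lemma label_set_disjoint l l' x : label_set l x -> label_set l' x -> l = l'.
Proof.
have tt v k v' k' : (k < t v)%N -> (k' < t v')%N -> v != v' -> tri_piece v k.+1 x ->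
    tri_piece v' k'.+1 x -> False.
  move=> kt kt' vv [tx h] [_ h']; have := level_pair vv tx; rewrite h h' -natrD ler_nat.
  by clear -kt kt'; lia.
have low v (k : 'I_(t v)) : (t v).+1%:R <= lev v x -> tri_piece v k.+1 x -> False.
  by move=> h [_ lx]; move: h; rewrite lx ler_nat ltnS leqNgt ltn_ord.
case: l => [[v k]|[k|k]]; case: l' => [[v' k']|[k'|k']] //=.
- have [E|vv] := eqVneq v v'; last by move=> h h'; case: (tt _ _ _ _ (ltn_ord k) (ltn_ord k') vv h h').
  move: k'; rewrite -E => k' [_ e1] [_]; rewrite e1 => /eqP; rewrite eqr_nat eqSS => /eqP e.
  by congr (inl (Tagged _ _)); exact: val_inj.
- move=> h h'; case: (low v k) => //; apply: quad_piece_level (quad_notoct k') _ h'.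
  by rewrite /= ltn_ord.
- by move=> h h'; case: (low v k) => //; apply: oct_piece_level h'; exact: oct_isoct k'.
- move=> h' h; case: (low v' k') => //; apply: quad_piece_level (quad_notoct k) _ h'.
  by rewrite /= ltn_ord.
- by move=> [_ e1] [_]; rewrite e1 => /eqP; rewrite eqr_nat eqSS => /eqP e; congr (inr (inl _)); exact: val_inj.
- by have e := quad_notoct k; move: (oct_isoct k') => e'; exfalso; move: e'; rewrite e.
- by move=> h' h; case: (low v' k') => //; apply: oct_piece_level h'; exact: oct_isoct k.
- by have e := quad_notoct k'; move: (oct_isoct k) => e'; exfalso; move: e'; rewrite e.
- move=> _ _; congr (inr (inr _)); apply: val_inj => /=; move: k k'; case: o => /= k k'.
    by case: k => -[|//] ?; case: k' => -[|//] ?.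
  by case: k.
Qed.

End TetraPieces.

(** * The surface with a given vector *)

Lemma card_enum_val (U : finType) (P : pred U) :
  #|[pred l : 'I_#|U| | P (enum_val l)]| = #|P|.
Proof.
rewrite -!sum1_card [RHS](reindex (@enum_val U predT)) //.
exact: onW_bij (enum_val_bij U).
Qed.

Section Counts.
Variables (t : 'I_4 -> nat) (m : 'I_3) (q : nat) (o : bool).

Lemma label_quads m' :
  #|[pred l : label t q o | is_quad m' (label_type m l)]| = ((m == m') * q)%N.
Proof.
rewrite -sum1_card big_mkcond /= !big_sumType /= 2?big1_eq addn0 add0n.
under eq_bigr do rewrite inE /=.
by rewrite sum_nat_const card_ord mulnC; case: (m == m').
Qed.

Lemma label_octs m' :
  #|[pred l : label t q o | is_oct m' (label_type m l)]| = ((m == m') * o)%N.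
Proof.
rewrite -sum1_card big_mkcond /= !big_sumType /= 2?big1_eq !add0n.
under eq_bigr do rewrite inE /=.
by rewrite sum_nat_const card_ord mulnC; case: (m == m').
Qed.

End Counts.

Lemma face_step_level (R : realType) n (T : face_gluing n) (W W' : 'I_4 -> 'I_4 -> nat)
    i a j s (x y : 'rV[R]_4) b : glue T i a = Some (j, s) -> face a x ->
  (forall v, y 0 (s v) = x 0 v) ->
  (forall u, u != a -> u != b -> W b u = W' (s b) (s u)) -> b != a ->
  level W b x = level W' (s b) y.
Proof.
move=> g [tx xa] xy WW ba; rewrite /level [RHS](reindex_inj (@perm_inj _ s)) /=.
apply: eq_bigr => u _; rewrite xy (inj_eq perm_inj).
have [//|ub] := eqVneq u b.
by have [->|ua] := eqVneq u a; [rewrite xa !mulr0|rewrite WW].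
Qed.

Lemma face_step_face (R : realType) n (T : face_gluing n) i a j s (x y : 'rV[R]_4) :
  glue T i a = Some (j, s) -> face a x -> (forall v, y 0 (s v) = x 0 v) -> face (s a) y.
Proof.
move=> g [[x0 x1] xa] xy; split; last by rewrite xy.
split; first by move=> v; rewrite -(permKV s v) xy.
by rewrite (reindex_inj (@perm_inj _ s)) -[RHS]x1; apply: eq_bigr => v _.
Qed.

(** * Assembling the surface *)

Section Construction.
Variables (R : realType) (n : nat) (T : face_gluing n) (w : 'M[int]_(n, 3)).
Variable p : 'I_n -> 'I_4 -> int.
Hypothesis p_gt0 : forall i u, 0 < p i u.
Hypothesis p_glue : forall i a j s u, glue T i a = Some (j, s) -> a != u ->
  p i u + w i (quad_separating a u) = p j (s u) + w j (quad_separating (s a) (s u)).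
Hypothesis wq : quad_constraints w.
Hypothesis wneg : forall i m, w i m < 0 -> w i m = -1.

(** If all three coordinates vanish, the default type carries no quadrilateral and no octagon. *)
Definition used_type i : 'I_3 := odflt ord0 [pick m | w i m != 0].
Definition has_oct i : bool := w i (used_type i) < 0.
Definition quad_number i : nat := if has_oct i then 0 else `|w i (used_type i)|%N.
(** [p] counts triangles and octagon together, so the octagon is taken off; since [p] is positive
    the subtraction is not truncated. *)
Definition tri_number i u : nat := (`|p i u| - has_oct i)%N.

Lemma quad_number_oct i : has_oct i -> quad_number i = 0%N.
Proof. by rewrite /quad_number => ->. Qed.

Lemma used_typeE i m : m != used_type i -> w i m = 0.
Proof.
rewrite /used_type; case: pickP => /= [m' m'0|no] mm; last first.
  by have := no m; move=> /negbFE/eqP.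
by apply: contraNeq mm => m0; apply/eqP; exact: (wq m0 m'0).
Qed.

Lemma coordE i m : w i m =
  ((used_type i == m) * quad_number i)%N%:Z - ((used_type i == m) * has_oct i)%N%:Z.
Proof.
have [<-|mm] := eqVneq (used_type i) m; last by rewrite used_typeE// eq_sym.
rewrite !mul1n /quad_number; case o: (has_oct i); first by rewrite wneg.
by rewrite subr0 gez0_abs// leNgt; apply/negbT.
Qed.

Notation ncorn i := (corners (tri_number i) (used_type i) (quad_number i) (has_oct i)).
Notation ncross i := (crossings (tri_number i) (used_type i) (quad_number i) (has_oct i)).
Notation lab i := (label (tri_number i) (quad_number i) (has_oct i)).

(** The counterpart of [face_corner_joint] for the prescribed numbers; through it [p_glue] becomes
    the equality of corner counts in glued faces. *)
Lemma cornersE i a b : a != b -> (ncorn i a b)%:Z = p i b + w i (quad_separating a b).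
Proof.
move=> ab; rewrite coordE /corners (same_side_sepE _ ab) /tri_number.
have := p_gt0 i b; have := @quad_number_oct i.
case: (has_oct i) => /=; [move=> -> //|move=> _]; case: eqP => _ /=; lia.
Qed.

Lemma corners_glue i a j s u : glue T i a = Some (j, s) -> a != u ->
  ncorn i a u = ncorn j (s a) (s u).
Proof.
move=> g au; apply/eqP; rewrite -eqz_nat !cornersE// ?(inj_eq perm_inj)//.
by rewrite (p_glue g au).
Qed.

Lemma crossings_glue i a j s u v : glue T i a = Some (j, s) -> uniq [:: a; u; v] ->
  ncross i u v = ncross j (s u) (s v).
Proof.
move=> g auv; have suv : uniq [:: s a; s u; s v].
  by rewrite -(map_inj_uniq (@perm_inj _ s)) in auv.
rewrite (crossings_corners _ _ _ _ auv) (crossings_corners _ _ _ _ suv).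
move: auv; rewrite /= !inE negb_or => /and3P[/andP[au av] _ _].
by rewrite (corners_glue g au) (corners_glue g av).
Qed.

Definition built_surface : pieces R n :=
  @Pieces R n (fun i => #|lab i|)
    (fun i l => label_type (used_type i) (enum_val l))
    (fun i l => label_set (R := R) (used_type i) (enum_val l)).

Lemma carrier_built i x :
  carrier built_surface i x <-> exists l : lab i, label_set (R := R) (used_type i) l x.
Proof.
split=> [[l _ lx]|[l lx]]; first by exists (enum_val l).
by exists (enum_rank l); rewrite //= enum_rankK.
Qed.

(** By [labels_face] the trace in a face is given by levels up to the corner counts. Corner counts
    and crossings are both preserved by the gluing, and so are the levels. *)
Lemma built_saturated : saturated T (carrier built_surface).
Proof.
split=> [i x /carrier_built[l lx]|[i x] [j y] /= [a [s [/= g fx xy]]] /carrier_built].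
  by have [h [_ _ _ sub _]] := label_disc R (used_type i) l; exact: sub.
move=> /(labels_face _ _ (@quad_number_oct i) fx)[b [k [ba kc lx]]].
have fy := face_step_face g fx xy; apply/carrier_built.
apply/(labels_face _ _ (@quad_number_oct j) fy); exists (s b), k.
have ab : a != b by rewrite eq_sym.
rewrite (inj_eq perm_inj) -(corners_glue g ab); split=> //.
rewrite -lx; apply/esym; apply: (face_step_level g fx xy) => // u ua ub.
by apply: (crossings_glue g); rewrite /= !inE !negb_or !(eq_sym a) ba ua eq_sym ub.
Qed.

Lemma built_made : made_of_pieces T built_surface.
Proof.
split; last exact: built_saturated.
- by move=> i l; exact: (label_normal R (used_type i) (@quad_number_oct i) (enum_val l)).
- move=> i; apply/trivIsetP => l l' _ _ ll'; apply/seteqP; split=> // x [lx lx'].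
  move/eqP: ll'; apply; apply: enum_val_inj.
  exact: (label_set_disjoint (@quad_number_oct i) lx lx').
Qed.

Lemma built_octs i m : oct_count built_surface i m = ((used_type i == m) * has_oct i)%N.
Proof. by rewrite /oct_count (card_enum_val (fun l : lab i => is_oct m (label_type _ l))) label_octs. Qed.

Lemma built_quads i m : quad_count built_surface i m = ((used_type i == m) * quad_number i)%N.
Proof. by rewrite /quad_count (card_enum_val (fun l : lab i => is_quad m (label_type _ l))) label_quads. Qed.

Lemma built_joint : joint_vector built_surface = w.
Proof. by apply/matrixP => i m; rewrite joint_vectorE built_octs built_quads -coordE. Qed.

Lemma built_total : total_octs built_surface = (\sum_i has_oct i)%N.
Proof.
apply: eq_bigr => i _; under eq_bigr do rewrite built_octs.
rewrite (bigD1 (used_type i))//= eqxx mul1n big1 ?addn0// => m mm.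
by rewrite eq_sym (negPf mm).
Qed.

End Construction.

Lemma total_octs_joint_ge0 (R : realType) n (S : pieces R n) : total_octs S = 0%N ->
  forall i m, 0 <= joint_vector S i m.
Proof.
move=> tot i m; rewrite joint_vectorE; have := oct_count_le S i m; rewrite tot leqn0 => /eqP ->.
by rewrite subr0.
Qed.

Lemma joint_surface (R : realType) (n : nat) (T : face_gluing n) (w : 'M[int]_(n, 3)) :
  (forall i v, homeomorphic_to T (vertex_link (R := R) T i v) (@sphere_set R 3) \/
               homeomorphic_to T (vertex_link (R := R) T i v) (@ball_set R 2)) ->
  matching_equations R T w -> quad_constraints w -> (forall i m, w i m < 0 -> w i m = -1) ->
  exists S : pieces R n, [/\ made_of_pieces T S, joint_vector S = w &
    total_octs S = (\sum_i has_oct w i)%N].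
Proof.
move=> links match_w quad_w neg_w; have [p [p0 pg]] := vertex_potential links match_w.
exists (built_surface R w p); split.
- exact: built_made.
- exact: built_joint.
- exact: built_total.
Qed.

Theorem theorem8p5 (R : realType) (n : nat) (T : face_gluing n)
    (hT : compact_3manifold_triangulation R T) (w : 'M[int]_(n, 3)) :
  ((exists S : pieces R n,
      (embedded_normal T S \/ octagonal_almost_normal T S) /\
      joint_vector S = w) <->
   [/\ forall i m i' m', w i m < 0 -> w i' m' < 0 -> (i, m) = (i', m'),
       matching_equations R T w,
       quad_constraints w &
       forall i m, w i m < 0 -> w i m = -1]) /\
  ((exists S : pieces R n,
      (embedded_normal T S \/ octagonal_almost_normal T S) /\
      joint_vector S = w) ->
   ((exists S : pieces R n, embedded_normal T S /\ joint_vector S = w) <->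
    forall i m, 0 <= w i m)).
Proof.
have fwd : (exists S : pieces R n, (embedded_normal T S \/ octagonal_almost_normal T S) /\
    joint_vector S = w) -> [/\ forall i m i' m', w i m < 0 -> w i' m' < 0 -> (i, m) = (i', m'),
    matching_equations R T w, quad_constraints w & forall i m, w i m < 0 -> w i m = -1].
  by move=> [S [hS <-]]; exact: joint_conditions.
split; first split=> // -[uniq_w match_w quad_w neg_w].
- have [S [mS jS tot]] := joint_surface hT.2 match_w quad_w neg_w.
  exists S; split=> //; case: (pselect (exists i, has_oct w i)) => [[i oi]|no].
    (* Uniqueness of the negative coordinate excludes an octagon in any other tetrahedron. *)
    right; split=> //; rewrite tot (bigD1 i)//= oi big1// => j ji.
    apply/eqP; rewrite eqb0; apply: contra ji => oj.
    by have [->] := uniq_w _ _ _ _ oj oi.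
  left; split=> //; rewrite tot big1// => i _; apply/eqP; rewrite eqb0.
  by apply/negP => oi; apply: no; exists i.
- move=> ex; have [_ match_w quad_w neg_w] := fwd ex; split.
    by move=> [S [[_ tot] <-]]; exact: total_octs_joint_ge0.
  (* The surface given by [ex] supplies only the conditions on [w]. A new one is built from them,
     and with no negative coordinate it has no octagon. *)
  move=> w0; have [S [mS jS tot]] := joint_surface hT.2 match_w quad_w neg_w.
  exists S; split=> //; split=> //; rewrite tot big1// => i _; apply/eqP; rewrite eqb0.
  by rewrite /has_oct -leNgt.
Qed.
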